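(* Let $k\ge6$ be an even integer, let $f\in\mathcal{B}_k(1)$ and let $\chi$ be a primitive Dirichlet character modulo $q$, $q\ge1$. Then for any $s\in\mathbb{C}$, $$L(s,f\times\chi) = i^k\,\epsilon_\chi^2\,q^{1-2s}\,\frac{\gamma_k(1-s)}{\gamma_k(s)}\,L(1-s,f\times\overline{\chi}),$$ where $L(s,f\times\chi)$ and $L(s,f\times\overline{\chi})$ are understood through their analytic continuations to $\mathbb{C}$ (and the identity as one of meromorphic functions).
   Context: $\mathcal{B}_k(1)$ is an orthogonal basis (with respect to the Petersson inner product) of the space of holomorphic cusp forms of level $1$ and weight $k$, consisting of Hecke eigenforms, where $f\in\mathcal{B}_k(1)$ has Fourier expansion $f(z)=\sum_{n\ge1}\lambda_f(n)n^{(k-1)/2}e(nz)$ with $\lambda_f(1)=1$ and $e(z):=e^{2\pi i z}$. For $\mathrm{Re}\, s\gg1$, $L(s,f\times\chi):=\sum_{n\ge1}\lambda_f(n)\chi(n)n^{-s}$. The normalized Gauss sum is $\epsilon_\chi:=\frac{1}{\sqrt q}\sum_{\alpha\,(\mathrm{mod}\,q)}\chi(\alpha)e(\alpha/q)$. The gamma factor is $$\gamma_k(s):=2^{(3-k)/2}\sqrt{\pi}\,(2\pi)^{-s}\,\Gamma\left(s+\frac{k-1}{2}\right)=\pi^{-s}\,\Gamma\left(\frac{s+\frac{k-1}{2}}{2}\right)\Gamma\left(\frac{s+\frac{k+1}{2}}{2}\right).$$ *)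

(* Defs.v *)
From HB Require Import structures.
From mathcomp Require Import all_boot all_order all_algebra.
From mathcomp Require Import all_classical all_reals all_analysis.
From mathcomp Require Import complex.

Set Implicit Arguments.
Unset Strict Implicit.
Unset Printing Implicit Defensive.

Import Order.TTheory GRing.Theory Num.Theory.
Import numFieldNormedType.Exports.

Local Open Scope classical_set_scope.
Local Open Scope complex_scope.
Local Open Scope ring_scope.

(* the usual topology and norm on R[i] *)
HB.instance Definition _ (R : realType) := NormedModule.copy R[i] R[i]^o.

Section ComplexAnalysis.
Variable R : realType.
Local Notation C := R[i].
Local Notation Re := (@complex.Re R).
Local Notation Im := (@complex.Im R).

Definition cexp (z : C) : C :=
  (expR (Re z))%:C * (cos (Im z) +i* sin (Im z)).

(* e(z) = exp(2 pi i z) *)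
Definition e2pi (z : C) : C := cexp ((2 * pi)%:C * 'i%C * z).

(* a^s for a real base a > 0; only meant for such a *)
Definition cpow (a : R) (s : C) : C := cexp ((ln a)%:C * s).

Definition holomorphic_on (D : set C) (f : C -> C) : Prop :=
  forall z : C, D z -> derivable f z 1.

Definition cintegral d (T : measurableType d)
    (mu : {measure set T -> \bar R}) (D : set T) (f : T -> C) : C :=
  (\int[mu]_(x in D) Re (f x)) +i* (\int[mu]_(x in D) Im (f x)).

(* Euler's integral for Re s > 0 *)
Definition Gamma_integral (s : C) : C :=
  cintegral lebesgue_measure `]0, +oo[
    (fun t : R => cpow t (s - 1) * (expR (- t))%:C).

(* Outside Re s > 0, Gamma is continued by
   Gamma(s) = Gamma(s + m) / (s (s + 1) ... (s + m - 1)) with Re (s + m) > 0.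
   At the poles 0, -1, -2, ... the denominator vanishes and the value is 0,
   so that 1 / Gamma takes there its correct value 0. *)
Definition cGamma (s : C) : C :=
  let m := if 0 < Re s then 0%N else `|Num.floor (Re s)|.+1%N in
  Gamma_integral (s + m%:R) / \prod_(j < m) (s + j%:R).

Definition gamma_factor (k : nat) (s : C) : C :=
  cpow 2 ((3 - k%:R) / 2) * (Num.sqrt pi)%:C * cpow (2 * pi) (- s)
  * cGamma (s + (k%:R - 1) / 2).

End ComplexAnalysis.

Section ModularForms.
Variable R : realType.
Local Notation C := R[i].
Local Notation Re := (@complex.Re R).
Local Notation Im := (@complex.Im R).

(* Functions on the upper half-plane are represented by functions on all of C;
   their values outside of it are never used. *)
Definition upper_half_plane : set C := [set z | 0 < Im z].

(* f(z) = \sum_(n >= 1) c(n) e(n z) on the upper half-plane; c 0 is unused *)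
Definition fourier_expansion (f : C -> C) (c : nat -> C) : Prop :=
  forall z, upper_half_plane z ->
    series (fun n => c n.+1 * e2pi (n.+1%:R * z)) @ \oo --> f z.

Definition modular (k : nat) (f : C -> C) : Prop :=
  forall (a b c d : int) (z : C), a * d - b * c = 1 -> upper_half_plane z ->
    f ((a%:~R * z + b%:~R) / (c%:~R * z + d%:~R))
    = (c%:~R * z + d%:~R) ^+ k * f z.

Definition cusp_form (k : nat) (f : C -> C) : Prop :=
  [/\ holomorphic_on upper_half_plane f, modular k f
    & exists c : nat -> C, fourier_expansion f c].

(* (T_n f)(z) = n^(k-1) \sum_(a d = n) d^(-k) \sum_(0 <= b < d) f((a z + b)/d) *)
Definition hecke (k n : nat) (f : C -> C) (z : C) : C :=
  n%:R ^+ k.-1 * \sum_(d <- divisors n)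
    d%:R ^- k * \sum_(b < d) f (((n %/ d)%:R * z + b%:R) / d%:R).

Definition hecke_eigenform (k : nat) (f : C -> C) : Prop :=
  cusp_form k f /\
  forall n : nat, (0 < n)%N -> exists a : C,
    forall z, upper_half_plane z -> hecke k n f z = a * f z.

Definition fundamental_domain : set (R * R) :=
  [set p | `|p.1| <= 1 / 2 /\ 1 <= p.1 ^+ 2 + p.2 ^+ 2 /\ 0 < p.2].

(* integral of f(z) conj(g(z)) y^k dx dy / y^2 *)
Definition petersson (k : nat) (f g : C -> C) : C :=
  cintegral (lebesgue_measure \x lebesgue_measure)%E fundamental_domain
    (fun p : R * R => f (p.1 +i* p.2) * (g (p.1 +i* p.2))^*
                      * (p.2 ^+ k / p.2 ^+ 2)%:C).

Definition cusp_form_basis (k r : nat) (B : 'I_r -> C -> C) : Prop :=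
  (forall j, cusp_form k (B j)) /\
  forall g, cusp_form k g -> exists! x : 'rV[C]_r,
    forall z, upper_half_plane z -> g z = \sum_(j < r) x 0 j * B j z.

(* lambda j n is the normalized coefficient lambda_f(n) of f = B j *)
Definition hecke_basis (k r : nat) (B : 'I_r -> C -> C)
    (lambda : 'I_r -> nat -> C) : Prop :=
  [/\ cusp_form_basis k B,
      forall i j, i != j -> petersson k (B i) (B j) = 0,
      forall j, hecke_eigenform k (B j),
      forall j, fourier_expansion (B j)
        (fun n => lambda j n * cpow n%:R ((k%:R - 1) / 2))
    & forall j, lambda j 1%N = 1].

End ModularForms.

Section DirichletCharacters.
Variable R : realType.
Local Notation C := R[i].
Local Notation Re := (@complex.Re R).

Definition dirichlet_character (q : nat) (chi : int -> C) : Prop :=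
  [/\ forall m n : int, chi (m * n) = chi m * chi n,
      forall m n : int, (m = n %[mod q%:Z])%Z -> chi m = chi n
    & forall n : int, (chi n != 0) = coprimez n q%:Z].

Definition primitive_character (q : nat) (chi : int -> C) : Prop :=
  dirichlet_character q chi /\
  ~ exists (d : nat) (psi : int -> C),
      [/\ (d %| q)%N, (d < q)%N, dirichlet_character d psi
        & forall n : int, coprimez n q%:Z -> chi n = psi n].

Definition conj_character (chi : int -> C) : int -> C := fun n => (chi n)^*.

Definition normalized_gauss_sum (q : nat) (chi : int -> C) : C :=
  (Num.sqrt q%:R)%:C^-1 * \sum_(a < q) chi a%:Z * e2pi (a%:R / q%:R).

Definition twisted_dirichlet_series (lambda : nat -> C) (chi : int -> C)
    (s : C) : nat -> C :=
  series (fun n => lambda n.+1 * chi n.+1%:Z * cpow n.+1%:R (- s)).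

(* F is the (by the identity theorem, unique) analytic continuation to C of
   L(s, f x chi), which is given by its Dirichlet series for Re s large. *)
Definition analytic_continuation_L (lambda : nat -> C) (chi : int -> C)
    (F : C -> C) : Prop :=
  holomorphic_on setT F /\
  exists sigma : R, forall s : C, sigma < Re s ->
    twisted_dirichlet_series lambda chi s @ \oo --> F s.

End DirichletCharacters.

(* Main.v *)
(* Hecke's argument. Write c(n) = lambda(n) n^((k-1)/2). By expansion of chi in
   additive characters, F_chi(y) = \sum_n c(n) chi(n) exp(-2 pi n y / q) is the
   multiple by 1/g(conj chi) of \sum_u conj chi(u) f((u + i y)/q), where g is
   the Gauss sum. The matrix (a, b; q, -u) with a u = -1 mod q maps (u + i/y)/q
   to (a + i y)/q, so modularity gives F_chi(1/y) = w y^k F_(conj chi)(y) with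
   w = i^k epsilon_chi^2; and w(chi) w(conj chi) = 1 as
   g(chi) g(conj chi) = chi(-1) q. The Mellin transform of F_chi, folded at
   y = 1, is Lambda(s) = M_F(s) + w M_G(k - s), where G = F_(conj chi) and
   M_F(s) is the integral of F(y) y^(s-1) over y >= 1. It is entire and visibly
   satisfies the functional equation, and it equals
   (2 pi / q)^(-s) Gamma(s) L(s - (k-1)/2, f x chi) for Re s large. Since 1/Gamma
   is entire, L continues to the plane.
   Convergence uses c(n) = O(n^(k/2)): Dirichlet approximation moves any z with
   Im z <= 1 by SL_2(Z) to height at least 1/5, where f(z) (Im z)^(k/2) is
   bounded by the Fourier expansion; hence |f(z)| = O((Im z)^(-k/2)), and c(n) is
   estimated by averaging f over the height 1/n. *)

Require Import Defs.
From mathcomp Require Import all_boot all_order all_algebra.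
From mathcomp Require Import all_classical all_reals all_analysis.
From mathcomp Require Import measurable_realfun.
From mathcomp Require Import complex ring lra.
From mathcomp Require cyclic.

Set Implicit Arguments.
Unset Strict Implicit.
Unset Printing Implicit Defensive.

Import Order.TTheory GRing.Theory Num.Theory.
Import numFieldNormedType.Exports.

Local Open Scope classical_set_scope.
Local Open Scope complex_scope.
Local Open Scope ring_scope.

(** * Complex numbers and the complex exponential *)

(** The analysis runs on norm estimates alone. Holomorphy is proved with an error term O(|h|^2),
    which survives integration, and sums are exchanged with integrals by means of a tail bound of
    the form const / (N + 1) times a fixed function of y. To keep every integral on [1, oo[, each
    single exponential is folded at y = 1 before summation; only then is F(1/y) replaced by means of
    the inversion formula. That 1/Gamma is entire requires Gamma to have no zeros, and this comes
    from the concentration of the Gamma density along s + n rather than from a product or reflection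
    formula. Since [cGamma] is 0 at the poles, 1/Gamma has its true value everywhere and the
    continuation is a plain product of entire functions. Gamma(1 - s + (k-1)/2) itself, on the other
    side of the functional equation, has a wrong value at its poles: hence the excluded points.
    Primitivity of chi acts through one fact: for each proper divisor d of q some unit m = 1 mod d
    has chi(m) different from 1. This makes the Gauss sums twisted by non-units vanish. *)

Section ComplexNorm.
Variable R : realType.
Local Notation C := R[i].
Local Notation Re := (@complex.Re R).
Local Notation Im := (@complex.Im R).
Local Notation nm := (@Normc.normc R).
Implicit Types (z w s : C) (a b t : R).

Lemma normcE z : `|z| = (nm z)%:C.
Proof. by case: z. Qed.

Lemma nm_ge0 z : 0 <= nm z.
Proof. by case: z => x y; exact: sqrtr_ge0. Qed.

Lemma nm0 : nm 0 = 0.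
Proof. exact: Normc.normc0. Qed.

Lemma nm1 : nm 1 = 1.
Proof. exact: Normc.normc1. Qed.

Lemma nmN z : nm (- z) = nm z.
Proof. exact: normcN. Qed.

Lemma nmM z w : nm (z * w) = nm z * nm w.
Proof. exact: Normc.normcM. Qed.

Lemma nmV z : nm z^-1 = (nm z)^-1.
Proof. exact: Normc.normcV. Qed.

Lemma nmD z w : nm (z + w) <= nm z + nm w.
Proof. exact: le_normcD. Qed.

Lemma nmB z w : nm (z - w) <= nm z + nm w.
Proof. by rewrite -(nmN w) nmD. Qed.

Lemma nm_distC z w : nm (z - w) = nm (w - z).
Proof. by rewrite -nmN opprB. Qed.

Lemma nm_eq0 z : (nm z == 0) = (z == 0).
Proof. by apply/eqP/eqP => [/Normc.eq0_normc//|->]; exact: nm0. Qed.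

Lemma nm_gt0 z : z != 0 -> 0 < nm z.
Proof. by rewrite -nm_eq0 lt_def nm_ge0 andbT. Qed.

Lemma nm_real a : nm a%:C = `|a|.
Proof. by rewrite /= expr0n addr0 sqrtr_sqr. Qed.

Lemma nm_nat (n : nat) : nm n%:R = n%:R.
Proof. by rewrite -(rmorph_nat (real_complex R)) nm_real ger0_norm. Qed.

Lemma nmX z n : nm (z ^+ n) = nm z ^+ n.
Proof. by elim: n => [|n IH]; rewrite ?expr0 ?nm1// !exprS nmM IH. Qed.

Lemma nm_sum (I : Type) (r : seq I) (P : pred I) (F : I -> C) :
  nm (\sum_(i <- r | P i) F i) <= \sum_(i <- r | P i) nm (F i).
Proof.
elim/big_ind2 : _ => //; first by rewrite nm0.
by move=> a b c d ab cd; apply: (le_trans (nmD _ _)); exact: lerD.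
Qed.

Lemma nm_Re z : `|Re z| <= nm z.
Proof.
by case: z => x y /=; rewrite -sqrtr_sqr; apply: ler_wsqrtr; rewrite lerDl sqr_ge0.
Qed.

Lemma nm_Im z : `|Im z| <= nm z.
Proof.
by case: z => x y /=; rewrite -sqrtr_sqr; apply: ler_wsqrtr; rewrite lerDr sqr_ge0.
Qed.

Lemma nm_le z : nm z <= `|Re z| + `|Im z|.
Proof.
case: z => x y /=.
rewrite -[leRHS]ger0_norm ?addr_ge0// -sqrtr_sqr; apply: ler_wsqrtr.
rewrite sqrrD !real_normK ?num_real//.
by rewrite lerD2r lerDl mulrn_wge0// mulr_ge0.
Qed.

Lemma nm_i : nm 'i%C = 1.
Proof. by rewrite /= expr0n add0r expr1n sqrtr1. Qed.

Lemma Re_nat (n : nat) : Re n%:R = n%:R.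
Proof. by rewrite -(rmorph_nat (real_complex R)). Qed.

Lemma ReD z w : Re (z + w) = Re z + Re w.
Proof. by case: z; case: w. Qed.

Lemma ImD z w : Im (z + w) = Im z + Im w.
Proof. by case: z; case: w. Qed.

Lemma ReN z : Re (- z) = - Re z.
Proof. by case: z. Qed.

Lemma ImN z : Im (- z) = - Im z.
Proof. by case: z. Qed.

Lemma ReM z w : Re (z * w) = Re z * Re w - Im z * Im w.
Proof. by case: z; case: w. Qed.

Lemma ImM z w : Im (z * w) = Re z * Im w + Im z * Re w.
Proof. by case: z => a b; case: w. Qed.

Lemma ReZ a z : Re (a%:C * z) = a * Re z.
Proof. by rewrite ReM /= mul0r subr0. Qed.

Lemma ImZ a z : Im (a%:C * z) = a * Im z.
Proof. by rewrite ImM /= mul0r addr0. Qed.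

Lemma ReZr a z : Re (z * a%:C) = Re z * a.
Proof. by rewrite mulrC ReZ mulrC. Qed.

Lemma ImZr a z : Im (z * a%:C) = Im z * a.
Proof. by rewrite mulrC ImZ mulrC. Qed.

(** In the partial order of [R[i]] a positive element is a positive real, so real tolerances
    suffice. *)
Lemma cvgCP (u : nat -> C) (l : C) :
  (u @ \oo --> l) <->
  (forall e : R, 0 < e -> exists N, forall n, (N <= n)%N -> nm (u n - l) <= e).
Proof.
split.
- move=> /cvgrPdist_le ul e e0.
  have e0' : 0 < e%:C by rewrite ltcR.
  have [N _ HN] := ul _ e0'; exists N => n Nn.
  by have := HN n Nn; rewrite normcE lecR nm_distC.
- move=> H; apply/cvgrPdist_le => e e0.
  have eR : e = (Re e)%:C.
    by move: e0; rewrite ltcE /=; case: e => ea eb /= /andP[/eqP -> _].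
  have e0' : 0 < Re e by move: e0; rewrite {1}eR ltcR.
  have [N HN] := H _ e0'; exists N => // n /= Nn.
  by rewrite eR normcE lecR nm_distC; exact: HN.
Qed.

Lemma series_ord (u : nat -> C) n : series u n = \sum_(i < n) u i.
Proof. by rewrite /series /= big_mkord. Qed.

Lemma cvgZC (u : nat -> C) (l a : C) : u @ \oo --> l -> (fun n => a * u n) @ \oo --> a * l.
Proof. move=> /cvgCP h; apply/cvgCP => e e0.
have a1 : 0 < nm a + 1 by rewrite ltr_wpDl// nm_ge0.
have [N hN] := h _ (divr_gt0 e0 a1); exists N => n Nn.
rewrite -mulrBr nmM; apply: le_trans (ler_wpM2l (nm_ge0 _) (hN n Nn)) _.
rewrite mulrA ler_pdivrMr// mulrC; apply: ler_wpM2l; [exact: ltW|rewrite lerDl; exact: ler01]. Qed.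

Lemma cvg_sumC (n : nat) (u : 'I_n -> nat -> C) (l : 'I_n -> C) :
  (forall j, u j @ \oo --> l j) ->
  (fun m => \sum_(j < n) u j m) @ \oo --> \sum_(j < n) l j.
Proof.
elim: n u l => [|n IH] u l h.
  by rewrite big_ord0 (_ : (fun m => _) = fun=> 0); [apply: cvg_cst|apply/funext => m; rewrite big_ord0].
rewrite big_ord_recr (_ : (fun m => _) = (fun m => \sum_(j < n) u (widen_ord (leqnSn n) j) m + u ord_max m)).
  by apply: cvgD; [apply: IH|apply: h].
by apply/funext => m; rewrite big_ord_recr.
Qed.

End ComplexNorm.

Section ComplexExp.
Variable R : realType.
Local Notation C := R[i].
Local Notation Re := (@complex.Re R).
Local Notation Im := (@complex.Im R).
Local Notation nm := (@Normc.normc R).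
Implicit Types (z w s : C) (a b t : R).

Lemma cexpD z w : cexp (z + w) = cexp z * cexp w.
Proof.
rewrite /cexp; case: z => a b; case: w => c d /=.
rewrite expRD cosD sinD; simpc; rewrite /real_complex_def.
by apply/eqP; rewrite eq_complex /=; apply/andP; split; apply/eqP; ring.
Qed.

Lemma cexp0 : cexp 0 = 1 :> C.
Proof.
by rewrite /cexp /= expR0 cos0 sin0; simpc.
Qed.

Lemma cexp_real a : cexp a%:C = (expR a)%:C.
Proof. by rewrite /cexp /= cos0 sin0; simpc. Qed.

Lemma nm_cexp z : nm (cexp z) = expR (Re z).
Proof.
rewrite /cexp nmM nm_real gtr0_norm ?expR_gt0//=.
by rewrite cos2Dsin2 sqrtr1 mulr1.
Qed.

Lemma cexp_neq0 z : cexp z != 0.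
Proof. by rewrite -nm_eq0 nm_cexp gt_eqF// expR_gt0. Qed.

Lemma cexpN z : cexp (- z) = (cexp z)^-1.
Proof.
by apply: (mulIf (cexp_neq0 z)); rewrite -cexpD addNr cexp0 mulVf// cexp_neq0.
Qed.

Lemma cexpMn z n : cexp (n%:R * z) = cexp z ^+ n.
Proof.
elim: n => [|n IH]; first by rewrite mul0r cexp0 expr0.
by rewrite -[n.+1]addn1 natrD mulrDl mul1r cexpD IH addn1 exprSr.
Qed.

Lemma expR_le_expn n t : 0 <= t -> t ^+ n <= n`!%:R * expR t.
Proof.
case: n => [|n] t0.
  by rewrite expr0 fact0 mul1r -expR0 ler_expR.
have := expR_ge1Dxn n t0.
have f0 : 0 < n.+1`!%:R :> R by rewrite ltr0n fact_gt0.
move=> H; rewrite mulrC -ler_pdivrMr//; apply: le_trans H.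
by rewrite lerDr.
Qed.

Lemma expRN_quad t : 0 <= t -> 0 <= expR (- t) - 1 + t <= t ^+ 2.
Proof.
move=> t0; apply/andP; split; first by have := expR_ge1Dx (- t); lra.
have h : expR (- t) <= (1 + t)^-1.
  rewrite expRN lef_pV2 ?posrE ?expR_gt0 ?expR_ge1Dx//; lra.
have t1 : 0 < 1 + t by lra.
apply: (@le_trans _ _ ((1 + t)^-1 - 1 + t)); first lra.
have -> : (1 + t)^-1 - 1 + t = t ^+ 2 / (1 + t) by field; rewrite gt_eqF.
by rewrite ler_pdivrMr// mulrDr mulr1 lerDl mulr_ge0// sqr_ge0.
Qed.

Lemma MVT_le (f df : R -> R) t :
  (forall x : R, is_derive x (1:R) f (df x)) ->
  exists2 c : R, `|c| <= `|t| & f t - f 0 = df c * t.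
Proof.
move=> fd.
have cf (a b : R) : {within `[a, b], continuous f}.
  apply: derivable_within_continuous => x _; exact: ex_derive.
have [t0|t0|t0] := ltgtP 0 t.
- have [c] := MVT t0 (fun x _ => fd x) (cf _ _).
  rewrite in_itv/= => /andP[c0 ct] E; exists c; last by rewrite E subr0.
  by rewrite !gtr0_norm// ltW.
- have [c] := MVT t0 (fun x _ => fd x) (cf _ _).
  rewrite in_itv/= => /andP[c0 ct] E; exists c.
    by rewrite !ltr0_norm// lerN2 ltW.
  by rewrite -opprB E sub0r mulrN opprK.
- by exists 0; rewrite -t0 ?subrr ?mulr0.
Qed.

Lemma sin_le t : `|sin t| <= `|t|.
Proof.
have [c _] := MVT_le t (@is_derive_sin R).
rewrite sin0 subr0 => ->; rewrite normrM -[leRHS]mul1r.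
by apply: ler_wpM2r => //; exact: cos_max.
Qed.

Lemma cos_quad t : `|cos t - 1| <= t ^+ 2.
Proof.
have [c ct] := MVT_le t (@is_derive_cos R).
rewrite cos0 => ->; rewrite normrM normrN -(real_normK (num_real t)) expr2.
by apply: ler_wpM2r => //; apply: (le_trans (sin_le c)).
Qed.

Lemma sin_quad t : `|sin t - t| <= t ^+ 2.
Proof.
have dd (x : R) : is_derive x (1:R) (fun x : R => sin x - x) (cos x - 1).
  by apply: is_deriveB.
have [c ct] := MVT_le t dd.
rewrite sin0 !subr0 => ->; rewrite normrM -(real_normK (num_real t)) expr2.
apply: ler_wpM2r => //.
have [c' _] := MVT_le c (@is_derive_cos R).
rewrite cos0 => ->; rewrite normrM normrN.
by apply: le_trans ct; rewrite -[leRHS]mul1r; apply: ler_wpM2r => //; exact: sin_max.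
Qed.

Lemma expR_lip t : `|expR t - 1| <= `|t| * expR `|t|.
Proof.
have [c ct] := MVT_le t (@is_derive_expR R).
rewrite expR0 => ->; rewrite normrM mulrC; apply: ler_wpM2l => //.
rewrite ger0_norm ?expR_ge0// ler_expR; apply: le_trans ct; exact: ler_norm.
Qed.

Lemma expR_quad t : `|expR t - 1 - t| <= t ^+ 2 * expR `|t|.
Proof.
have dd (x : R) : is_derive x (1:R) (fun x : R => expR x - x) (expR x - 1).
  by apply: is_deriveB.
have [c ct] := MVT_le t dd.
rewrite expR0 subr0 => E.
have -> : expR t - 1 - t = (expR c - 1) * t by rewrite -E; ring.
rewrite normrM -(real_normK (num_real t)) expr2 mulrAC; apply: ler_wpM2r => //.
apply: (le_trans (expR_lip c)); by apply: ler_pM => //; rewrite ler_expR.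
Qed.

(** The source of all derivative estimates below. The constant 4 is 2 + 1 + 1: the trigonometric
    remainders, the remainder of e^a, and the mixed term i (e^a - 1) b. *)
Lemma cexp_quad z : nm (cexp z - 1 - z) <= 4 * nm z ^+ 2 * expR (nm z).
Proof.
case: z => a b.
set z := a +i* b.
have -> : cexp z - 1 - z =
  (expR a)%:C * ((cos b - 1) +i* (sin b - b)) + (expR a - 1 - a)%:C
  + ((expR a - 1) * b)%:C * 'i%C.
  rewrite /cexp /z /=; apply/eqP; rewrite eq_complex; apply/andP; split; apply/eqP;
  rewrite /= /real_complex_def /=; ring.
have az : `|a| <= nm z by exact: (nm_Re z).
have bz : `|b| <= nm z by exact: (nm_Im z).
have e0 := expR_ge0 (nm z).
have ea : expR `|a| <= expR (nm z) by rewrite ler_expR.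
have n0 := nm_ge0 z.
have b2 : b ^+ 2 <= nm z ^+ 2.
  by rewrite -(real_normK (num_real b)) ler_pXn2r ?nnegrE.
have a2 : a ^+ 2 <= nm z ^+ 2.
  by rewrite -(real_normK (num_real a)) ler_pXn2r ?nnegrE.
have h1 : nm ((expR a)%:C * ((cos b - 1) +i* (sin b - b)))
    <= 2 * nm z ^+ 2 * expR (nm z).
  rewrite nmM nm_real mulrC; apply: ler_pM; rewrite ?nm_ge0 ?normr_ge0//.
    apply: (le_trans (nm_le _)) => /=; rewrite mulr_natl mulr2n.
    by apply: lerD; [exact: le_trans (cos_quad b) b2 | exact: le_trans (sin_quad b) b2].
  rewrite ger0_norm ?expR_ge0//; apply: le_trans ea; rewrite ler_expR; exact: ler_norm.
have h2 : nm (expR a - 1 - a)%:C <= nm z ^+ 2 * expR (nm z).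
  rewrite nm_real; apply: (le_trans (expR_quad a)); apply: ler_pM => //.
  exact: sqr_ge0.
have h3 : nm (((expR a - 1) * b)%:C * 'i%C) <= nm z ^+ 2 * expR (nm z).
  rewrite nmM nm_i mulr1 nm_real normrM expr2 mulrAC; apply: ler_pM => //.
  apply: (le_trans (expR_lip a)); by apply: ler_pM.
apply: (le_trans (nmD _ _)); have := nmD ((expR a)%:C * ((cos b - 1) +i* (sin b - b))) (expR a - 1 - a)%:C.
lra.
Qed.

Lemma cpowDr a s w : cpow a (s + w) = cpow a s * cpow a w.
Proof. by rewrite /cpow mulrDr cexpD. Qed.

Lemma cpow_neq0 a s : cpow a s != 0.
Proof. exact: cexp_neq0. Qed.

Lemma cpowN a s : cpow a (- s) = (cpow a s)^-1.
Proof. by rewrite /cpow mulrN cexpN. Qed.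

Lemma cpowMl a b s : 0 < a -> 0 < b -> cpow (a * b) s = cpow a s * cpow b s.
Proof. by move=> a0 b0; rewrite /cpow lnM ?posrE// rmorphD mulrDl cexpD. Qed.

Lemma cpowV a s : 0 < a -> cpow a^-1 s = cpow a (- s).
Proof. by move=> a0; rewrite /cpow lnV ?posrE// rmorphN mulNr mulrN. Qed.

Lemma cpow1r a : 0 < a -> cpow a 1 = a%:C.
Proof. by move=> a0; rewrite /cpow mulr1 cexp_real lnK. Qed.

Lemma cpow_nat a n : 0 < a -> cpow a n%:R = (a ^+ n)%:C.
Proof.
by move=> a0; rewrite /cpow mulrC cexpMn cexp_real lnK// rmorphXn.
Qed.

Lemma nm_cpow a s : 0 < a -> nm (cpow a s) = a `^ Re s.
Proof.
by move=> a0; rewrite /cpow nm_cexp ReZ /powR gt_eqF// mulrC.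
Qed.

Lemma cpow_real a b : 0 < a -> cpow a b%:C = (a `^ b)%:C.
Proof.
by move=> a0; rewrite /cpow -rmorphM cexp_real /powR gt_eqF// mulrC.
Qed.

End ComplexExp.

(** * Complex derivatives with a quadratic error term *)

Section QuadraticDerivative.
Variable R : realType.
Local Notation C := R[i].
Local Notation nm := (@Normc.normc R).
Implicit Types (f g : C -> C) (z w h a : C).

(* With a quadratic error term instead of o(h), differentiation under the
   integral sign is a plain norm estimate. *)
Definition qderivable f z := exists l (M d : R), 0 < d /\
  forall h, nm h <= d -> nm (f (z + h) - f z - l * h) <= M * nm h ^+ 2.

Lemma qderivable_derivable f z : qderivable f z -> derivable f z 1.
Proof.
move=> [l [M [d [d0 H]]]].
apply/cvg_ex; exists l; apply/cvgrPdist_le => e e0.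
have eR : e = (complex.Re e)%:C.
  by move: e0; rewrite ltcE /=; case: e => ea eb /= /andP[/eqP -> _].
have e0' : 0 < complex.Re e by move: e0; rewrite {1}eR ltcR.
set r := complex.Re e in eR e0'.
have M1 : 0 < `|M| + 1 by rewrite ltr_wpDl.
set d' := Num.min d (r / (`|M| + 1)).
have d'0 : 0 < d' by rewrite lt_min d0/= divr_gt0.
have d'C : 0 < d'%:C by rewrite ltcR.
rewrite near_withinE; apply/nbhs_norm0P; exists d'%:C => // h /=.
rewrite normcE ltcR => hd h0; rewrite eR normcE lecR.
have hd1 : nm h <= d by rewrite (le_trans (ltW hd))// ge_min lexx.
have hd2 : nm h <= r / (`|M| + 1) by rewrite (le_trans (ltW hd))// ge_min lexx orbT.
have := H h hd1.
have hn : 0 < nm h by exact: nm_gt0.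
have -> : f (z + h) - f z - l * h = - h * (l - h^-1 *: (f (h *: 1 + z) - f z)).
  rewrite /GRing.scale /= mulr1 [h + z]addrC mulrBr mulNr mulNr mulrA divff// mul1r.
  by rewrite (mulrC h) opprK [RHS]addrC.
rewrite nmM nmN expr2 mulrCA (ler_pM2l hn) => HH; apply: (le_trans HH).
apply: (@le_trans _ _ ((`|M| + 1) * nm h)).
  by apply: ler_wpM2r; rewrite ?nm_ge0//; have := ler_norm M; lra.
by rewrite mulrC -ler_pdivlMr.
Qed.

Lemma qderivable_lip f z : qderivable f z -> exists (M d : R), 0 < d /\
  forall h, nm h <= d -> nm (f (z + h) - f z) <= M * nm h.
Proof.
move=> [l [M [d [d0 H]]]]; exists (`|M| * d + nm l), d; split => // h hd.
have -> : f (z + h) - f z = (f (z + h) - f z - l * h) + l * h by ring.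
apply: (le_trans (nmD _ _)); rewrite mulrDl nmM; apply: lerD => //.
apply: (le_trans (H h hd)); rewrite expr2 mulrA; apply: ler_wpM2r; first exact: nm_ge0.
apply: (@le_trans _ _ (`|M| * nm h)).
  by apply: ler_wpM2r; rewrite ?nm_ge0// ler_norm.
exact: ler_wpM2l.
Qed.

End QuadraticDerivative.

Arguments Normc.normc : simpl never.
Arguments cexp : simpl never.
Arguments cpow : simpl never.
Arguments cintegral : simpl never.

(** * Integration *)

Section ComplexIntegral.
Variable R : realType.
Local Notation C := R[i].
Local Notation Re := (@complex.Re R).
Local Notation Im := (@complex.Im R).
Local Notation nm := (@Normc.normc R).
Local Notation mu := (@lebesgue_measure R).
Implicit Types (D : set R) (f g : R -> C) (p : R -> R).

Definition cmeasurable D f :=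
  measurable_fun D (fun x => Re (f x)) /\ measurable_fun D (fun x => Im (f x)).

Definition cintegrable D f :=
  mu.-integrable D (EFin \o (fun x => Re (f x))) /\
  mu.-integrable D (EFin \o (fun x => Im (f x))).

Lemma cmeasurableD D f g :
  cmeasurable D f -> cmeasurable D g -> cmeasurable D (fun x => f x + g x).
Proof.
move=> [f1 f2] [g1 g2]; split.
  by under eq_fun do rewrite ReD; exact: measurable_funD.
by under eq_fun do rewrite ImD; exact: measurable_funD.
Qed.

Lemma cmeasurableM D f g :
  cmeasurable D f -> cmeasurable D g -> cmeasurable D (fun x => f x * g x).
Proof.
move=> [f1 f2] [g1 g2]; split.
  by under eq_fun do rewrite ReM; apply: measurable_funB; exact: measurable_funM.
by under eq_fun do rewrite ImM; apply: measurable_funD; exact: measurable_funM.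
Qed.

Lemma cmeasurable_cst D (z : C) : cmeasurable D (fun=> z).
Proof. by split; exact: measurable_cst. Qed.

Lemma cmeasurable_real D p : measurable_fun D p -> cmeasurable D (fun x => (p x)%:C).
Proof. by move=> mp; split => //; exact: measurable_cst. Qed.

Lemma cmeasurable_sum D (I : Type) (r : seq I) (F : I -> R -> C) :
  (forall i, cmeasurable D (F i)) -> cmeasurable D (fun x => \sum_(i <- r) F i x).
Proof.
move=> mF; elim: r => [|i r IH].
  by under eq_fun do rewrite big_nil; exact: cmeasurable_cst.
by under eq_fun do rewrite big_cons; exact: cmeasurableD.
Qed.

Lemma cmeasurable_cexp D f : cmeasurable D f -> cmeasurable D (fun x => cexp (f x)).
Proof.
move=> [f1 f2]; apply: cmeasurableM.
  by apply: cmeasurable_real; apply: measurableT_comp.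
split => /=.
  by apply: (measurableT_comp (f := @cos R)) => //; apply: continuous_measurable_fun; exact: continuous_cos.
by apply: (measurableT_comp (f := @sin R)) => //; apply: continuous_measurable_fun; exact: continuous_sin.
Qed.

Lemma cmeasurable_cpow D (s : C) : measurable D -> cmeasurable D (fun x => cpow x s).
Proof.
move=> mD; apply: cmeasurable_cexp; apply: cmeasurableM; last exact: cmeasurable_cst.
by apply: cmeasurable_real; exact: measurable_funTS.
Qed.

Lemma cmeasurable_cvg D (F : nat -> R -> C) f : (forall n, cmeasurable D (F n)) ->
  (forall x, D x -> F ^~ x @ \oo --> f x) -> cmeasurable D f.
Proof.
move=> mF Ff; split.
- apply: (@measurable_fun_cvg _ _ _ _ (fun n x => Re (F n x))) => [n|x Dx].
    by have [] := mF n.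
  apply/cvgrPdist_le => e e0; have /cvgCP /(_ e e0) [N HN] := Ff x Dx.
  exists N => // n Nn; rewrite -normrN opprB; apply: le_trans (HN n Nn).
  by rewrite -ReN -ReD; exact: nm_Re.
- apply: (@measurable_fun_cvg _ _ _ _ (fun n x => Im (F n x))) => [n|x Dx].
    by have [] := mF n.
  apply/cvgrPdist_le => e e0; have /cvgCP /(_ e e0) [N HN] := Ff x Dx.
  exists N => // n Nn; rewrite -normrN opprB; apply: le_trans (HN n Nn).
  by rewrite -ImN -ImD; exact: nm_Im.
Qed.

Lemma le_Rintegrable D p q : measurable D -> measurable_fun D p ->
  mu.-integrable D (EFin \o q) -> (forall x, D x -> `|p x| <= q x) ->
  mu.-integrable D (EFin \o p).
Proof.
move=> mD mp iq pq; apply: (@le_integrable _ _ R mu D mD _ (EFin \o q)) => //.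
  exact/measurable_EFinP.
move=> x Dx /=; rewrite lee_fin; apply: le_trans (pq x Dx) _; exact: ler_norm.
Qed.

Lemma le_cintegrable D f p : measurable D -> cmeasurable D f ->
  mu.-integrable D (EFin \o p) -> (forall x, D x -> nm (f x) <= p x) ->
  cintegrable D f.
Proof.
move=> mD [m1 m2] ip fp; split; apply: (le_Rintegrable mD _ ip) => // x Dx.
  exact: le_trans (nm_Re _) (fp x Dx).
exact: le_trans (nm_Im _) (fp x Dx).
Qed.

Lemma eq_cintegrable D f g : measurable D -> (forall x, D x -> f x = g x) ->
  cintegrable D f -> cintegrable D g.
Proof.
by move=> mD fg [h1 h2]; split; [apply: eq_integrable h1|apply: eq_integrable h2] => //
  x; rewrite inE => /fg /= ->.
Qed.

Lemma cintegrableD D f g : measurable D ->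
  cintegrable D f -> cintegrable D g -> cintegrable D (fun x => f x + g x).
Proof.
move=> mD [f1 f2] [g1 g2]; split; rewrite /comp.
  by under eq_fun do rewrite ReD EFinD; exact: integrableD.
by under eq_fun do rewrite ImD EFinD; exact: integrableD.
Qed.

Lemma RintegrableZl D (k : R) p : measurable D ->
  mu.-integrable D (EFin \o p) -> mu.-integrable D (EFin \o (fun x => k * p x)).
Proof. by move=> mD ip; rewrite /comp; under eq_fun do rewrite EFinM; exact: integrableZl. Qed.

Lemma RintegrableD D p q : measurable D -> mu.-integrable D (EFin \o p) ->
  mu.-integrable D (EFin \o q) -> mu.-integrable D (EFin \o (fun x => p x + q x)).
Proof. by move=> mD ip iq; rewrite /comp; under eq_fun do rewrite EFinD; exact: integrableD. Qed.

Lemma RintegrableB D p q : measurable D -> mu.-integrable D (EFin \o p) ->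
  mu.-integrable D (EFin \o q) -> mu.-integrable D (EFin \o (fun x => p x - q x)).
Proof. by move=> mD ip iq; rewrite /comp; under eq_fun do rewrite EFinB; exact: integrableB. Qed.

Lemma cintegrableZ D (z : C) f : measurable D ->
  cintegrable D f -> cintegrable D (fun x => z * f x).
Proof.
move=> mD [f1 f2]; split.
  have -> : (fun x => Re (z * f x)) = (fun x => Re z * Re (f x) - Im z * Im (f x)).
    by apply/funext => x; rewrite ReM.
  by apply: RintegrableB => //; exact: RintegrableZl.
have -> : (fun x => Im (z * f x)) = (fun x => Re z * Im (f x) + Im z * Re (f x)).
  by apply/funext => x; rewrite ImM.
by apply: RintegrableD => //; exact: RintegrableZl.
Qed.

Lemma cintegrable0 D : cintegrable D (fun=> 0).
Proof. by split; exact: integrable0. Qed.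

Lemma cintegrable_sum D (I : Type) (r : seq I) (F : I -> R -> C) : measurable D ->
  (forall i, cintegrable D (F i)) -> cintegrable D (fun x => \sum_(i <- r) F i x).
Proof.
move=> mD mF; elim: r => [|i r IH].
  by under eq_fun do rewrite big_nil; exact: cintegrable0.
by under eq_fun do rewrite big_cons; exact: cintegrableD.
Qed.

Lemma eq_cintegral D f g : (forall x, D x -> f x = g x) ->
  cintegral mu D f = cintegral mu D g.
Proof.
move=> fg; rewrite /cintegral; congr Complex; apply: eq_Rintegral => x;
  by rewrite inE => /fg ->.
Qed.

Lemma cintegralD D f g : measurable D -> cintegrable D f -> cintegrable D g ->
  cintegral mu D (fun x => f x + g x) = cintegral mu D f + cintegral mu D g.
Proof.
move=> mD [f1 f2] [g1 g2]; rewrite /cintegral; simpc; congr Complex.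
  by under eq_Rintegral do rewrite ReD; rewrite RintegralD.
by under eq_Rintegral do rewrite ImD; rewrite RintegralD.
Qed.

Lemma cintegralZ D (z : C) f : measurable D -> cintegrable D f ->
  cintegral mu D (fun x => z * f x) = z * cintegral mu D f.
Proof.
move=> mD [f1 f2]; case: z => a b; rewrite /cintegral; simpc; congr Complex.
  under eq_Rintegral do rewrite ReM /=.
  by rewrite RintegralB ?RintegralZl//; exact: RintegrableZl.
under eq_Rintegral do rewrite ImM /=.
by rewrite RintegralD ?RintegralZl//; exact: RintegrableZl.
Qed.

Lemma cintegralB D f g : measurable D -> cintegrable D f -> cintegrable D g ->
  cintegral mu D (fun x => f x - g x) = cintegral mu D f - cintegral mu D g.
Proof.
move=> mD f1 g1; under eq_cintegral do rewrite -(mulN1r (g _)).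
rewrite cintegralD ?cintegralZ ?mulN1r//; exact: cintegrableZ.
Qed.

Lemma cintegral_sum D (I : Type) (r : seq I) (F : I -> R -> C) : measurable D ->
  (forall i, cintegrable D (F i)) ->
  cintegral mu D (fun x => \sum_(i <- r) F i x) = \sum_(i <- r) cintegral mu D (F i).
Proof.
move=> mD mF; elim: r => [|i r IH].
  under eq_cintegral do rewrite big_nil.
  by rewrite big_nil /cintegral /Rintegral !integral0.
under eq_cintegral do rewrite big_cons.
by rewrite big_cons -IH cintegralD//; exact: cintegrable_sum.
Qed.

Lemma cintegral_setU D D' f : measurable D -> measurable D' ->
  cintegrable (D `|` D') f -> [disjoint D & D'] ->
  cintegral mu (D `|` D') f = cintegral mu D f + cintegral mu D' f.
Proof.
by move=> mD mD' [f1 f2] DD; rewrite /cintegral; simpc; congr Complex;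
  rewrite Rintegral_setU.
Qed.

(* The constant 2 is what bounding real and imaginary parts separately gives. *)
Lemma nm_cintegral_le D f p : measurable D -> cintegrable D f ->
  mu.-integrable D (EFin \o p) -> (forall x, D x -> nm (f x) <= p x) ->
  nm (cintegral mu D f) <= 2 * \int[mu]_(x in D) p x.
Proof.
move=> mD [f1 f2] ip fp; apply: (le_trans (nm_le _)) => /=.
rewrite mulr_natl mulr2n; apply: lerD.
- apply: (le_trans (@le_normr_Rintegral _ _ R mu D _ mD f1)); apply: le_Rintegral => //.
    exact: integrable_norm f1.
  by move=> x Dx; exact: le_trans (nm_Re _) (fp x Dx).
- apply: (le_trans (@le_normr_Rintegral _ _ R mu D _ mD f2)); apply: le_Rintegral => //.
    exact: integrable_norm f2.
  by move=> x Dx; exact: le_trans (nm_Im _) (fp x Dx).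
Qed.

End ComplexIntegral.

(** * The substitution t -> 1/t *)

Section HalfLineIntegrals.
Variable R : realType.
Local Notation mu := (@lebesgue_measure R).
Implicit Types (G : R -> R) (a b c t : R).

Lemma derive1_inv t : t != 0 -> ((@GRing.inv R)^`()%classic)%classic t = - t ^- 2.
Proof.
move=> t0; rewrite derive1E.
have did : derivable (id : R -> R) t 1 by exact: derivable_id.
have /= := @deriveV R R id t 1 t0 did.
by rewrite derive_id => ->; rewrite /GRing.scale /= mulr1.
Qed.

(** Substitution on the compact intervals [1/(n+1), 1] and [1, n+1], followed by monotone
    convergence on both sides; this is why G is taken nonnegative here. *)
Lemma ge0_integral_inv G : (forall t, 0 < t -> {for t, continuous G}) ->
  (forall t, 0 < t -> 0 <= G t) ->
  (\int[mu]_(t in `]0%R, 1%R]) (G t)%:E = \int[mu]_(t in `[1%R, +oo[) (G t^-1 * t ^- 2)%:E)%E.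
Proof.
move=> cG G0.
pose A (n : nat) := `[(n.+1%:R : R)^-1, 1]%classic.
pose B (n : nat) := `[(1 : R), n.+1%:R]%classic.
have UA : \bigcup_n A n = `]0, (1:R)]%classic.
  apply/seteqP; split => t /=.
    move=> [n _]; rewrite /A /= !in_itv/= => /andP[h1 ->]; rewrite andbT.
    by apply: lt_le_trans h1; rewrite invr_gt0.
  rewrite in_itv/= => /andP[t0 t1]; exists (Num.bound t^-1) => //.
  rewrite /A /= in_itv/= t1 andbT -[leRHS]invrK lef_pV2 ?posrE ?invr_gt0//.
  have /archi_boundP h : 0 <= t^-1 by rewrite invr_ge0 ltW.
  by apply: (le_trans (ltW h)); rewrite ler_nat.
have UB : \bigcup_n B n = `[(1:R), +oo[%classic.
  apply/seteqP; split => t /=.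
    by move=> [n _]; rewrite /B /= !in_itv/= => /andP[h1 _]; rewrite h1.
  rewrite in_itv/= andbT => t1; exists (Num.bound t) => //.
  rewrite /B /= in_itv/= t1 /=.
  have /archi_boundP h : 0 <= t by apply: le_trans t1.
  by apply: (le_trans (ltW h)); rewrite ler_nat.
have cI t : 0 < t -> {for t, continuous (fun t : R => G t^-1 * t ^- 2)}.
  move=> t0; apply: continuousM.
    apply: continuous_comp; first by apply: inv_continuous; rewrite gt_eqF.
    by apply: cG; rewrite invr_gt0.
  apply: continuous_comp; first exact: exprn_continuous.
  by apply: inv_continuous; rewrite expf_neq0// gt_eqF.
have mposi (f : R -> R) : (forall t : R, 0 < t -> {for t, continuous f}) ->
    measurable_fun (`]0, +oo[%classic : set R) f.
  move=> cf; apply: open_continuous_measurable_fun; first exact: interval_open.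
  by move=> t; rewrite inE/= in_itv/= andbT => /cf.
have Asub n : A n `<=` `]0, +oo[%classic.
  move=> t; rewrite /A /= !in_itv/= andbT => /andP[h1 _]; apply: lt_le_trans h1.
  by rewrite invr_gt0.
have Bsub n : B n `<=` `]0, +oo[%classic.
  by move=> t; rewrite /B /= !in_itv/= andbT => /andP[h1 _]; apply: lt_le_trans h1.
have HA := @ge0_nondecreasing_set_cvg_integral _ (measurableTypeR R) R A (EFin \o G) mu.
have HB := @ge0_nondecreasing_set_cvg_integral _ (measurableTypeR R) R B (fun t => (G t^-1 * t ^- 2)%:E) mu.
rewrite UA in HA; rewrite UB in HB.
have {}HA : ((\int[mu]_(x in A n) (G x)%:E)%E @[n --> \oo] --> (\int[mu]_(x in `]0%R, 1%R]) (G x)%:E)%E).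
  apply: HA.
  - move=> n m nm; apply/subsetPset => t; rewrite /A /= !in_itv/= => /andP[h1 ->].
    by rewrite andbT; apply: le_trans h1; rewrite lef_pV2 ?posrE// ler_nat.
  - by move=> n; exact: measurable_itv.
  - move=> n; apply/measurable_EFinP; apply: (measurable_funS _ (Asub n)) => //.
    exact: mposi.
  - by move=> n t /Asub; rewrite /= in_itv/= andbT lee_fin => /G0.
have {}HB : ((\int[mu]_(x in B n) (G x^-1 * x ^- 2)%:E)%E @[n --> \oo] --> (\int[mu]_(x in `[1%R, +oo[) (G x^-1 * x ^- 2)%:E)%E).
  apply: HB.
  - move=> n m nm; apply/subsetPset => t; rewrite /B /= !in_itv/= => /andP[-> h1] /=.
    by apply: le_trans h1 _; rewrite ler_nat.
  - by move=> n; exact: measurable_itv.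
  - move=> n; apply/measurable_EFinP; apply: (measurable_funS _ (Bsub n)) => //.
    exact: mposi.
  - move=> n t /Bsub; rewrite /= in_itv/= andbT lee_fin => t0.
    by rewrite mulr_ge0 ?G0 ?invr_ge0 ?exprn_ge0 ?invr_gt0// ltW.
have AB n : (\int[mu]_(x in A n) (G x)%:E = \int[mu]_(x in B n) (G x^-1 * x ^- 2)%:E)%E.
  have n1 : (1:R) <= n.+1%:R by rewrite ler1n.
  have pos t : t \in `[(1:R), n.+1%:R] -> 0 < t.
    by rewrite in_itv/= => /andP[h _]; apply: lt_le_trans h.
  have dF t : 0 < t -> is_derive t (1:R) (@GRing.inv R) (- t ^- 2).
    move=> t0; have tn : t != 0 by rewrite gt_eqF.
    apply: DeriveDef; first by apply: (@derivableV R R id) => //; exact: derivable_id.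
    by rewrite -derive1E derive1_inv.
  have cF t : 0 < t -> {for t, continuous (fun t : R => - t ^- 2)}.
    move=> t0; apply: continuousN; apply: continuous_comp; first exact: exprn_continuous.
    by apply: inv_continuous; rewrite expf_neq0// gt_eqF.
  have nF t : 0 < t -> \forall u \near t, (fun u : R => - u ^- 2) u = (@GRing.inv R)^`()%classic u.
    move=> t0; near=> u; rewrite derive1_inv// gt_eqF//.
    by near: u; exact: lt_nbhsr.
  have cF' t : 0 < t -> {for t, continuous (@GRing.inv R)^`()%classic}.
    move=> t0; have := cF t t0; rewrite /continuous_at /prop_for derive1_inv ?gt_eqF//.
    by move=> h; apply: cvg_trans h; apply: near_eq_cvg; exact: nF.
  have := @integration_by_substitution_decreasing R (@GRing.inv R) G 1 n.+1%:R n1.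
  rewrite invr1 /A /B => -> //.
  - apply: eq_integral => t; rewrite inE => /pos t0 /=.
    have -> : ((G \o GRing.inv) * - (@GRing.inv R)^`()%classic) t = G t^-1 * - ((@GRing.inv R)^`()%classic t) by [].
    by rewrite derive1_inv ?gt_eqF// opprK.
  - move=> x y /pos x0 /pos y0 xy; by rewrite ltf_pV2.
  - by move=> t /subset_itv_oo_cc /pos /cF'.
  - by apply/cvg_ex; eexists; apply: cvg_at_right_filter; exact: cF'.
  - by apply/cvg_ex; eexists; apply: cvg_at_left_filter; exact: cF'.
  - split.
    + by move=> t /subset_itv_oo_cc /pos /dF [].
    + by apply: cvg_at_right_filter; apply: inv_continuous.
    + by apply: cvg_at_left_filter; apply: inv_continuous.
  - apply: continuous_in_subspaceT => t; rewrite inE/= in_itv/= => /andP[h1 _].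
    by apply: cG; apply: lt_le_trans h1; rewrite invr_gt0.
move: HA; under eq_cvg do rewrite AB; move=> HA.
by have := cvg_unique _ HA HB; apply.
Unshelve. all: by end_near. Qed.

End HalfLineIntegrals.

(** * The substitution t -> c t *)

Section Scaling.
Variable R : realType.
Local Notation mu := (@lebesgue_measure R).

(** Lebesgue measure is determined by its values on the intervals ]a, b], where the left-hand side
    can be computed. *)
Lemma lebesgue_measure_scale (c : R) (c0 : 0 < c) (A : set (measurableTypeR R)) :
  measurable A ->
  (c%:E * pushforward mu ( *%R c : _ -> measurableTypeR R) A = mu A)%E.
Proof.
move=> mA; apply/esym.
have mf : measurable_fun [set: measurableTypeR R] ( *%R c : _ -> measurableTypeR R).
  exact: mulrl_measurable.
pose k : {nonneg R} := NngNum (ltW c0).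
pose m2 : {measure set (measurableTypeR R) -> \bar R} := pushforward mu ( *%R c : _ -> measurableTypeR R).
pose m := mscale k (m2 mf).
rewrite -[RHS]/(m A).
apply: lebesgue_measure_unique => //= _ [[a b]] _ <-.
rewrite /m /mscale /= /pushforward.
have -> : ( *%R c) @^-1` `]a, b]%classic = `](c^-1 * a), (c^-1 * b)]%classic.
  apply/seteqP; split => t /=; rewrite !in_itv/= => /andP[h1 h2]; apply/andP; split.
  - by rewrite -ltr_pdivlMl ?invr_gt0// invrK.
  - by rewrite -ler_pdivrMl ?invr_gt0// invrK.
  - by move: h1; rewrite -ltr_pdivlMl ?invr_gt0// invrK.
  - by move: h2; rewrite -ler_pdivrMl ?invr_gt0// invrK.
rewrite /= !lebesgue_measure_itv/= !lte_fin ltr_pM2l ?invr_gt0//.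
case: ifPn => _; last by rewrite mule0.
by rewrite -!EFinD -EFinM -mulrBr mulrA divff ?mul1r// gt_eqF.
Qed.

Lemma ge0_integral_scale (c : R) (f : R -> \bar R) : 0 < c ->
  measurable_fun [set: R] f -> (forall t, (0 <= f t)%E) ->
  (\int[mu]_(t in `]0%R, +oo[) f t = c%:E * \int[mu]_(t in `]0%R, +oo[) f (c * t)%R)%E.
Proof.
move=> c0 mf f0.
have mphi : measurable_fun [set: measurableTypeR R] ( *%R c : _ -> measurableTypeR R).
  exact: mulrl_measurable.
pose k : {nonneg R} := NngNum (ltW c0).
pose m2 : {measure set (measurableTypeR R) -> \bar R} := pushforward mu ( *%R c : _ -> measurableTypeR R).
have mD : measurable (`]0%R, +oo[%classic : set (measurableTypeR R)) by exact: measurable_itv.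
transitivity (\int[mscale k (m2 mphi)]_(t in `]0%R, +oo[) f t)%E.
  apply: eq_measure_integral => A mA _; apply/esym; exact: lebesgue_measure_scale.
rewrite ge0_integral_mscale//; last exact: measurable_funTS.
congr (_ * _)%E; rewrite /m2.
rewrite ge0_integral_pushforward//; last exact: measurable_funTS.
congr (integral _ _ _).
apply/seteqP; split => t /=; rewrite !in_itv/= !andbT => h; last exact: mulr_gt0.
by move: h; rewrite pmulr_rgt0.
Qed.

Lemma Rintegral_scale (c : R) (p : R -> R) : 0 < c -> measurable_fun [set: R] p ->
  mu.-integrable `]0, +oo[ (EFin \o p) ->
  mu.-integrable `]0, +oo[ (EFin \o (fun t => p (c * t))) /\
  \int[mu]_(t in `]0, +oo[) p (c * t) = c^-1 * \int[mu]_(t in `]0, +oo[) p t.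
Proof.
move=> c0 mp ip.
have mphi : measurable_fun [set: R] ( *%R c) by exact: mulrl_measurable.
have mpc : measurable_fun [set: R] (fun t => p (c * t)) by exact: measurableT_comp.
have mD : measurable (`]0%R, +oo[%classic : set (measurableTypeR R)) by exact: measurable_itv.
have key (q : R -> R) : measurable_fun [set: R] q -> (forall t, 0 <= q t)%R ->
  (\int[mu]_(t in `]0%R, +oo[) (q (c * t)%R)%:E = (c^-1)%:E * \int[mu]_(t in `]0%R, +oo[) (q t)%:E)%E.
  move=> mq q0; rewrite [in RHS](@ge0_integral_scale c)//.
  - by rewrite muleA -EFinM mulVf ?gt_eqF// mul1e.
  - exact/measurable_EFinP.
have ipc : mu.-integrable `]0, +oo[ (EFin \o (fun t => p (c * t))).
  apply/integrableP; split; first by apply/measurable_EFinP; exact: measurable_funTS.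
  move/integrableP: ip => [_ ip].
  rewrite (_ : integral _ _ _ = (\int[mu]_(t in `]0%R, +oo[) ((fun u => `|p u|) (c * t)%R)%:E)%E)//.
  rewrite (key (fun u => `|p u|))//; last exact: measurableT_comp.
  by rewrite lte_mul_pinfty// lee_fin invr_ge0 ltW.
split => //.
(* The nonnegative case [key] is applied to the positive and the negative part of p, both taken as
   real-valued functions. *)
pose pp := (fun t => Num.max (p t) 0); pose pn := (fun t => Num.max (- p t) 0).
have mpp : measurable_fun [set: R] pp by apply: measurable_maxr => //; exact: measurable_cst.
have mpn : measurable_fun [set: R] pn.
  by apply: measurable_maxr => //; exact: measurableT_comp.
have pE t : p t = pp t - pn t.
  rewrite /pp /pn; have [h|h] := leP (p t) 0.
    by rewrite max_l ?oppr_ge0// sub0r opprK.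
  by rewrite max_r ?subr0// oppr_le0 ltW.
have habs t : 0 <= pp t <= `|p t| /\ 0 <= pn t <= `|p t|.
  have hN : - p t <= `|p t| by rewrite -normrN ler_norm.
  by rewrite /pp /pn; split; rewrite le_max lexx orbT /= ge_max normr_ge0 ?hN ?ler_norm.
have i1 : mu.-integrable `]0, +oo[ (EFin \o pp).
  apply: (le_Rintegrable _ _ (integrable_norm ip)) => //; first exact: measurable_funTS.
  by move=> t _; have [/andP[h0 h] _] := habs t; rewrite ger0_norm.
have i2 : mu.-integrable `]0, +oo[ (EFin \o pn).
  apply: (le_Rintegrable _ _ (integrable_norm ip)) => //; first exact: measurable_funTS.
  by move=> t _; have [_ /andP[h0 h]] := habs t; rewrite ger0_norm.
have i3 : mu.-integrable `]0, +oo[ (EFin \o (fun t => pp (c * t))).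
  apply: (le_Rintegrable _ _ (integrable_norm ipc)) => //.
    by apply: measurable_funTS; exact: measurableT_comp.
  by move=> t _; have [/andP[h0 h] _] := habs (c * t); rewrite ger0_norm.
have i4 : mu.-integrable `]0, +oo[ (EFin \o (fun t => pn (c * t))).
  apply: (le_Rintegrable _ _ (integrable_norm ipc)) => //.
    by apply: measurable_funTS; exact: measurableT_comp.
  by move=> t _; have [_ /andP[h0 h]] := habs (c * t); rewrite ger0_norm.
under eq_Rintegral do rewrite pE.
under [in RHS]eq_Rintegral do rewrite pE.
rewrite !RintegralB// mulrBr.
have fk (q : R -> R) : mu.-integrable `]0, +oo[ (EFin \o q) -> measurable_fun [set: R] q -> (forall t, 0 <= q t)%R ->
  \int[mu]_(x in `]0, +oo[) q (c * x) = c^-1 * \int[mu]_(x in `]0, +oo[) q x.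
  move=> iq mq q0; rewrite /Rintegral key// fineM//.
  exact: integrable_fin_num iq.
by rewrite !fk// => t; have [/andP[h0 _] /andP[h1 _]] := habs t.
Qed.

End Scaling.

(** * Integrability of powers and of powers times exponentials *)

Section PowerIntegrals.
Variable R : realType.
Local Notation mu := (@lebesgue_measure R).
Implicit Types (a b c t : R).

Lemma Rintegrable_setU (A B : set R) (p : R -> R) : measurable A -> measurable B ->
  mu.-integrable A (EFin \o p) -> mu.-integrable B (EFin \o p) -> [disjoint A & B] ->
  mu.-integrable (A `|` B) (EFin \o p).
Proof.
move=> mA mB /integrableP[m1 i1] /integrableP[m2 i2] AB.
have mU : measurable_fun (A `|` B) (EFin \o p) by apply/measurable_funU.
apply/integrableP; split => //.
rewrite ge0_integral_setU//; last by apply: measurableT_comp => //.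
by rewrite lte_add_pinfty.
Qed.

Lemma integrable_powR_ge1 a : 0 < a ->
  mu.-integrable `[1, +oo[ (EFin \o (fun t => t `^ (- a - 1))).
Proof.
move=> a0.
have mf : measurable_fun (`[1, +oo[%classic : set R) (fun t => t `^ (- a - 1)).
  by apply: measurable_funTS; exact: measurable_powR.
apply/integrableP; split; first exact/measurable_EFinP.
under eq_integral do rewrite /= ger0_norm ?powR_ge0//.
have pos t : 1 < t -> 0 < t by move=> t1; apply: lt_trans t1.
have D t : 0 < t -> is_derive t (1:R) (fun t : R => - a^-1 * t `^ (- a)) (t `^ (- a - 1)).
  move=> t0.
  have t0' : t \in `]0, +oo[ by rewrite in_itv/= t0.
  have d0 : is_derive t (1:R) (fun t : R => t `^ (- a)) (- a * t `^ (- a - 1)).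
    apply: DeriveDef; first exact: derivable_powR.
    by rewrite -derive1E powR_derive1.
  have := @is_deriveZ R _ _ _ (- a^-1) t 1 _ d0.
  by rewrite [X in is_derive _ _ _ X](_ : _ = t `^ (- a - 1))// /GRing.scale /=; field; rewrite gt_eqF.
have C t : 0 < t -> {for t, continuous (fun t : R => t `^ (- a - 1))}.
  move=> t0; apply: differentiable_continuous; apply/derivable1_diffP.
  by apply: derivable_powR; rewrite in_itv/= t0.
rewrite (@ge0_continuous_FTC2y _ _ (fun t : R => - a^-1 * t `^ (- a)) 1 0).
- by rewrite -EFinB ltry.
- by move=> t _; exact: powR_ge0.
- apply: continuous_in_subspaceT => t; rewrite inE/= in_itv/= andbT => t1.
  by apply: C; apply: lt_le_trans t1.
- have -> : (0:R) = - a^-1 * 0 by rewrite mulr0.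
  apply: cvgM; first exact: cvg_cst.
  apply/cvgrPdist_le => e e0; near=> t.
  have t0 : 0 < t by near: t; exact: nbhs_pinfty_gt.
  rewrite sub0r normrN ger0_norm ?powR_ge0// /powR gt_eqF//.
  rewrite -[leRHS]lnK ?posrE// ler_expR mulNr lerNl -ler_pdivrMl//.
  rewrite -[leLHS]expRK ler_ln ?posrE ?expR_gt0//.
- by move=> t t1; have [] := D t (pos t t1).
- have c1 : {for (1:R), continuous (fun t : R => - a^-1 * t `^ (- a))}.
    apply: differentiable_continuous; apply/derivable1_diffP.
    by have [] := D 1 ltr01.
  exact: cvg_at_right_filter c1.
- move=> t; rewrite in_itv/= andbT => t1; rewrite derive1E.
  by have [_ ->] := D t (pos t t1).
Unshelve. all: by end_near. Qed.

(** Inversion turns t^(a-1) on ]0, 1] into t^(-a-1) on [1, oo[. *)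
Lemma integrable_powR_le1 a : 0 < a ->
  mu.-integrable `]0, 1] (EFin \o (fun t => t `^ (a - 1))).
Proof.
move=> a0.
apply/integrableP; split.
  by apply/measurable_EFinP; apply: measurable_funTS; exact: measurable_powR.
under eq_integral do rewrite /= ger0_norm ?powR_ge0//.
rewrite ge0_integral_inv; last 2 first.
- move=> t t0; apply: differentiable_continuous; apply/derivable1_diffP.
  by apply: derivable_powR; rewrite in_itv/= t0.
- by move=> t _; exact: powR_ge0.
have /integrableP[_] := integrable_powR_ge1 a0.
rewrite (_ : integral _ _ _ = integral mu `[1%R, +oo[%classic (fun t => (t^-1 `^ (a - 1) / t ^+ 2)%:E))//.
apply: eq_integral => t; rewrite inE/= in_itv/= andbT => t1.
have t0 : 0 < t by apply: lt_le_trans t1.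
rewrite ger0_norm ?powR_ge0//; congr EFin.
rewrite -powR_inv1 ?ltW// -powRrM -powR_invn ?ltW// -powRD; last by rewrite (gt_eqF t0) implybT.
by congr powR; ring.
Qed.

(** For a natural number n >= a + 2, (c t)^n <= n! e^(c t) bounds t^(a+2). The exponent [- 1 - 1] is
    the shape of [integrable_powR_ge1] at 1. *)
Lemma powR_expRN_bound a c : 0 < c -> exists2 K, 0 <= K &
  forall t, 1 <= t -> t `^ a * expR (- (c * t)) <= K * t `^ (- 1 - 1).
Proof.
move=> c0.
have /archi_boundP hn : 0 <= `|a + 2| by [].
set n := Num.bound _ in hn.
exists (n`!%:R / c ^+ n); first by rewrite divr_ge0// exprn_ge0// ltW.
move=> t t1; have t0 : 0 < t by apply: lt_le_trans t1.
have -> : t `^ a = t `^ (a + 2) * t `^ (- 1 - 1).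
  rewrite -powRD; last by rewrite (gt_eqF t0) implybT.
  by congr powR; ring.
rewrite mulrAC; apply: ler_wpM2r; first exact: powR_ge0.
rewrite expRN -ler_pdivlMr ?invr_gt0 ?expR_gt0// invrK mulrAC ler_pdivlMr ?exprn_gt0//.
apply: (@le_trans _ _ ((c * t) ^+ n)); last first.
  by apply: expR_le_expn; rewrite mulr_ge0 ?ltW.
rewrite exprMn mulrC; apply: ler_wpM2l; first by rewrite exprn_ge0// ltW.
have h : a + 2 <= n%:R by apply: le_trans (ler_norm _) (ltW hn).
by have := ler_powR t1 h; rewrite powR_mulrn// ltW.
Qed.

Lemma integrable_powR_expRN_ge1 a c : 0 < c ->
  mu.-integrable `[1, +oo[ (EFin \o (fun t => t `^ a * expR (- (c * t)))).
Proof.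
move=> c0; have [K K0 HK] := powR_expRN_bound a c0.
apply: (le_Rintegrable _ _ (RintegrableZl K _ (integrable_powR_ge1 ltr01))) => //.
  apply: measurable_funM; first by apply: measurable_funTS; exact: measurable_powR.
  apply: measurableT_comp => //; apply: measurableT_comp => //; exact: mulrl_measurable.
move=> t; rewrite /= in_itv/= andbT => t1.
by rewrite ger0_norm ?HK// mulr_ge0 ?powR_ge0 ?expR_ge0.
Qed.

Lemma itv0y_setU : (`]0, +oo[%classic : set R) = `]0, 1]%classic `|` `]1, +oo[%classic.
Proof. by apply: itv_bndbnd_setU; rewrite bnd_simp. Qed.

Lemma disjoint_01_1y : [disjoint (`]0, 1]%classic : set R) & `]1, +oo[%classic].
Proof.
apply/disj_setPS => t [/=]; rewrite !in_itv/= => /andP[_ h] /andP[h' _].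
by move: (lt_le_trans h' h); rewrite ltxx.
Qed.

Lemma integrable_powR_expRN a c : 0 < a -> 0 < c ->
  mu.-integrable `]0, +oo[ (EFin \o (fun t => t `^ (a - 1) * expR (- (c * t)))).
Proof.
move=> a0 c0.
have me (D : set R) : measurable D -> measurable_fun D (fun t => t `^ (a - 1) * expR (- (c * t))).
  move=> mD; apply: measurable_funM; first by apply: measurable_funTS; exact: measurable_powR.
  apply: measurableT_comp => //; apply: measurableT_comp => //; exact: mulrl_measurable.
rewrite itv0y_setU; apply: Rintegrable_setU => //.
- apply: (le_Rintegrable _ _ (integrable_powR_le1 a0)) => //; first exact: me.
  move=> t; rewrite /= in_itv/= => /andP[t0 _].
  rewrite ger0_norm ?mulr_ge0 ?powR_ge0 ?expR_ge0// -[leRHS]mulr1.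
  apply: ler_wpM2l; first exact: powR_ge0.
  by rewrite -expR0 ler_expR oppr_le0 mulr_ge0// ltW.
- apply: integrableS (integrable_powR_expRN_ge1 (a - 1) c0) => //.
  by move=> t /=; rewrite !in_itv/= !andbT => /ltW.
- exact: disjoint_01_1y.
Qed.

End PowerIntegrals.

(** * The Gamma function *)

Section GammaIntegral.
Variable R : realType.
Local Notation C := R[i].
Local Notation Re := (@complex.Re R).
Local Notation Im := (@complex.Im R).
Local Notation nm := (@Normc.normc R).
Local Notation mu := (@lebesgue_measure R).
Implicit Types (a b c t : R) (s z w h : C).

Lemma itv0y_gt0 t : `]0, +oo[%classic t -> 0 < t.
Proof. by rewrite /= in_itv/= andbT. Qed.

Lemma itv1y_ge1 t : `[1, +oo[%classic t -> 1 <= t.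
Proof. by rewrite /= in_itv/= andbT. Qed.

Definition mellin_exp s c t : C := cpow t (s - 1) * (expR (- (c * t)))%:C.

Lemma measurable_expRN c (D : set R) : measurable D -> measurable_fun D (fun t => expR (- (c * t))).
Proof.
move=> mD; apply: measurableT_comp => //; exact: measurableT_comp.
Qed.

Lemma cpow_invr c : 0 < c -> (c^-1)%:C = cpow c (- 1).
Proof. by move=> c0; rewrite cpowN cpow1r// -fmorphV. Qed.

Lemma powRDn t a (n : nat) : 0 < t -> t `^ (a + n%:R) = t `^ a * t ^+ n.
Proof.
move=> t0; rewrite powRD; last by rewrite (gt_eqF t0) implybT.
by rewrite (powR_mulrn n (ltW t0)).
Qed.

Lemma cmeasurable_mellin_exp s c (D : set R) : measurable D -> cmeasurable D (mellin_exp s c).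
Proof.
move=> mD; apply: cmeasurableM; first exact: cmeasurable_cpow.
by apply: cmeasurable_real; exact: measurable_expRN.
Qed.

Lemma nm_mellin_exp s c t : 0 < t ->
  nm (mellin_exp s c t) = t `^ (Re s - 1) * expR (- (c * t)).
Proof.
move=> t0; rewrite /mellin_exp nmM nm_cpow// nm_real ger0_norm ?expR_ge0//.
by rewrite ReD ReN /=.
Qed.

Lemma cintegrable_mellin_exp s c : 0 < Re s -> 0 < c -> cintegrable `]0, +oo[ (mellin_exp s c).
Proof.
move=> s0 c0; apply: (le_cintegrable _ _ (integrable_powR_expRN s0 c0)) => //.
  exact: cmeasurable_mellin_exp.
by move=> t /itv0y_gt0 t0; rewrite nm_mellin_exp.
Qed.

Lemma cintegral_scale c (f : R -> C) : 0 < c -> cmeasurable [set: R] f ->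
  cintegrable `]0, +oo[ f ->
  cintegrable `]0, +oo[ (fun t => f (c * t)) /\
  cintegral mu `]0, +oo[ (fun t => f (c * t)) = (c^-1)%:C * cintegral mu `]0, +oo[ f.
Proof.
move=> c0 [m1 m2] [i1 i2].
have [j1 e1] := Rintegral_scale c0 m1 i1; have [j2 e2] := Rintegral_scale c0 m2 i2.
by split; [split|rewrite /cintegral; simpc; congr Complex].
Qed.

Lemma Gamma_integralE s : Gamma_integral s = cintegral mu `]0, +oo[ (mellin_exp s 1).
Proof. by apply: eq_cintegral => t _; rewrite /mellin_exp mul1r. Qed.

Lemma Gamma_integral_scale s c : 0 < Re s -> 0 < c ->
  cintegral mu `]0, +oo[ (mellin_exp s c) = cpow c (- s) * Gamma_integral s.
Proof.
move=> s0 c0.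
have mT : cmeasurable [set: R] (mellin_exp s 1) by exact: cmeasurable_mellin_exp.
have [i1 e1] := cintegral_scale c0 mT (cintegrable_mellin_exp s0 ltr01).
transitivity (cintegral mu `]0, +oo[ (fun t => cpow c (1 - s) * mellin_exp s 1 (c * t))).
  apply: eq_cintegral => t /itv0y_gt0 t0.
  by rewrite /mellin_exp mul1r cpowMl// -[1 - s]opprB cpowN -mulrA mulKf ?cpow_neq0.
rewrite (cintegralZ _ (measurable_itv _) i1) e1 -Gamma_integralE mulrA.
apply: (f_equal2 *%R); last by [].
by rewrite cpow_invr// -cpowDr; congr cpow; ring.
Qed.

Lemma continuous_cpow_Re w t : 0 < t -> {for t, continuous (fun t => Re (cpow t w))}.
Proof.
move=> t0.
have -> : (fun t => Re (cpow t w)) = (fun t => expR (Re w * ln t) * cos (Im w * ln t)).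
  by apply/funext => u; rewrite /cpow /cexp ReM ReZ ImZ /= mul0r subr0 !(mulrC (ln u)).
have cl : {for t, continuous (@ln R)} by exact: continuous_ln.
apply: continuousM.
  apply: continuous_comp; last exact: continuous_expR.
  by apply: continuousM => //; exact: cst_continuous.
apply: continuous_comp; last exact: continuous_cos.
by apply: continuousM => //; exact: cst_continuous.
Qed.

Lemma continuous_cpow_Im w t : 0 < t -> {for t, continuous (fun t => Im (cpow t w))}.
Proof.
move=> t0.
have -> : (fun t => Im (cpow t w)) = (fun t => expR (Re w * ln t) * sin (Im w * ln t)).
  by apply/funext => u; rewrite /cpow /cexp ImM ReZ ImZ /= mul0r addr0 !(mulrC (ln u)).
have cl : {for t, continuous (@ln R)} by exact: continuous_ln.
apply: continuousM.
  apply: continuous_comp; last exact: continuous_expR.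
  by apply: continuousM => //; exact: cst_continuous.
apply: continuous_comp; last exact: continuous_sin.
by apply: continuousM => //; exact: cst_continuous.
Qed.

Lemma integral_inv (G : R -> R) : (forall t, 0 < t -> {for t, continuous G}) ->
  (\int[mu]_(t in `]0%R, 1%R]) (G t)%:E = \int[mu]_(t in `[1%R, +oo[) (G t^-1 * t ^- 2)%:E)%E.
Proof.
move=> cG; rewrite integralE [RHS]integralE; congr (_ - _)%E.
- transitivity (\int[mu]_(t in `]0%R, 1%R]) (Num.max (G t) 0)%:E)%E.
    by apply: eq_integral => t _; rewrite funeposE -EFin_max.
  rewrite ge0_integral_inv.
  + apply: eq_integral => t; rewrite inE /= in_itv/= andbT => t1.
    rewrite funeposE -EFin_max; congr EFin.
    by rewrite maxr_pMl ?mul0r// invr_ge0 exprn_ge0// (le_trans _ t1).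
  + by move=> t t0; apply: continuous_max => //; [exact: cG|exact: cst_continuous].
  + by move=> t _; rewrite le_max lexx orbT.
- transitivity (\int[mu]_(t in `]0%R, 1%R]) (Num.max (- G t) 0)%:E)%E.
    by apply: eq_integral => t _; rewrite funenegE -EFin_max.
  rewrite ge0_integral_inv.
  + apply: eq_integral => t; rewrite inE /= in_itv/= andbT => t1.
    rewrite funenegE -EFin_max; congr EFin.
    by rewrite -mulNr maxr_pMl ?mul0r// invr_ge0 exprn_ge0// (le_trans _ t1).
  + move=> t t0; apply: continuous_max => //; last exact: cst_continuous.
    by apply: continuousN; exact: cG.
  + by move=> t _; rewrite le_max lexx orbT.
Qed.

Lemma cintegrable_mellin_exp_ge1 s c : 0 < c -> cintegrable `[1, +oo[ (mellin_exp s c).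
Proof.
move=> c0; apply: (le_cintegrable _ _ (integrable_powR_expRN_ge1 (Re s - 1) c0)) => //.
  exact: cmeasurable_mellin_exp.
by move=> t /itv1y_ge1 t1; rewrite nm_mellin_exp// (lt_le_trans _ t1).
Qed.

(** The Mellin integral of one exponential, folded at t = 1 by inversion. Both halves live on [1,
    oo[, so that after summation over n the second one contains F(1/y). *)
Lemma Gamma_integral_split s c : 0 < Re s -> 0 < c ->
  cpow c (- s) * Gamma_integral s =
  cintegral mu `[1, +oo[ (mellin_exp s c) +
  cintegral mu `[1, +oo[ (fun t => cpow t (- s - 1) * (expR (- (c / t)))%:C).
Proof.
move=> s0 c0; rewrite -Gamma_integral_scale//.
have iU : cintegrable (`]0, 1]%classic `|` `]1, +oo[%classic) (mellin_exp s c).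
  by rewrite -itv0y_setU; exact: cintegrable_mellin_exp.
transitivity (cintegral mu (`]0, 1]%classic `|` `]1, +oo[%classic) (mellin_exp s c)).
  by congr (cintegral mu _ _); exact: itv0y_setU.
have m01 : measurable (`]0, 1]%classic : set R) by exact: measurable_itv.
have m1y : measurable (`]1, +oo[%classic : set R) by exact: measurable_itv.
rewrite (cintegral_setU m01 m1y iU (disjoint_01_1y R)).
rewrite addrC; apply: (f_equal2 +%R).
  have [i1 i2] := cintegrable_mellin_exp_ge1 s c0.
  rewrite /cintegral !Rintegral_itv_obnd_cbnd//.
  - by apply: integrableS i2 => //; apply: subset_itvr; rewrite bnd_simp.
  - by apply: integrableS i1 => //; apply: subset_itvr; rewrite bnd_simp.
have cexpc t : 0 < t -> {for t, continuous (fun t => expR (- (c * t)))}.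
  move=> t0; apply: continuous_comp; last exact: continuous_expR.
  apply: continuousN; apply: continuousM => //; exact: cst_continuous.
have E t : 1 <= t -> mellin_exp s c t^-1 * (t ^- 2)%:C = cpow t (- s - 1) * (expR (- (c / t)))%:C.
  move=> t1; have t0 : 0 < t by apply: lt_le_trans t1.
  rewrite /mellin_exp cpowV// mulrAC; congr (_ * _).
  have -> : (t ^- 2)%:C = cpow t (- 2%:R) by rewrite cpowN cpow_nat// -fmorphV.
  by rewrite -cpowDr; congr cpow; ring.
have ERe t : 1 <= t -> Re (mellin_exp s c t^-1) * t ^- 2 = Re (cpow t (- s - 1) * (expR (- (c / t)))%:C).
  by move=> /E <-; rewrite [RHS]ReZr.
have EIm t : 1 <= t -> Im (mellin_exp s c t^-1) * t ^- 2 = Im (cpow t (- s - 1) * (expR (- (c / t)))%:C).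
  by move=> /E <-; rewrite [RHS]ImZr.
rewrite /cintegral /Rintegral; apply: f_equal2; apply: (f_equal fine).
- rewrite integral_inv.
    by apply: eq_integral => t; rewrite inE => /itv1y_ge1 h; congr EFin; exact: ERe.
  move=> t t0.
  have -> : (fun t => Re (mellin_exp s c t)) = (fun t => Re (cpow t (s - 1)) * expR (- (c * t))).
    by apply/funext => u; rewrite /mellin_exp ReZr.
  by apply: continuousM; [exact: continuous_cpow_Re|exact: cexpc].
- rewrite integral_inv.
    by apply: eq_integral => t; rewrite inE => /itv1y_ge1 h; congr EFin; exact: EIm.
  move=> t t0.
  have -> : (fun t => Im (mellin_exp s c t)) = (fun t => Im (cpow t (s - 1)) * expR (- (c * t))).
    by apply/funext => u; rewrite /mellin_exp ImZr.
  by apply: continuousM; [exact: continuous_cpow_Im|exact: cexpc].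
Qed.

Lemma mellin_expS s c t : 0 < t -> mellin_exp (s + 1) c t = t%:C * mellin_exp s c t.
Proof.
move=> t0; rewrite /mellin_exp mulrA; congr (_ * _).
by rewrite -(cpow1r t0) -cpowDr; congr cpow; ring.
Qed.

Lemma eq0_of_le_small (x K : R) : 0 <= x -> (forall h : R, 0 < h <= 1 -> x <= h * K) -> x = 0.
Proof.
move=> x0 H; apply/eqP; rewrite eq_le x0 andbT; apply/ler_addgt0Pl => e e0; rewrite addr0.
have K1 : 0 < `|K| + 1 by rewrite ltr_wpDl.
have h0 : 0 < Num.min 1 (e / (`|K| + 1)) <= 1.
  by rewrite lt_min ltr01 divr_gt0//= ge_min lexx.
apply: (le_trans (H _ h0)).
apply: (@le_trans _ _ (Num.min 1 (e / (`|K| + 1)) * (`|K| + 1))).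
  apply: ler_wpM2l; first by case/andP: h0 => /ltW.
  by apply: le_trans (ler_norm _) _; rewrite lerDl.
by rewrite -ler_pdivlMr// ge_min lexx orbT.
Qed.

(* The relation between Gamma(s + 1) and Gamma(s) is the derivative at c = 1 of
   the scaling relation Gamma_integral_scale, with c = e^h. *)
Lemma Gamma_integralS s : 0 < Re s -> Gamma_integral (s + 1) = s * Gamma_integral s.
Proof.
move=> s0.
have s1 : 0 < Re (s + 1) by rewrite ReD /=; lra.
have i2 := cintegrable_mellin_exp s0 ltr01.
have i3 := cintegrable_mellin_exp s1 ltr01.
set E : R := expR 1.
have E0 : 0 < E by exact: expR_gt0.
(* The majorant of the integrand divided by h^2. With x = (e^h - 1) t, the quantity e^(-x) - 1 + h t
   is at most x^2 + (e^h - 1 - h) t in absolute value, and for h <= 1 one has e^h - 1 - h <= e h^2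
   and x <= (1 + e) h t. *)
pose p t := E * (t `^ (Re s + 1 - 1) * expR (- (1 * t)))
  + (1 + E) ^+ 2 * (t `^ (Re s + 2 - 1) * expR (- (1 * t))).
have ip : mu.-integrable `]0, +oo[ (EFin \o p).
  by apply: RintegrableD => //; apply: RintegrableZl => //;
    apply: integrable_powR_expRN => //; lra.
set K1 := 2 * \int[mu]_(t in `]0, +oo[) p t.
set K2 := 4 * nm s ^+ 2 * expR (nm s) * nm (Gamma_integral s).
apply/eqP; rewrite -subr_eq0 -nm_eq0; apply/eqP.
apply: (@eq0_of_le_small _ (K1 + K2)); first exact: nm_ge0.
move=> h /andP[h0 h1].
have [eh0 eh] : 0 <= expR h - 1 - h /\ expR h - 1 - h <= h ^+ 2 * E.
  split; first by have := expR_ge1Dx h; lra.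
  apply: (le_trans (ler_norm _)); apply: (le_trans (expR_quad h)).
  apply: ler_wpM2l; first exact: sqr_ge0.
  by rewrite /E (ger0_norm (ltW h0)) ler_expR.
have hh : h ^+ 2 <= h by rewrite expr2 -[leRHS]mulr1; apply: ler_wpM2l => //; exact: ltW.
have c0 : 0 < expR h by exact: expR_gt0.
have i1 := cintegrable_mellin_exp s0 c0.
pose f t := (mellin_exp s (expR h) t + - 1 * mellin_exp s 1 t) + h%:C * mellin_exp (s + 1) 1 t.
have i12 : cintegrable `]0, +oo[ (fun t => mellin_exp s (expR h) t + - 1 * mellin_exp s 1 t).
  by apply: cintegrableD => //; exact: cintegrableZ.
have i3' : cintegrable `]0, +oo[ (fun t => h%:C * mellin_exp (s + 1) 1 t) by exact: cintegrableZ.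
have if_ : cintegrable `]0, +oo[ f by exact: cintegrableD.
have iph : mu.-integrable `]0, +oo[ (EFin \o (fun t => h ^+ 2 * p t)) by exact: RintegrableZl.
have fp t : `]0, +oo[%classic t -> nm (f t) <= h ^+ 2 * p t.
  move=> /itv0y_gt0 t0.
  pose x := (expR h - 1) * t.
  have x0 : 0 <= x by rewrite mulr_ge0 ?ltW//; lra.
  have fE : f t = mellin_exp s 1 t * (expR (- x) - 1 + h * t)%:C.
    rewrite /f mellin_expS// /mellin_exp.
    have -> : expR (- (expR h * t)) = expR (- (1 * t)) * expR (- x).
      by rewrite -expRD; congr expR; rewrite /x; ring.
    by rewrite !rmorphD !rmorphM rmorphN rmorph1; ring.
  have bnd : `|expR (- x) - 1 + h * t| <= h ^+ 2 * (E * t + (1 + E) ^+ 2 * t ^+ 2).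
    have /andP[q0 q1] := expRN_quad x0.
    have -> : expR (- x) - 1 + h * t = (expR (- x) - 1 + x) - (expR h - 1 - h) * t by rewrite /x; ring.
    apply: (le_trans (ler_normB _ _)); rewrite (ger0_norm q0) normrM (ger0_norm eh0) (ger0_norm (ltW t0)).
    have xh : x <= h * (1 + E) * t.
      apply: ler_wpM2r; first exact: ltW.
      have : h ^+ 2 * E <= h * E by apply: ler_wpM2r => //; exact: ltW.
      by lra.
    have x2 : x ^+ 2 <= (h * (1 + E) * t) ^+ 2 by rewrite ler_pXn2r ?nnegrE// (le_trans x0).
    have et : (expR h - 1 - h) * t <= h ^+ 2 * E * t by apply: ler_wpM2r => //; exact: ltW.
    have : (h * (1 + E) * t) ^+ 2 = h ^+ 2 * ((1 + E) ^+ 2 * t ^+ 2) by ring.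
    by lra.
  rewrite fE nmM nm_real nm_mellin_exp//.
  apply: (@le_trans _ _ (t `^ (Re s - 1) * expR (- (1 * t)) * (h ^+ 2 * (E * t + (1 + E) ^+ 2 * t ^+ 2)))).
    by apply: ler_wpM2l bnd; rewrite mulr_ge0 ?powR_ge0 ?expR_ge0.
  have t0n : t != 0 by rewrite gt_eqF.
  have -> : p t = (E * t + (1 + E) ^+ 2 * t ^+ 2) * (t `^ (Re s - 1) * expR (- (1 * t))).
    rewrite /p (_ : Re s + 1 - 1 = (Re s - 1) + 1%:R); last by ring.
    rewrite (_ : Re s + 2 - 1 = (Re s - 1) + 2%:R); last by ring.
    by rewrite !powRDn//; ring.
  by rewrite le_eqVlt; apply/orP; left; apply/eqP; ring.
have mD : measurable (`]0, +oo[%classic : set R) by exact: measurable_itv.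
have := nm_cintegral_le mD if_ iph fp.
rewrite (@RintegralZl _ _ R mu _ _ _ mD ip) /f (cintegralD mD i12 i3').
rewrite (cintegralD mD i1 (cintegrableZ (-1) mD i2)) !(cintegralZ _ mD)//.
rewrite (Gamma_integral_scale s0 c0) -!Gamma_integralE.
set G := Gamma_integral s; set G1 := Gamma_integral (s + 1).
have -> : cpow (expR h) (- s) = cexp (h%:C * - s) by rewrite /cpow expRK.
set w := h%:C * - s => HH.
have nw : nm w = h * nm s by rewrite /w nmM nmN nm_real ger0_norm// ltW.
have := cexp_quad w; rewrite nw => Hw.
have Hw2 : nm (cexp w - 1 - w) <= h ^+ 2 * (4 * nm s ^+ 2 * expR (nm s)).
  apply: (le_trans Hw); rewrite exprMn.
  have : expR (h * nm s) <= expR (nm s).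
    by rewrite ler_expR -[leRHS]mul1r ler_wpM2r// nm_ge0.
  have : 0 <= h ^+ 2 * (4 * nm s ^+ 2) by apply: mulr_ge0; [exact: sqr_ge0|apply: mulr_ge0 => //; exact: sqr_ge0].
  move=> u0 u1; have := ler_wpM2l u0 u1; lra.
(* Both terms on the right are O(h^2): the integral of f, and the Taylor remainder of c^(-s) = e^(-h
   s). Division by h then leaves a bound that tends to 0. *)
have key : h%:C * (G1 - s * G) =
   (cexp w * G + -1 * G + h%:C * G1) - (cexp w - 1 - w) * G.
  by rewrite /w; ring.
have := nmB (cexp w * G + -1 * G + h%:C * G1) ((cexp w - 1 - w) * G).
rewrite -key !nmM nm_real (ger0_norm (ltW h0)) => H3.
have H4 : nm (cexp w - 1 - w) * nm G <= h ^+ 2 * K2.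
  by rewrite /K2 mulrA; apply: ler_wpM2r => //; exact: nm_ge0.
rewrite -(ler_pM2l h0); apply: (le_trans H3); apply: (le_trans (lerD HH H4)).
by rewrite le_eqVlt; apply/orP; left; apply/eqP; rewrite /K1; ring.
Qed.

Lemma Re_add_nat s n : Re (s + n%:R) = Re s + n%:R.
Proof. by rewrite ReD Re_nat. Qed.

Lemma Gamma_integral_addn s n : 0 < Re s ->
  Gamma_integral (s + n%:R) = (\prod_(j < n) (s + j%:R)) * Gamma_integral s.
Proof.
move=> s0; elim: n => [|n IH]; first by rewrite addr0 big_ord0 mul1r.
rewrite -natr1 addrA Gamma_integralS; last by rewrite Re_add_nat ltr_wpDr.
by rewrite IH big_ord_recr /= mulrA [(s + _) * _]mulrC.
Qed.

Definition Rgamma a := \int[mu]_(t in `]0, +oo[) (t `^ (a - 1) * expR (- (1 * t))).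

Lemma integrable_Rgamma a : 0 < a ->
  mu.-integrable `]0, +oo[ (EFin \o (fun t => t `^ (a - 1) * expR (- (1 * t)))).
Proof. by move=> a0; exact: integrable_powR_expRN. Qed.

(** On [1, 2] the integrand is at least min(1, 2^(a-1)) e^(-2), whether the power increases or
    decreases. *)
Lemma Rgamma_gt0 a : 0 < a -> 0 < Rgamma a.
Proof.
move=> a0; have ia := integrable_Rgamma a0.
have m12 : measurable (`[1, 2]%classic : set R) by exact: measurable_itv.
have mD : measurable (`]0, +oo[%classic : set R) by exact: measurable_itv.
have sub : `[1, 2]%classic `<=` (`]0, +oo[%classic : set R).
  by move=> t /=; rewrite !in_itv/= andbT => /andP[t1 _]; apply: lt_le_trans t1.
have E : mu (`[1, 2]%classic : set R) = 1%E.
  have h12 : (1 : R) < 2 by lra.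
  by rewrite lebesgue_measure_itv/= lte_fin h12 -EFinB; congr EFin; ring.
pose m := Num.min 1 (2 `^ (a - 1)) * expR (- 2).
have m0 : 0 < m by rewrite mulr_gt0 ?expR_gt0// lt_min ltr01 powR_gt0.
have : m <= \int[mu]_(t in `[1, 2]) (t `^ (a - 1) * expR (- (1 * t))).
  have -> : m = \int[mu]_(t in `[1, 2]) m.
    rewrite (@Rintegral_cst _ _ R mu _ m12) -[LHS]mulr1; congr (_ * _).
    exact: esym (congr1 fine E).
  apply: le_Rintegral => //.
  - apply: (measurable_bounded_integrable (mu := mu)) => //.
    + by apply: (eq_ind_r (fun x => (x < +oo)%E) (ltry 1) E).
    + by exists `|m|; split; [exact: num_real|move=> y my x _ /=; exact: ltW].
  - exact: integrableS ia.
  - move=> t; rewrite /= in_itv/= => /andP[t1 t2]; have t0 : 0 < t by apply: lt_le_trans t1.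
    apply: ler_pM; rewrite ?le_min ?powR_ge0 ?ler01 ?expR_ge0//.
      have [a1|a1] := leP 1 a.
        rewrite ge_min; apply/orP; left; rewrite -[leLHS](powRr0 t).
        by apply: ler_powR; rewrite // subr_ge0.
      rewrite ge_min; apply/orP; right.
      rewrite -[a - 1]opprK (powRN 2) (powRN t) lef_pV2 ?posrE ?powR_gt0//.
      by apply: ge0_ler_powR => //; rewrite ?nnegrE; lra.
    by rewrite ler_expR mul1r lerN2.
move=> /(lt_le_trans m0) /lt_le_trans; apply.
rewrite /Rgamma [leRHS](_ : _ = \int[mu]_(t in (`[1, 2] `|` (`]0, +oo[ `\` `[1, 2]))%classic) (t `^ (a - 1) * expR (- (1 * t)))); last first.
  by rewrite setDUK.
rewrite Rintegral_setU//.
- rewrite lerDl; apply: Rintegral_ge0 => t _.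
  by rewrite mulr_ge0 ?powR_ge0 ?expR_ge0.
- exact: measurableD.
- by rewrite setDUK.
- by apply/disj_setPS => t [] ? [].
Qed.

Lemma Gamma_integral_real a : Gamma_integral a%:C = (Rgamma a)%:C.
Proof.
rewrite Gamma_integralE /cintegral.
have E t : 0 < t -> mellin_exp a%:C 1 t = (t `^ (a - 1) * expR (- (1 * t)))%:C.
  move=> t0; rewrite /mellin_exp (_ : a%:C - 1 = (a - 1)%:C); last by rewrite rmorphB rmorph1.
  by rewrite cpow_real// rmorphM.
apply: f_equal2.
  by apply: eq_Rintegral => t; rewrite inE => /itv0y_gt0 /E ->.
transitivity (\int[mu]_(t in `]0, +oo[) (0 : R)).
  by apply: eq_Rintegral => t; rewrite inE => /itv0y_gt0 /E ->.
by rewrite Rintegral_cst// mul0r.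
Qed.

Lemma RgammaS a : 0 < a -> Rgamma (a + 1) = a * Rgamma a.
Proof.
move=> a0; apply: (@complexI R); rewrite rmorphM /= -!Gamma_integral_real.
by rewrite -Gamma_integralS// rmorphD rmorph1.
Qed.

(** Shaped for a Chebyshev argument: applied at t / a and integrated against the Gamma density of
    parameter a, the square becomes the variance 1 / a. *)
Lemma cpow_im_near1 (y : R) : exists2 K : R, 0 <= K & forall t, 0 < t ->
  nm (cpow t (0 +i* y) - 1) <= 1 / 8 + K * (t - 1) ^+ 2.
Proof.
(* near t = 1 by continuity, elsewhere because the left-hand side is at most 2 *)
have Y0 : 0 < 1 + `|y| by rewrite ltr_pwDl.
have eY : 0 < expR (1 : R) by exact: expR_gt0.
(* d bounds |ln t|, and r = d / 2 bounds |t - 1| because |ln t| <= 2 |t - 1| for t >= 1/2. Then w =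
   i y ln t satisfies |w| <= d (1 + |y|) <= 1, and |e^w - 1| <= (1 + 4 e) |w| is at most 1/16. *)
pose d := (16 * (1 + `|y|) ^+ 2 * (1 + 4 * expR 1))^-1.
have den : 1 <= 16 * (1 + `|y|) ^+ 2 * (1 + 4 * expR 1).
  have h1 : 1 <= (1 + `|y|) ^+ 2 by apply: exprn_ege1; rewrite lerDl.
  have h2 : 1 <= 1 + 4 * expR (1 : R) by rewrite lerDl mulr_ge0// ltW.
  have : 1 * 1 <= (1 + `|y|) ^+ 2 * (1 + 4 * expR 1) by apply: ler_pM.
  lra.
have d0 : 0 < d by rewrite invr_gt0; apply: lt_le_trans den.
have d1 : d <= 1 by rewrite invf_le1//; apply: lt_le_trans den.
pose r := d / 2.
have r0 : 0 < r by rewrite divr_gt0.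
exists (2 / r ^+ 2); first by rewrite divr_ge0// sqr_ge0.
move=> t t0.
have [tr|tr] := leP `|t - 1| r; last first.
  apply: (@le_trans _ _ 2).
    apply: (le_trans (nmB _ _)); rewrite nm_cpow//= powRr0 nm1; lra.
  have : 1 <= (t - 1) ^+ 2 / r ^+ 2.
    rewrite ler_pdivlMr ?exprn_gt0// mul1r -(real_normK (num_real (t - 1))).
    by rewrite ler_pXn2r ?nnegrE ?normr_ge0 ?(ltW r0) ?(ltW tr).
  rewrite mulrAC => h; lra.
rewrite -[leLHS]addr0; apply: lerD; last first.
  by rewrite mulr_ge0 ?sqr_ge0// divr_ge0// sqr_ge0.
have t12 : 1 / 2 <= t by move: tr; rewrite ler_norml => /andP[h _]; rewrite /r in h; lra.
have lt1 : `|ln t| <= d.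
  have u1 : ln t <= t - 1 by have := @le_ln1Dx R (t - 1); rewrite (addrC 1) subrK; apply; lra.
  have u2 : - ln t <= t^-1 - 1.
    rewrite -lnV ?posrE//; have := @le_ln1Dx R (t^-1 - 1); rewrite (addrC 1) subrK; apply.
    by rewrite ltrBrDr addNr invr_gt0.
  have u3 : t^-1 - 1 <= 2 * `|t - 1|.
    have -> : t^-1 - 1 = t^-1 * (1 - t) by rewrite mulrBr mulVf ?mulr1// gt_eqF.
    apply: (le_trans (ler_norm _)); rewrite normrM distrC; apply: ler_wpM2r => //.
    rewrite normfV (gtr0_norm t0) -[leRHS]invrK lef_pV2 ?posrE ?invr_gt0//.
    by move: t12; rewrite mul1r.
  have u4 := ler_norm (t - 1).
  have : 2 * `|t - 1| <= d by rewrite /r in tr; lra.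
  have := normr_ge0 (t - 1).
  by rewrite ler_norml => *; apply/andP; split; lra.
rewrite /cpow; set w := _ * _.
have nw : nm w <= d * (1 + `|y|).
  rewrite /w nmM nm_real; apply: ler_pM => //; first exact: nm_ge0.
  by apply: (le_trans (nm_le _)) => /=; rewrite normr0 add0r lerDr.
have nw0 := nm_ge0 w.
have nw1 : nm w <= 1.
  apply: (le_trans nw); rewrite mulrC /d ler_pdivrMr; last by apply: lt_le_trans den.
  rewrite mul1r.
  have h1 : 1 + `|y| <= (1 + `|y|) ^+ 2 by rewrite expr2 -[leLHS]mul1r; apply: ler_wpM2r; [exact: ltW|rewrite lerDl].
  have h2 : 1 <= 16 * (1 + 4 * expR (1 : R)) by lra.
  have : (1 + `|y|) * 1 <= (1 + `|y|) ^+ 2 * (16 * (1 + 4 * expR 1)).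
    by apply: ler_pM => //; exact: ltW.
  lra.
have -> : cexp w - 1 = (cexp w - 1 - w) + w by ring.
apply: (le_trans (nmD _ _)).
have q1 : nm (cexp w - 1 - w) <= 4 * nm w * expR 1.
  apply: (le_trans (cexp_quad w)); apply: ler_pM => //.
  - by rewrite mulr_ge0 ?sqr_ge0.
  - by rewrite ler_wpM2l// expr2 ler_piMr.
  - by rewrite ler_expR.
apply: (@le_trans _ _ (nm w * (1 + 4 * expR 1))); first by lra.
apply: (@le_trans _ _ (d * (1 + `|y|) * (1 + 4 * expR 1))).
  by apply: ler_wpM2r => //; rewrite addr_ge0// mulr_ge0// ltW.
rewrite -mulrA /d mulrC ler_pdivrMr; last by apply: lt_le_trans den.
have h1 : 1 + `|y| <= (1 + `|y|) ^+ 2 by rewrite expr2 -[leLHS]mul1r; apply: ler_wpM2r; [exact: ltW|rewrite lerDl].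
have : (1 + `|y|) * (1 + 4 * expR 1) <= (1 + `|y|) ^+ 2 * (1 + 4 * expR 1).
  by apply: ler_wpM2r => //; rewrite addr_ge0// mulr_ge0// ltW.
have : 0 <= (1 + `|y|) * (1 + 4 * expR 1) by rewrite !(mulr_ge0, addr_ge0)// ltW.
by lra.
Qed.

(* If Gamma(s) = 0 then Gamma(s + n) = 0 for all n. But the Gamma distribution
   with parameter a = Re s + n concentrates at t = a, where (t / a)^(i Im s) is
   close to 1, so that Gamma(s + n) is close to a^(i Im s) Gamma(a). *)
Lemma Gamma_integral_neq0 s : 0 < Re s -> Gamma_integral s != 0.
Proof.
move=> s0; apply/eqP => G0.
have [K K0 HK] := cpow_im_near1 (Im s).
(* The shift n is taken large enough for the variance term K / a to stay below 1/4. *)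
have /archi_boundP hn : 0 <= 4 * K by rewrite mulr_ge0.
set n := Num.bound _ in hn.
pose a := Re s + n%:R.
have a0 : 0 < a by rewrite ltr_wpDr.
have aK : 4 * K < a by apply: lt_le_trans hn _; rewrite lerDr ltW.
pose w : C := 0 +i* Im s.
have sE : s + n%:R = a%:C + w.
  rewrite /a /w rmorphD rmorph_nat addrAC; congr (_ + _).
  by case: (s) => x y; simpc.
have Gn : Gamma_integral (s + n%:R) = 0 by rewrite Gamma_integral_addn// G0 mulr0.
have sn0 : 0 < Re (s + n%:R) by rewrite Re_add_nat.
have ia : 0 < Re a%:C by [].
have i1 := cintegrable_mellin_exp sn0 ltr01.
have i2 := cintegrable_mellin_exp ia ltr01.
have mD : measurable (`]0, +oo[%classic : set R) by exact: measurable_itv.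
pose f t := cpow a (- w) * mellin_exp (s + n%:R) 1 t - mellin_exp a%:C 1 t.
have i1' := cintegrableZ (cpow a (- w)) mD i1.
have if_ : cintegrable `]0, +oo[ f.
  apply: (@eq_cintegrable R _ (fun t => cpow a (- w) * mellin_exp (s + n%:R) 1 t + (-1) * mellin_exp a%:C 1 t)) => //.
    by move=> t _; rewrite mulN1r.
  by apply: cintegrableD => //; exact: cintegrableZ.
have If : cintegral mu `]0, +oo[ f = - (Rgamma a)%:C.
  rewrite /f cintegralB// (cintegralZ _ mD i1) -!Gamma_integralE Gn mulr0 sub0r.
  by rewrite Gamma_integral_real.
pose g b t := t `^ (b - 1) * expR (- (1 * t)).
have ig b : 0 < b -> mu.-integrable `]0, +oo[ (EFin \o g b) by exact: integrable_Rgamma.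
have a10 : 0 < a + 1 by lra.
have a20 : 0 < a + 1 + 1 by lra.
(* This is the density g a t times 1/8 + K (t/a - 1)^2, expanded. By Gamma(a+1) = a Gamma(a) and
   Gamma(a+2) = a (a+1) Gamma(a) its integral is Gamma(a) (1/8 + K/a). *)
pose p t := ((1 / 8 + K) * g a t + (- 2 * K / a) * g (a + 1) t) + (K / a ^+ 2) * g (a + 1 + 1) t.
have j1 := RintegrableZl (1 / 8 + K) mD (ig _ a0).
have j2 := RintegrableZl (- 2 * K / a) mD (ig _ a10).
have j3 := RintegrableZl (K / a ^+ 2) mD (ig _ a20).
have j12 := RintegrableD mD j1 j2.
have ip : mu.-integrable `]0, +oo[ (EFin \o p) by exact: (RintegrableD mD j12 j3).
have Ip : \int[mu]_(t in `]0, +oo[) p t = Rgamma a * (1 / 8 + K / a).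
  rewrite /p (@RintegralD _ _ R mu _ _ _ mD j12 j3) (@RintegralD _ _ R mu _ _ _ mD j1 j2).
  rewrite !(@RintegralZl _ _ R mu _ _ _ mD)//; try exact: ig.
  rewrite -/(Rgamma a) -/(Rgamma (a + 1)) -/(Rgamma (a + 1 + 1)) !RgammaS//.
  by field; rewrite gt_eqF.
have fp t : `]0, +oo[%classic t -> nm (f t) <= p t.
  move=> /itv0y_gt0 t0.
  have fE : f t = mellin_exp a%:C 1 t * (cpow (a^-1 * t) w - 1).
    rewrite /f /mellin_exp sE cpowMl ?invr_gt0// cpowV//.
    have -> : a%:C + w - 1 = (a%:C - 1) + w by ring.
    by rewrite cpowDr; ring.
  rewrite fE nmM nm_mellin_exp//.
  apply: (@le_trans _ _ (g a t * (1 / 8 + K * (a^-1 * t - 1) ^+ 2))).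
    apply: ler_wpM2l; first by rewrite mulr_ge0 ?powR_ge0 ?expR_ge0.
    by apply: HK; rewrite mulr_gt0 ?invr_gt0.
  rewrite le_eqVlt; apply/orP; left; apply/eqP; rewrite /p /g.
  rewrite (_ : a + 1 + 1 - 1 = (a - 1) + 2%:R); last by ring.
  rewrite (_ : a + 1 - 1 = (a - 1) + 1%:R); last by ring.
  by rewrite !powRDn//; field; rewrite gt_eqF.
have := nm_cintegral_le mD if_ ip fp.
rewrite If Ip nmN nm_real gtr0_norm ?Rgamma_gt0//.
have Ga := Rgamma_gt0 a0.
rewrite mulrCA -[leLHS]mulr1 ler_pM2l//.
(* What remains is 1 <= 2 (1/8 + K/a), the 2 being the loss in [nm_cintegral_le]; but the right-hand
   side is below 3/4. *)
have : K / a < 1 / 4 by rewrite ltr_pdivrMr//; lra.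
lra.
Qed.

(** Frees [cGamma] from the particular shift in its definition, so that one m can serve a whole
    neighbourhood. Passing to a larger shift adds factors of positive real part, which cancel; at a
    pole both quotients are 0 because an earlier factor vanishes. *)
Lemma cGammaE s m : 0 < Re s + m%:R ->
  cGamma s = Gamma_integral (s + m%:R) / \prod_(j < m) (s + j%:R).
Proof.
have key z p q : 0 < Re z + p%:R -> (p <= q)%N ->
    Gamma_integral (z + q%:R) / \prod_(j < q) (z + j%:R) =
    Gamma_integral (z + p%:R) / \prod_(j < p) (z + j%:R).
  move=> zp /subnK <-; elim: (q - p)%N => [|i IH]; first by rewrite add0n.
  have h : 0 < Re (z + (i + p)%:R) by rewrite Re_add_nat natrD; have := ler0n R i; lra.
  rewrite addSn big_ord_recr /= -IH -natr1 addrA Gamma_integralS// invfM.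
  have nz : z + (i + p)%:R != 0.
    by apply/eqP => e; move: h; rewrite e /= ltxx.
  by rewrite [_ * Gamma_integral _]mulrC mulrACA divff// mulr1.
move=> sm; rewrite /cGamma; set m0 := if _ then _ else _.
have sm0 : 0 < Re s + m0%:R.
  rewrite /m0; case: ifPn => [|]; first by rewrite addr0.
  rewrite -leNgt => s0.
  have f0 : Num.floor (Re s) <= 0 by rewrite floor_le0; lra.
  have -> : (`|Num.floor (Re s)|.+1%N)%:R = 1 - (Num.floor (Re s))%:~R :> R.
    by rewrite -natr1 natr_absz ler0_norm// rmorphN addrC.
  by have := floor_le (Re s); lra.
have [h|h] := leqP m0 m; first by rewrite (key s m0 m).
by rewrite (key s m m0)// ltnW.
Qed.

Lemma cGamma_neq0 s : (forall n : nat, s != - n%:R) -> cGamma s != 0.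
Proof.
move=> sn.
have /archi_boundP hm : 0 <= `|Re s| by [].
set m := Num.bound _ in hm.
have sm : 0 < Re s + m%:R by have := ler_norm (- Re s); rewrite normrN; lra.
rewrite (cGammaE sm) mulf_neq0//; first by apply: Gamma_integral_neq0; rewrite Re_add_nat.
rewrite invr_neq0//; apply/prodf_neq0 => j _.
by rewrite addr_eq0.
Qed.

End GammaIntegral.

(** * Holomorphy of Mellin transforms and of 1 / Gamma *)

Section QuadraticDerivativeRules.
Variable R : realType.
Local Notation C := R[i].
Local Notation Re := (@complex.Re R).
Local Notation nm := (@Normc.normc R).
Local Notation mu := (@lebesgue_measure R).
Implicit Types (f g : C -> C) (z w h s : C).

Lemma qderivable_near f g z (d : R) : 0 < d ->
  (forall h, nm h <= d -> f (z + h) = g (z + h)) -> qderivable g z -> qderivable f z.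
Proof.
move=> d0 fg [l [M [e [e0 H]]]]; exists l, M, (Num.min d e); split.
  by rewrite lt_min d0.
move=> h; rewrite le_min => /andP[hd he].
have fz : f z = g z by have := fg 0; rewrite addr0 nm0; apply; exact: ltW.
by rewrite fz fg//; exact: H.
Qed.

Lemma qderivable_cst (c : C) z : qderivable (fun=> c) z.
Proof.
exists 0, 0, 1; split => // h _.
by rewrite mul0r subrr subr0 nm0 mul0r.
Qed.

Lemma qderivable_addl (c : C) z : qderivable (fun s => s + c) z.
Proof.
exists 1, 0, 1; split => // h _.
by rewrite (_ : z + h + c - (z + c) - 1 * h = 0) ?nm0 ?mul0r//; ring.
Qed.

Lemma qderivable_shift f (c : C) z : qderivable f (z + c) -> qderivable (fun s => f (s + c)) z.
Proof.
by move=> [l [M [e [e0 H]]]]; exists l, M, e; split => // h he; rewrite (addrAC z h c); exact: H.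
Qed.

Lemma qderivable_refl f (c : C) z : qderivable f (c - z) -> qderivable (fun s => f (c - s)) z.
Proof.
move=> [l [M [e [e0 H]]]]; exists (- l), M, e; split => // h he.
have -> : c - (z + h) = (c - z) + (- h) by ring.
have := H (- h); rewrite nmN => /(_ he).
by rewrite mulrN mulNr.
Qed.

Lemma qderivableD f g z : qderivable f z -> qderivable g z -> qderivable (fun s => f s + g s) z.
Proof.
move=> [l [M [d [d0 H]]]] [m [N [e [e0 K]]]]; exists (l + m), (M + N), (Num.min d e); split.
  by rewrite lt_min d0.
move=> h; rewrite le_min => /andP[hd he].
have -> : f (z + h) + g (z + h) - (f z + g z) - (l + m) * h =
  (f (z + h) - f z - l * h) + (g (z + h) - g z - m * h) by ring.
by apply: (le_trans (nmD _ _)); rewrite mulrDl; apply: lerD; [exact: H|exact: K].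
Qed.

Lemma qderivableM f g z : qderivable f z -> qderivable g z -> qderivable (fun s => f s * g s) z.
Proof.
move=> df dg; have [L [dL [dL0 HL]]] := qderivable_lip dg.
move: df dg => [l [M [d [d0 H]]]] [m [N [e [e0 K]]]].
exists (l * g z + f z * m), (M * (nm (g z) + `|L| * dL) + nm l * L + nm (f z) * N).
exists (Num.min dL (Num.min d e)); split; first by rewrite !lt_min dL0 d0 e0.
move=> h; rewrite !le_min => /andP[hL /andP[hd he]].
have -> : f (z + h) * g (z + h) - f z * g z - (l * g z + f z * m) * h =
  ((f (z + h) - f z - l * h) * g (z + h) + l * h * (g (z + h) - g z))
  + f z * (g (z + h) - g z - m * h) by ring.
have h0 := nm_ge0 h.
apply: (le_trans (nmD _ _)); rewrite [leRHS]mulrDl; apply: lerD; last first.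
  by rewrite nmM -mulrA; apply: ler_wpM2l; [exact: nm_ge0|exact: K].
apply: (le_trans (nmD _ _)); rewrite [leRHS]mulrDl; apply: lerD; last first.
  rewrite !nmM -mulrA -[leRHS]mulrA; apply: ler_wpM2l; first exact: nm_ge0.
  by rewrite expr2 mulrCA; apply: ler_wpM2l => //; exact: HL.
rewrite nmM [leRHS]mulrAC; apply: ler_pM; rewrite ?nm_ge0//; first exact: H.
have -> : g (z + h) = g z + (g (z + h) - g z) by ring.
apply: (le_trans (nmD _ _)); rewrite lerD2l; apply: (le_trans (HL h hL)).
apply: (@le_trans _ _ (`|L| * nm h)); first by apply: ler_wpM2r => //; exact: ler_norm.
exact: ler_wpM2l.
Qed.

Lemma qderivableV f z : f z != 0 -> qderivable f z -> qderivable (fun s => (f s)^-1) z.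
Proof.
move=> fz df; have [L [dL [dL0 HL]]] := qderivable_lip df.
move: df => [l [M [d [d0 H]]]].
have n0 := nm_gt0 fz.
have L1 : 0 < 2 * (`|L| + 1) by rewrite mulr_gt0// ltr_wpDl.
(* For |h| <= e (and within the Lipschitz radius) |f(z+h)| stays above |f(z)| / 2, whence the factor
   2 / |f(z)|^3 in the error constant. *)
pose e := nm (f z) / (2 * (`|L| + 1)).
have e0 : 0 < e by rewrite divr_gt0.
exists (- l / f z ^+ 2), ((nm (f z) * M + nm l * L) * (2 / nm (f z) ^+ 3)).
exists (Num.min dL (Num.min d e)); split; first by rewrite !lt_min dL0 d0 e0.
move=> h; rewrite !le_min => /andP[hL /andP[hd he]].
have h0 := nm_ge0 h.
have FL : nm (f (z + h) - f z) <= nm (f z) / 2.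
  apply: (le_trans (HL h hL)); apply: (@le_trans _ _ ((`|L| + 1) * nm h)).
    by apply: ler_wpM2r => //; have := ler_norm L; lra.
  have L2 : 0 < `|L| + 1 by rewrite ltr_wpDl.
  rewrite mulrC -ler_pdivlMr//; apply: (le_trans he).
  rewrite le_eqVlt; apply/orP; left; apply/eqP; rewrite /e; field.
  by rewrite gt_eqF.
have F2 : nm (f z) / 2 <= nm (f (z + h)).
  have := nmB (f (z + h)) (f (z + h) - f z).
  have -> : f (z + h) - (f (z + h) - f z) = f z by ring.
  by move: FL; lra.
have F0 : 0 < nm (f (z + h)) by apply: lt_le_trans F2; rewrite divr_gt0.
have Fz : f (z + h) != 0 by rewrite -nm_eq0 gt_eqF.
have -> : (f (z + h))^-1 - (f z)^-1 - - l / f z ^+ 2 * h =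
  (- f z * (f (z + h) - f z - l * h) + l * h * (f (z + h) - f z))
  * (f z ^+ 2 * f (z + h))^-1 by field; rewrite fz Fz.
rewrite nmM nmV nmM nmX [leRHS]mulrAC; apply: ler_pM.
- exact: nm_ge0.
- by rewrite invr_ge0 mulr_ge0 ?exprn_ge0 ?nm_ge0.
- apply: (le_trans (nmD _ _)); rewrite mulrDl; apply: lerD.
    by rewrite nmM nmN -mulrA; apply: ler_wpM2l; [exact: nm_ge0|exact: H].
  rewrite !nmM -mulrA -[leRHS]mulrA; apply: ler_wpM2l; first exact: nm_ge0.
  by rewrite expr2 mulrCA; apply: ler_wpM2l => //; exact: HL.
have -> : 2 / nm (f z) ^+ 3 = (nm (f z) ^+ 2 * (nm (f z) / 2))^-1 by field; rewrite gt_eqF.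
rewrite lef_pV2 ?posrE; first by apply: ler_wpM2l => //; exact: sqr_ge0.
  by rewrite mulr_gt0// exprn_gt0.
by rewrite mulr_gt0 ?divr_gt0// exprn_gt0.
Qed.

Lemma qderivable_prod (I : Type) (r : seq I) (F : I -> C -> C) z :
  (forall i, qderivable (F i) z) -> qderivable (fun s => \prod_(i <- r) F i s) z.
Proof.
move=> dF; elim: r => [|i r IH].
  by under eq_fun do rewrite big_nil; exact: qderivable_cst.
by under eq_fun do rewrite big_cons; exact: qderivableM.
Qed.

Lemma qderivable_cpow (a : R) z : qderivable (cpow a) z.
Proof.
exists ((ln a)%:C * cpow a z), (nm (cpow a z) * (4 * `|ln a| ^+ 2 * expR `|ln a|)), 1.
split => // h h1.
have -> : cpow a (z + h) - cpow a z - (ln a)%:C * cpow a z * h =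
  cpow a z * (cexp ((ln a)%:C * h) - 1 - (ln a)%:C * h).
  by rewrite cpowDr -/(cpow a h); ring.
rewrite nmM -[leRHS]mulrA; apply: ler_wpM2l; first exact: nm_ge0.
apply: (le_trans (cexp_quad _)); rewrite nmM nm_real exprMn.
rewrite [leRHS]mulrAC -[4 * _ * nm h ^+ 2]mulrA.
apply: ler_wpM2l; first by apply: mulr_ge0 => //; apply: mulr_ge0; exact: sqr_ge0.
by rewrite ler_expR -[leRHS]mulr1; apply: ler_wpM2l.
Qed.

(** Differentiation under the integral sign. For |h| <= y/2 the remainder t^h - 1 - h ln t is at
    most 4 |h ln t|^2 e^(|h ln t|). With u = y |ln t| / 2 both ln(t)^2, up to a constant, and e^(|h
    ln t|) are bounded by e^u, and e^(2u) <= t^y + t^(-y), the weight in the integrability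
    hypothesis. *)
Lemma mellin_qderivable (D : set R) (phi : R -> C) (p : R -> R) s (y : R) :
  measurable D -> (forall t, D t -> 0 < t) -> 0 < y -> cmeasurable D phi ->
  (forall t, D t -> nm (phi t) <= p t) ->
  mu.-integrable D (EFin \o (fun t => p t * (t `^ (Re s - 1) * (t `^ y + t `^ (- y))))) ->
  cintegrable D (fun t => phi t * cpow t (s - 1)) /\
  qderivable (fun s => cintegral mu D (fun t => phi t * cpow t (s - 1))) s.
Proof.
move=> mD Dpos y0 mphi phip iW.
pose W t := p t * (t `^ (Re s - 1) * (t `^ y + t `^ (- y))).
pose u t := y / 2 * `|ln t|.
have mcp w : cmeasurable D (fun t => phi t * cpow t w).
  by apply: cmeasurableM => //; exact: cmeasurable_cpow.
have u0 t : 0 <= u t by rewrite mulr_ge0// divr_ge0// ltW.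
have e2u t : 0 < t -> expR (u t) * expR (u t) <= t `^ y + t `^ (- y).
  move=> t0; rewrite -expRD (_ : u t + u t = y * `|ln t|); last by rewrite /u; field.
  rewrite /powR gt_eqF//; have [l0|l0] := leP 0 (ln t).
    by rewrite (ger0_norm l0) lerDl expR_ge0.
  by rewrite (ltr0_norm l0) mulrN mulNr lerDr expR_ge0.
have eu1 t : 1 <= expR (u t) by rewrite -expR0 ler_expR.
have eu0 t : 0 <= expR (u t) by exact: expR_ge0.
have dom (q : R -> R) (K : R) (f : R -> C) : 0 <= K ->
    (forall t, D t -> nm (f t) <= t `^ (Re s - 1) * q t) ->
    (forall t, D t -> q t <= K * (expR (u t) * expR (u t))) ->
    forall t, D t -> nm (phi t * f t) <= K * W t.
  move=> K0 fq qK t Dt; have t0 := Dpos t Dt.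
  rewrite nmM /W mulrCA; apply: ler_pM; rewrite ?nm_ge0//; first exact: phip.
  apply: (le_trans (fq t Dt)); rewrite mulrCA; apply: ler_wpM2l; first exact: powR_ge0.
  by apply: (le_trans (qK t Dt)); apply: ler_wpM2l => //; exact: e2u.
have iKW K : mu.-integrable D (EFin \o (fun t => K * W t)) by exact: RintegrableZl.
have ub h t : nm h <= y / 2 -> expR (`|ln t| * nm h) <= expR (u t).
  by move=> hy; rewrite ler_expR /u mulrC; apply: ler_wpM2r.
have cpb h t : 0 < t -> nm h <= y / 2 -> nm (cpow t (s + h - 1)) <= t `^ (Re s - 1) * expR (u t).
  move=> t0 hy; rewrite (_ : s + h - 1 = (s - 1) + h); last by ring.
  rewrite cpowDr nmM nm_cpow// ReD ReN /=; apply: ler_wpM2l; first exact: powR_ge0.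
  rewrite nm_cpow// /powR gt_eqF//; apply: le_trans (ub h t hy); rewrite ler_expR.
  by apply: (le_trans (ler_norm _)); rewrite normrM mulrC ler_wpM2l// nm_Re.
have eule t : expR (u t) <= 1 * (expR (u t) * expR (u t)).
  by rewrite mul1r -[leLHS]mulr1; apply: ler_wpM2l.
have ish h : nm h <= y / 2 -> cintegrable D (fun t => phi t * cpow t (s + h - 1)).
  move=> hy; apply: (le_cintegrable mD (mcp _) (iKW 1)).
  apply: (dom (fun t => expR (u t))) => // t Dt; exact: cpb (Dpos t Dt) hy.
have is0 : cintegrable D (fun t => phi t * cpow t (s - 1)).
  by have := ish 0; rewrite nm0 addr0; apply; rewrite divr_ge0// ltW.
split => //.
have ilog : cintegrable D (fun t => phi t * ((ln t)%:C * cpow t (s - 1))).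
  apply: (le_cintegrable mD _ (iKW (2 / y))).
    apply: cmeasurableM => //; apply: cmeasurableM; last exact: cmeasurable_cpow.
    by apply: cmeasurable_real; exact: measurable_funTS.
  apply: (dom (fun t => `|ln t|)); first by rewrite divr_ge0// ltW.
    move=> t Dt; rewrite nmM nm_real nm_cpow; last exact: Dpos.
    by rewrite ReD ReN mulrC.
  move=> t Dt; rewrite -ler_pdivrMl ?divr_gt0// invf_div.
  have := @expR_le_expn R 1 (u t) (u0 t); rewrite expr1 mul1r => h.
  by apply: (le_trans h); have := eule t; rewrite mul1r.
set L := cintegral mu D (fun t => phi t * ((ln t)%:C * cpow t (s - 1))).
(* The 2 is the loss in [nm_cintegral_le]; 32 is 4 from [cexp_quad] times 8 from u^2 <= 2 e^u, that
   is ln(t)^2 <= (8 / y^2) e^u. *)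
exists L, (2 * (32 / y ^+ 2 * \int[mu]_(t in D) W t)), (y / 2).
split; first by rewrite divr_gt0.
move=> h hy.
pose f t := (phi t * cpow t (s + h - 1) - phi t * cpow t (s - 1)) + (- h) * (phi t * ((ln t)%:C * cpow t (s - 1))).
have i1 : cintegrable D (fun t => phi t * cpow t (s + h - 1) - phi t * cpow t (s - 1)).
  apply: (@eq_cintegrable R _ (fun t => phi t * cpow t (s + h - 1) + (-1) * (phi t * cpow t (s - 1)))) => //.
    by move=> t _; rewrite mulN1r.
  by apply: cintegrableD; rewrite //; [exact: ish|exact: cintegrableZ].
have i2 := cintegrableZ (- h) mD ilog.
have if_ : cintegrable D f by exact: cintegrableD.
have If : cintegral mu D f = cintegral mu D (fun t => phi t * cpow t (s + h - 1))
   - cintegral mu D (fun t => phi t * cpow t (s - 1)) - L * h.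
  rewrite (cintegralD mD i1 i2) (cintegralB mD (ish h hy) is0) (cintegralZ _ mD ilog).
  by rewrite mulNr mulrC.
rewrite -If.
have := @nm_cintegral_le R D f _ mD if_ (iKW (nm h ^+ 2 * (32 / y ^+ 2))).
rewrite (@RintegralZl _ _ R mu _ _ _ mD iW) => H.
have -> : 2 * (32 / y ^+ 2 * \int[mu]_(t in D) W t) * nm h ^+ 2 =
  2 * (nm h ^+ 2 * (32 / y ^+ 2) * \int[mu]_(t in D) W t) by ring.
apply: H => t Dt; have t0 := Dpos t Dt.
have -> : f t = phi t * (cpow t (s - 1) * (cexp ((ln t)%:C * h) - 1 - (ln t)%:C * h)).
  rewrite /f (_ : s + h - 1 = (s - 1) + h); last by ring.
  by rewrite cpowDr -/(cpow t h); ring.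
have K0 : 0 <= nm h ^+ 2 * (32 / y ^+ 2) by rewrite mulr_ge0 ?sqr_ge0// divr_ge0// sqr_ge0.
move: t Dt t0.
suff: forall t, D t -> nm (phi t * (cpow t (s - 1) * (cexp ((ln t)%:C * h) - 1 - (ln t)%:C * h))) <=
   nm h ^+ 2 * (32 / y ^+ 2) * W t by move=> HH t Dt _; exact: HH.
apply: (dom (fun t => 4 * (`|ln t| * nm h) ^+ 2 * expR (`|ln t| * nm h))) => // t Dt.
  rewrite nmM nm_cpow; last exact: Dpos.
  rewrite ReD ReN /=; apply: ler_wpM2l; first exact: powR_ge0.
  by apply: (le_trans (cexp_quad _)); rewrite nmM nm_real.
have := @expR_le_expn R 2 (u t) (u0 t); rewrite /u exprMn => h2.
have lb : `|ln t| ^+ 2 <= 8 / y ^+ 2 * expR (u t).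
  have -> : 8 / y ^+ 2 * expR (u t) = (2 / y) ^+ 2 * (2%:R * expR (u t)) by field; rewrite gt_eqF.
  rewrite -ler_pdivrMl ?exprn_gt0 ?divr_gt0// -exprVn invf_div; exact: h2.
rewrite exprMn (_ : _ * (32 / y ^+ 2) * _ = 4 * (8 / y ^+ 2 * expR (u t) * nm h ^+ 2) * expR (u t)); last by ring.
apply: ler_pM; rewrite ?expR_ge0 ?ub//; first by apply: mulr_ge0 => //; apply: mulr_ge0; exact: sqr_ge0.
by apply: ler_wpM2l => //; apply: ler_wpM2r => //; exact: sqr_ge0.
Qed.

Lemma Gamma_integral_qderivable s : 0 < Re s -> qderivable (@Gamma_integral R) s.
Proof.
move=> s0.
have mD : measurable (`]0, +oo[%classic : set R) by exact: measurable_itv.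
(* Half the distance to the line Re s = 0: both Re s + y and Re s - y remain positive, as
   integrability at 0 demands. *)
have y0 : 0 < Re s / 2 by rewrite divr_gt0.
have [| | |_] := @mellin_qderivable `]0, +oo[%classic (fun t => (expR (- (1 * t)))%:C)
   (fun t => expR (- (1 * t))) s (Re s / 2) mD (@itv0y_gt0 R) y0.
- by apply: cmeasurable_real; exact: measurable_expRN.
- by move=> t _; rewrite nm_real ger0_norm ?expR_ge0.
- have a1 : 0 < Re s + Re s / 2 by lra.
  have a2 : 0 < Re s - Re s / 2 by lra.
  apply: eq_integrable (RintegrableD mD (integrable_Rgamma a1) (integrable_Rgamma a2)) => //.
  move=> t; rewrite inE => /itv0y_gt0 t0 /=; congr EFin.
  rewrite mulrDr -!powRD ?(gt_eqF t0) ?implybT// mulrDr.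
  rewrite (_ : Re s + Re s / 2 - 1 = Re s - 1 + Re s / 2); last by ring.
  rewrite (_ : Re s - Re s / 2 - 1 = Re s - 1 - Re s / 2); last by ring.
  by rewrite !(mulrC (expR _)).
apply: (@qderivable_near _ _ _ 1) => // h _.
rewrite Gamma_integralE; apply: eq_cintegral => t _.
by rewrite /mellin_exp mulrC.
Qed.

(** Near s one shift m represents 1/Gamma as a polynomial divided by the nonvanishing Gamma(z + m).
    This includes the poles of Gamma, where [cGamma] and its inverse are both 0. The 1 added to |Re
    s| leaves room for |h| <= 1. *)
Lemma cGamma_inv_qderivable s : qderivable (fun z => (@cGamma R z)^-1) s.
Proof.
have /archi_boundP hm : 0 <= `|Re s| + 1 by rewrite addr_ge0.
set m := Num.bound _ in hm.
have sm : 0 < Re s + m%:R by have := ler_norm (- Re s); rewrite normrN; lra.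
apply: (@qderivable_near _ (fun z => (\prod_(j < m) (z + j%:R)) * (Gamma_integral (z + m%:R))^-1) s 1) => //.
  move=> h h1; rewrite (@cGammaE R _ m) ?invfM ?invrK 1?mulrC//.
  have := nm_Re h; rewrite ReD ler_norml => /andP[h2 _].
  by have := ler_norm (- Re s); rewrite normrN; lra.
apply: qderivableM; first by apply: qderivable_prod => j; exact: qderivable_addl.
apply: qderivableV; first by apply: Gamma_integral_neq0; rewrite Re_add_nat.
apply: (@qderivable_shift (@Gamma_integral R)); apply: Gamma_integral_qderivable.
by rewrite Re_add_nat.
Qed.

End QuadraticDerivativeRules.

(** * Mellin transforms of exponential expansions *)

Section MellinExpansion.
Variable R : realType.
Local Notation C := R[i].
Local Notation Re := (@complex.Re R).
Local Notation nm := (@Normc.normc R).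
Local Notation mu := (@lebesgue_measure R).
Implicit Types (c B y : R) (a b : nat -> C) (F G : R -> C) (A : nat) (s : C).

Definition exp_term c a (y : R) (n : nat) : C := a n * (expR (- (c * n.+1%:R * y)))%:C.

(* The index is shifted: [a n] is the coefficient of exp(- c (n + 1) y). *)
Definition exp_expansion c B A a F :=
  (forall n, nm (a n) <= B * n.+1%:R ^+ A) /\
  (forall y, 0 < y -> series (exp_term c a y) @ \oo --> F y).

(** The constant obtained from u^(A+2) <= (A+2)! e^u at u = c (n+1) y / 2. *)
Definition tail_const c B A : R := B * ((A.+2)`!%:R * (2 / c) ^+ A.+2).

Lemma tail_const_ge0 c B A : 0 < c -> 0 <= B -> 0 <= tail_const c B A.
Proof.
move=> c0 B0; apply: mulr_ge0 => //; apply: mulr_ge0 => //.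
by apply: exprn_ge0; apply: ltW; rewrite divr_gt0.
Qed.

Lemma measurable_inv_gt0 : measurable_fun (`]0, +oo[%classic : set R) (@GRing.inv R).
Proof.
apply: open_continuous_measurable_fun; first exact: interval_open.
move=> t; rewrite inE => /itv0y_gt0 t0; apply: inv_continuous.
by rewrite gt_eqF.
Qed.

(** Half of the exponential is spent on turning (n+1)^A into (n+1)^(-2), at the cost of y^(-A-2);
    the other half is kept as decay in y. Finally (n+1)^(-2) is replaced by a telescoping
    difference, so that tails sum in closed form. *)
Lemma exp_term_bound c B A a F y n : 0 < c -> 0 <= B -> 0 < y ->
  exp_expansion c B A a F ->
  nm (exp_term c a y n) <=
    tail_const c B A * (y ^- A.+2 * expR (- (c / 2 * y))) * (2 / n.+1%:R - 2 / n.+2%:R).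
Proof.
move=> c0 B0 y0 [ha _].
have n0 : 0 < n.+1%:R :> R by [].
have n1 : 1 <= n.+1%:R :> R by rewrite ler1n.
pose u := c / 2 * n.+1%:R * y.
have u0 : 0 <= u by rewrite !mulr_ge0// ltW// divr_gt0.
have hu := @expR_le_expn R A.+2 u u0.
rewrite /exp_term nmM nm_real ger0_norm ?expR_ge0//.
apply: (@le_trans _ _ (B * n.+1%:R ^+ A * expR (- (c * n.+1%:R * y)))).
  by apply: ler_wpM2r => //; exact: expR_ge0.
have -> : expR (- (c * n.+1%:R * y)) = expR (- u) * expR (- u).
  by rewrite -expRD; congr expR; rewrite /u; field.
have e1 : expR (- u) <= expR (- (c / 2 * y)).
  have cy : 0 <= c / 2 * y by apply: ltW; rewrite mulr_gt0// divr_gt0.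
  by rewrite ler_expR lerN2 (_ : u = n.+1%:R * (c / 2 * y)) ?ler_peMl// /u; ring.
have e2 : n.+1%:R ^+ A * expR (- u) <= (A.+2)`!%:R * (2 / c) ^+ A.+2 * y ^- A.+2 * n.+1%:R ^- 2.
  have -> : n.+1%:R ^+ A = u ^+ A.+2 * ((2 / c) ^+ A.+2 * y ^- A.+2 * n.+1%:R ^- 2).
    have -> : u ^+ A.+2 = n.+1%:R ^+ A * n.+1%:R ^+ 2 * ((c / 2) ^+ A.+2 * y ^+ A.+2).
      by rewrite -exprD addn2 /u !exprMn; ring.
    have -> : (2 / c) ^+ A.+2 = (c / 2) ^- A.+2 by rewrite -exprVn invf_div.
    have h1 : (c / 2) ^+ A.+2 != 0 by rewrite expf_neq0// gt_eqF// divr_gt0.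
    have h2 : y ^+ A.+2 != 0 by rewrite expf_neq0// gt_eqF.
    have h3 : n.+1%:R ^+ 2 != 0 :> R by rewrite expf_neq0// gt_eqF.
    move: h1 h2 h3; move: ((c / 2) ^+ A.+2) (y ^+ A.+2) (n.+1%:R ^+ 2) => X Y Z h1 h2 h3.
    by field; rewrite h1 h2 h3.
  set P := (2 / c) ^+ A.+2 * y ^- A.+2 * n.+1%:R ^- 2.
  have P0 : 0 <= P.
    apply: mulr_ge0; last by rewrite invr_ge0 exprn_ge0.
    apply: mulr_ge0; last by rewrite invr_ge0 exprn_ge0// ltW.
    by apply: exprn_ge0; apply: ltW; rewrite divr_gt0.
  have -> : (A.+2)`!%:R * (2 / c) ^+ A.+2 * y ^- A.+2 * n.+1%:R ^- 2 = (A.+2)`!%:R * P.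
    by rewrite /P !mulrA.
  rewrite mulrAC; apply: ler_wpM2r => //.
  by rewrite expRN -ler_pdivlMr ?invr_gt0 ?expR_gt0// invrK.
have e3 : n.+1%:R ^- 2 <= 2 / n.+1%:R - 2 / n.+2%:R :> R.
  have -> : 2 / n.+1%:R - 2 / n.+2%:R = n.+1%:R ^- 2 * (2 * n.+1%:R / n.+2%:R) :> R.
    by field; rewrite !gt_eqF.
  rewrite ler_peMr ?invr_ge0 ?exprn_ge0 ?ler0n// ler_pdivlMr// mul1r -[n.+2]addn1 natrD.
  lra.
have h1 : n.+1%:R ^+ A * expR (- u) * expR (- u) <=
    (A.+2)`!%:R * (2 / c) ^+ A.+2 * y ^- A.+2 * n.+1%:R ^- 2 * expR (- (c / 2 * y)).
  by apply: ler_pM; rewrite ?expR_ge0// mulr_ge0 ?expR_ge0 ?exprn_ge0.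
have P0 : 0 <= (A.+2)`!%:R * (2 / c) ^+ A.+2 * y ^- A.+2 * expR (- (c / 2 * y)).
  apply: mulr_ge0; last exact: expR_ge0.
  apply: mulr_ge0; last by rewrite invr_ge0 exprn_ge0// ltW.
  by apply: mulr_ge0 => //; apply: exprn_ge0; apply: ltW; rewrite divr_gt0.
have := ler_wpM2l P0 e3; rewrite /tail_const.
move: h1; move: ((2 / c) ^+ A.+2) (y ^- A.+2) (n.+1%:R ^- 2 : R) => X Y Z h1 h2.
rewrite -mulrA mulrA -[leLHS]mulrA.
apply: (@le_trans _ _ (B * ((A.+2)`!%:R * X * Y * expR (- (c / 2 * y)) * (2 / n.+1%:R - 2 / n.+2%:R)))).
  rewrite -mulrA; apply: ler_wpM2l => //; rewrite mulrA; apply: le_trans h1 _.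
  by rewrite [leLHS]mulrAC [leRHS]mulrA.
by rewrite le_eqVlt; apply/orP; left; apply/eqP; ring.
Qed.

(** N and y are separated in the bound. Integrated against a power of y it yields convergence at the
    rate 1 / (N+1), in place of a dominated convergence argument. *)
Lemma exp_expansion_tail c B A a F y N : 0 < c -> 0 <= B -> 0 < y ->
  exp_expansion c B A a F ->
  nm (F y - \sum_(n < N) exp_term c a y n) <=
    2 / N.+1%:R * tail_const c B A * (y ^- A.+2 * expR (- (c / 2 * y))).
Proof.
move=> c0 B0 y0 hF; have [_ /(_ y y0) hl] := hF.
set T := tail_const c B A * (y ^- A.+2 * expR (- (c / 2 * y))).
have T0 : 0 <= T.
  apply: mulr_ge0; first exact: tail_const_ge0.
  by apply: mulr_ge0; rewrite ?expR_ge0// invr_ge0 exprn_ge0// ltW.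
have partial m : nm (\sum_(n < N + m) exp_term c a y n - \sum_(n < N) exp_term c a y n)
    <= T * (2 / N.+1%:R - 2 / (N + m).+1%:R).
  elim: m => [|m IH]; first by rewrite addn0 !subrr nm0 mulr0.
  rewrite addnS big_ord_recr /= addrAC.
  apply: (le_trans (nmD _ _)).
  have := exp_term_bound (N + m) c0 B0 y0 hF; rewrite -/T => h.
  apply: (le_trans (lerD IH h)); rewrite -mulrDr.
  by rewrite le_eqVlt; apply/orP; left; apply/eqP; congr (_ * _); ring.
have -> : 2 / N.+1%:R * tail_const c B A * (y ^- A.+2 * expR (- (c / 2 * y))) = T * (2 / N.+1%:R).
  by rewrite /T; ring.
apply/ler_addgt0Pl => e e0.
have /cvgCP /(_ e e0) [M HM] := hl.
pose m := (maxn N M - N)%N.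
have Nm : (N + m = maxn N M)%N by rewrite /m subnKC// leq_maxl.
have := HM (maxn N M) (leq_maxr _ _); rewrite series_ord -Nm nm_distC => h1.
have -> : F y - \sum_(n < N) exp_term c a y n = (F y - \sum_(n < N + m) exp_term c a y n)
   + (\sum_(n < N + m) exp_term c a y n - \sum_(n < N) exp_term c a y n) by ring.
apply: (le_trans (nmD _ _)); apply: lerD => //; apply: (le_trans (partial m)).
by apply: ler_wpM2l => //; rewrite lerBlDr lerDl divr_ge0.
Qed.

Lemma exp_expansion_measurable c B A a F (D : set R) : measurable D ->
  (forall y, D y -> 0 < y) -> exp_expansion c B A a F -> cmeasurable D F.
Proof.
move=> mD Dpos [_ hF].
apply: (@cmeasurable_cvg R D (fun N y => \sum_(n < N) exp_term c a y n)) => [N|y Dy].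
  apply: cmeasurable_sum => n; apply: cmeasurableM; first exact: cmeasurable_cst.
  by apply: cmeasurable_real; exact: measurable_expRN.
have := hF y (Dpos y Dy).
by rewrite (_ : (fun N => _) = series (exp_term c a y))//; apply/funext => N; rewrite series_ord.
Qed.

Definition mellin_ge1 F s : C := cintegral mu `[1, +oo[ (fun y => F y * cpow y (s - 1)).

Lemma itv1y_gt0 y : `[1, +oo[%classic y -> 0 < y.
Proof. by move=> /itv1y_ge1; exact: lt_le_trans. Qed.

Lemma exp_expansion_le c B A a F y : 0 < c -> 0 <= B -> 1 <= y ->
  exp_expansion c B A a F ->
  nm (F y) <= 2 * tail_const c B A * expR (- (c / 2 * y)).
Proof.
move=> c0 B0 y1 hF; have y0 : 0 < y by apply: lt_le_trans y1.
have := exp_expansion_tail 0 c0 B0 y0 hF; rewrite big_ord0 subr0 divr1 => h.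
apply: (le_trans h); apply: ler_wpM2l.
  by apply: mulr_ge0 => //; exact: tail_const_ge0.
rewrite ler_piMl ?expR_ge0// invf_le1 ?exprn_gt0//; exact: exprn_ege1.
Qed.

(** Entire in s: F decays exponentially and the domain stays away from 0. The 1 given to
    [mellin_qderivable] is an arbitrary choice of exponent. *)
Lemma mellin_ge1_qderivable c B A a F s : 0 < c -> 0 <= B ->
  exp_expansion c B A a F ->
  cintegrable `[1, +oo[ (fun y => F y * cpow y (s - 1)) /\ qderivable (mellin_ge1 F) s.
Proof.
move=> c0 B0 hF.
have mD : measurable (`[1, +oo[%classic : set R) by exact: measurable_itv.
have c2 : 0 < c / 2 by rewrite divr_gt0.
pose K := 2 * tail_const c B A.
apply: (@mellin_qderivable R `[1, +oo[%classic F (fun y => K * expR (- (c / 2 * y))) s 1 mD itv1y_gt0 ltr01).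
- exact: exp_expansion_measurable mD itv1y_gt0 hF.
- by move=> y /itv1y_ge1 y1; exact: exp_expansion_le hF.
- have i1 := integrable_powR_expRN_ge1 (Re s - 1 + 1) c2.
  have i2 := integrable_powR_expRN_ge1 (Re s - 1 + - 1) c2.
  apply: eq_integrable (RintegrableZl K mD (RintegrableD mD i1 i2)) => //.
  move=> y; rewrite inE => /itv1y_gt0 y0 /=; congr EFin.
  by rewrite !powRD ?(gt_eqF y0) ?implybT//; ring.
Qed.

(** The condition on Re s comes from the folded half: at 1/y the tail bound grows like y^(A+2),
    against the weight y^(-Re s - 1). *)
Lemma mellin_dirichlet c B A (k : nat) a b F G (w : C) s : 0 < c -> 0 <= B ->
  exp_expansion c B A a F -> exp_expansion c B A b G ->
  (forall y, 1 <= y -> F y^-1 = w * (y ^+ k)%:C * G y) ->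
  A.+2%:R < Re s ->
  series (fun n => a n * cpow (c * n.+1%:R) (- s) * Gamma_integral s) @ \oo -->
    mellin_ge1 F s + w * mellin_ge1 G (k%:R - s).
Proof.
move=> c0 B0 hF hG FG sA.
have s0 : 0 < Re s by apply: le_lt_trans sA.
have mD : measurable (`[1, +oo[%classic : set R) by exact: measurable_itv.
have [iF _] := mellin_ge1_qderivable s c0 B0 hF.
have [iG _] := mellin_ge1_qderivable (k%:R - s) c0 B0 hG.
pose F' y := F y^-1 * cpow y (- s - 1).
have F'E y : `[1, +oo[%classic y -> w * (G y * cpow y (k%:R - s - 1)) = F' y.
  move=> y1; have y0 := itv1y_gt0 y1; rewrite /F' FG; last exact: itv1y_ge1.
  by rewrite -cpow_nat// (_ : k%:R - s - 1 = k%:R + (- s - 1)) ?cpowDr; ring.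
have iF' : cintegrable `[1, +oo[ F'.
  by apply: eq_cintegrable F'E _ => //; exact: cintegrableZ.
have -> : mellin_ge1 F s + w * mellin_ge1 G (k%:R - s) =
    cintegral mu `[1, +oo[ (fun y => F y * cpow y (s - 1)) + cintegral mu `[1, +oo[ F'.
  congr (_ + _); rewrite /mellin_ge1 -(cintegralZ _ mD iG); exact: eq_cintegral.
have c2 : 0 < c / 2 by rewrite divr_gt0.
have t0 : 0 < Re s - A.+2%:R by rewrite subr_gt0.
have j1 := integrable_powR_expRN_ge1 (Re s - 1) c2.
have j2 := integrable_powR_ge1 t0.
set J1 := \int[mu]_(y in `[1, +oo[) (y `^ (Re s - 1) * expR (- (c / 2 * y))).
set J2 := \int[mu]_(y in `[1, +oo[) (y `^ (- (Re s - A.+2%:R) - 1)).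
pose T := tail_const c B A.
have T0 : 0 <= T by exact: tail_const_ge0.
pose S N y := \sum_(n < N) exp_term c a y n.
have cn n : 0 < c * n.+1%:R by rewrite mulr_gt0.
have i1 n : cintegrable `[1, +oo[ (fun y => a n * mellin_exp s (c * n.+1%:R) y).
  by apply: cintegrableZ => //; exact: cintegrable_mellin_exp_ge1.
have i2 n : cintegrable `[1, +oo[ (fun y => cpow y (- s - 1) * (expR (- (c * n.+1%:R / y)))%:C).
  apply: (le_cintegrable (p := fun y => y `^ (- Re s - 1)) mD).
  - apply: cmeasurableM; first exact: cmeasurable_cpow.
    apply: cmeasurable_real; apply: measurableT_comp => //; apply: measurableT_comp => //.
    apply: measurable_funM => //; apply: measurable_funS measurable_inv_gt0 => //.
    by move=> y /itv1y_gt0; rewrite /= in_itv/= andbT.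
  - exact: integrable_powR_ge1.
  - move=> y y1; rewrite nmM nm_cpow; last exact: itv1y_gt0.
    rewrite ReD !ReN /= nm_real ger0_norm ?expR_ge0// ler_piMr ?powR_ge0//.
    rewrite -[leRHS]expR0 ler_expR oppr_le0; apply: divr_ge0; apply: ltW; [exact: cn|exact: itv1y_gt0 y1].
have i2' n : cintegrable `[1, +oo[ (fun y => a n * (cpow y (- s - 1) * (expR (- (c * n.+1%:R / y)))%:C)).
  exact: cintegrableZ.
(* Each term of the Dirichlet series is folded by [Gamma_integral_split], so a partial sum is a pair
   of integrals over [1, oo[ of the same finite exponential sum S N, at y and at 1/y. *)
have SE N : series (fun n => a n * cpow (c * n.+1%:R) (- s) * Gamma_integral s) N =
    cintegral mu `[1, +oo[ (fun y => S N y * cpow y (s - 1)) +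
    cintegral mu `[1, +oo[ (fun y => S N y^-1 * cpow y (- s - 1)).
  rewrite series_ord.
  transitivity (\sum_(n < N) (cintegral mu `[1, +oo[ (fun y => a n * mellin_exp s (c * n.+1%:R) y)
     + cintegral mu `[1, +oo[ (fun y => a n * (cpow y (- s - 1) * (expR (- (c * n.+1%:R / y)))%:C)))).
    apply: eq_bigr => n _; rewrite -mulrA (Gamma_integral_split s0 (cn n)) mulrDr.
    by congr (_ + _); rewrite cintegralZ//; exact: cintegrable_mellin_exp_ge1.
  rewrite big_split /= -!cintegral_sum//; congr (_ + _); apply: eq_cintegral => y _.
    by rewrite /S mulr_suml; apply: eq_bigr => n _; rewrite /exp_term /mellin_exp; ring.
  by rewrite /S mulr_suml; apply: eq_bigr => n _; rewrite /exp_term; ring.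
have iS N : cintegrable `[1, +oo[ (fun y => S N y * cpow y (s - 1)).
  apply: (@eq_cintegrable R _ (fun y => \sum_(n < N) a n * mellin_exp s (c * n.+1%:R) y)) => //.
    by move=> y _; rewrite /S mulr_suml; apply: eq_bigr => n _; rewrite /exp_term /mellin_exp; ring.
  exact: cintegrable_sum.
have iS' N : cintegrable `[1, +oo[ (fun y => S N y^-1 * cpow y (- s - 1)).
  apply: (@eq_cintegrable R _ (fun y => \sum_(n < N) a n * (cpow y (- s - 1) * (expR (- (c * n.+1%:R / y)))%:C))) => //.
    by move=> y _; rewrite /S mulr_suml; apply: eq_bigr => n _; rewrite /exp_term; ring.
  exact: cintegrable_sum.
apply/cvgCP => e e0.
(* The 4 combines the 2 of [nm_cintegral_le] with the 2 of [exp_expansion_tail]; the total error is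
   K / (N+1). *)
pose K := 4 * T * (J1 + J2).
have /archi_boundP hM : 0 <= `|K| / e by rewrite divr_ge0// ltW.
exists (Num.bound (`|K| / e)) => N MN; rewrite SE nm_distC.
have d1 : nm (cintegral mu `[1, +oo[ (fun y => F y * cpow y (s - 1)) -
    cintegral mu `[1, +oo[ (fun y => S N y * cpow y (s - 1))) <= 2 * (2 / N.+1%:R * T * J1).
  rewrite -(cintegralB mD iF (iS N)) /J1 -(@RintegralZl _ _ R mu _ _ _ mD j1).
  apply: nm_cintegral_le => //.
  - apply: (@eq_cintegrable R _ (fun y => F y * cpow y (s - 1) + (-1) * (S N y * cpow y (s - 1)))) => //.
      by move=> y _; rewrite mulN1r.
    by apply: cintegrableD => //; exact: cintegrableZ.
  - exact: RintegrableZl.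
  move=> y y1; have y0 := itv1y_gt0 y1; rewrite -mulrBl nmM nm_cpow// ReD ReN /=.
  rewrite [leRHS]mulrCA [leRHS]mulrC; apply: ler_wpM2r; first exact: powR_ge0.
  apply: (le_trans (exp_expansion_tail N c0 B0 y0 hF)); apply: ler_wpM2l.
    by rewrite mulr_ge0// divr_ge0.
  rewrite ler_piMl ?expR_ge0// invf_le1 ?exprn_gt0//; apply: exprn_ege1; exact: itv1y_ge1.
have d2 : nm (cintegral mu `[1, +oo[ F' -
    cintegral mu `[1, +oo[ (fun y => S N y^-1 * cpow y (- s - 1))) <= 2 * (2 / N.+1%:R * T * J2).
  rewrite -(cintegralB mD iF' (iS' N)) /J2 -(@RintegralZl _ _ R mu _ _ _ mD j2).
  apply: nm_cintegral_le => //.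
  - apply: (@eq_cintegrable R _ (fun y => F' y + (-1) * (S N y^-1 * cpow y (- s - 1)))) => //.
      by move=> y _; rewrite mulN1r.
    by apply: cintegrableD => //; exact: cintegrableZ.
  - exact: RintegrableZl.
  move=> y y1; have y0 := itv1y_gt0 y1; have y0' : 0 < y^-1 by rewrite invr_gt0.
  rewrite -mulrBl nmM nm_cpow// ReD !ReN /=.
  have -> : - (Re s - A.+2%:R) - 1 = (- Re s - 1) + A.+2%:R by ring.
  rewrite powRDn// [leRHS]mulrCA [leRHS]mulrC; apply: ler_wpM2r; first exact: powR_ge0.
  apply: (le_trans (exp_expansion_tail N c0 B0 y0' hF)); apply: ler_wpM2l.
    by rewrite mulr_ge0// divr_ge0.
  rewrite exprVn invrK ler_piMr//; first by rewrite exprn_ge0// ltW.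
  by rewrite -[leRHS]expR0 ler_expR oppr_le0; apply: mulr_ge0; exact: ltW.
rewrite opprD addrACA; apply: (le_trans (nmD _ _)); apply: (le_trans (lerD d1 d2)).
have -> : 2 * (2 / N.+1%:R * T * J1) + 2 * (2 / N.+1%:R * T * J2) = K / N.+1%:R by rewrite /K; field.
rewrite ler_pdivrMr// mulrC -ler_pdivrMr//.
apply: (@le_trans _ _ (`|K| / e)); first by apply: ler_wpM2r; rewrite ?invr_ge0 ?ler_norm// ltW.
by apply: (le_trans (ltW hM)); rewrite ler_nat leqW.
Qed.

End MellinExpansion.

(** * Gauss sums *)

Section AdditiveCharacter.
Variable R : realType.
Local Notation C := R[i].
Local Notation Re := (@complex.Re R).
Local Notation Im := (@complex.Im R).
Local Notation nm := (@Normc.normc R).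

Lemma e2piD (z w : C) : e2pi (z + w) = e2pi z * e2pi w.
Proof. by rewrite /e2pi mulrDr cexpD. Qed.

Lemma e2piN (z : C) : e2pi (- z) = (e2pi z)^-1.
Proof. by rewrite /e2pi mulrN cexpN. Qed.

Lemma e2piMn (z : C) n : e2pi (n%:R * z) = e2pi z ^+ n.
Proof. by rewrite /e2pi mulrCA cexpMn. Qed.

Lemma e2pi_real (x : R) : e2pi x%:C = cos (2 * pi * x) +i* sin (2 * pi * x).
Proof.
have -> : e2pi x%:C = cexp (0 +i* (2 * pi * x)).
  by rewrite /e2pi; congr cexp; apply/eqP; rewrite eq_complex /=; apply/andP; split; apply/eqP; ring.
by rewrite /cexp /= expR0 mul1r.
Qed.

Lemma e2pi1 : e2pi (1 : C) = 1.
Proof.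
have := e2pi_real 1; rewrite rmorph1 => ->.
by rewrite mulr1 mulr_natl cos2pi sin2pi.
Qed.

Lemma e2pi_int (m : int) : e2pi (m%:~R : C) = 1.
Proof.
have en n : e2pi (n%:R : C) = 1 by rewrite -[n%:R]mulr1 e2piMn e2pi1 expr1n.
case: m => n; first exact: en.
by rewrite NegzE mulrNz e2piN en invr1.
Qed.

Lemma e2pi_neq1 (x : R) : 0 < x < 1 -> e2pi (x%:C : C) != 1.
Proof.
move=> /andP[x0 x1]; apply/eqP; rewrite e2pi_real => -[hc _].
have s0 : 0 < sin (pi * x).
  apply: sin_gt0_pi; rewrite mulr_gt0 ?pi_gt0//=.
  by rewrite -[ltRHS]mulr1 ltr_pM2l ?pi_gt0.
move: hc; rewrite (_ : 2 * pi * x = (pi * x) *+ 2); last by rewrite mulr2n; ring.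
rewrite cos_mulr2n cos2sin2 => h.
have : sin (pi * x) ^+ 2 = 0 by move: h; rewrite mulr2n; lra.
by move/eqP; rewrite expf_eq0 /= gt_eqF.
Qed.

Lemma nm_e2pi (z : C) : nm (e2pi z) = expR (- (2 * pi * Im z)).
Proof.
rewrite /e2pi nm_cexp; congr expR; rewrite -mulrA ReZ -mulrA.
by case: z => a b /=; ring.
Qed.

Definition eq_frac (q : nat) (m : int) : C := e2pi (m%:~R / q%:R).

Variable q : nat.
Hypothesis q_gt0 : (0 < q)%N.

Let qC : q%:R != 0 :> C. Proof. by rewrite pnatr_eq0 -lt0n. Qed.

Lemma eq_fracD m n : eq_frac q (m + n) = eq_frac q m * eq_frac q n.
Proof. by rewrite /eq_frac rmorphD mulrDl e2piD. Qed.

Lemma eq_frac_mod m n : (m = n %[mod q%:Z])%Z -> eq_frac q m = eq_frac q n.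
Proof.
move=> /eqP; rewrite eqz_mod_dvd => /dvdzP[l hl].
have -> : m = n + l * q%:Z by rewrite -hl; ring.
rewrite eq_fracD [X in _ * X](_ : _ = 1) ?mulr1//.
by rewrite /eq_frac rmorphM /= -pmulrn mulfK// e2pi_int.
Qed.

Lemma eq_fracMn m (n : nat) : eq_frac q (n%:Z * m) = eq_frac q m ^+ n.
Proof. by rewrite /eq_frac rmorphM /= -mulrA e2piMn. Qed.

Lemma eq_frac_neq1 m : ~~ (q%:Z %| m)%Z -> eq_frac q m != 1.
Proof.
move=> hm; rewrite -(@eq_frac_mod (m %% q%:Z)%Z m) ?modz_mod//.
have q0 : q%:Z != 0 by rewrite eqz_nat -lt0n.
have r0 : (0 <= m %% q%:Z)%Z by rewrite modz_ge0.
have r1 : (m %% q%:Z < q%:Z)%Z by rewrite ltz_pmod// ltz_nat.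
have r2 : (m %% q%:Z)%Z != 0 by apply: contra hm => /eqP h; apply/dvdz_mod0P.
move: r0 r1 r2; case: (m %% q%:Z)%Z => // r _; rewrite ltz_nat => rq r2.
rewrite /eq_frac /=.
have -> : (r%:Z%:~R / q%:R : C) = (r%:R / q%:R)%:C.
  by rewrite rmorphM fmorphV !rmorph_nat.
apply: e2pi_neq1; rewrite divr_gt0 ?ltr0n//=; last by rewrite lt0n.
by rewrite ltr_pdivrMr ?ltr0n// mul1r ltr_nat.
Qed.

Lemma sum_eq_frac m :
  \sum_(u < q) eq_frac q (u%:Z * m) = if (q%:Z %| m)%Z then q%:R else 0.
Proof.
under eq_bigr do rewrite eq_fracMn.
case: ifPn => [/dvdzP[l ->]|hm].
  have -> : eq_frac q (l * q%:Z) = 1.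
    by rewrite /eq_frac rmorphM /= -pmulrn mulfK// e2pi_int.
  under eq_bigr do rewrite expr1n.
  by rewrite sumr_const card_ord.
have h1 : eq_frac q m ^+ q = 1.
  by rewrite -eq_fracMn mulrC /eq_frac rmorphM /= -pmulrn mulfK// e2pi_int.
have := subrXX (eq_frac q m) 1 q; rewrite h1 expr1n subrr => /esym/eqP.
rewrite mulf_eq0 subr_eq0 (negbTE (eq_frac_neq1 hm)) /= => /eqP h.
rewrite -[RHS]h [RHS](reindex_inj rev_ord_inj) /=; apply: eq_bigr => i _.
rewrite [1 ^+ _]expr1n mulr1; congr (_ ^+ _); have := ltn_ord i.
move: (i : nat) q_gt0 => j; case: (q) => // p _; rewrite ltnS => ip.
by rewrite subSS /= subKn.
Qed.

Lemma sum_mod_mul (f : int -> C) (m : int) :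
  (forall a b, (a = b %[mod q%:Z])%Z -> f a = f b) -> coprimez m q%:Z ->
  \sum_(u < q) f (u%:Z * m) = \sum_(u < q) f u%:Z.
Proof.
move=> fper cop.
have q0 : q%:Z != 0 by rewrite eqz_nat -lt0n.
pose r (u : 'I_q) := (u%:Z * m %% q%:Z)%Z.
have r0 u : (0 <= r u) by rewrite modz_ge0.
have r1 u : (`|r u| < q)%N.
  by rewrite -ltz_nat gez0_abs ?r0// ltz_pmod// ltz_nat.
pose h (u : 'I_q) : 'I_q := Ordinal (r1 u).
have hinj : injective h.
  move=> u v /(congr1 val) /= e.
  have {}e : r u = r v by rewrite -(gez0_abs (r0 u)) -(gez0_abs (r0 v)) e.
  move/eqP: e; rewrite eqz_mod_dvd -mulrBl Gauss_dvdzl 1?coprimez_sym//.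
  rewrite -eqz_mod_dvd => /eqP; rewrite !modz_small ?ltz_nat ?ltn_ord//= => /eqP.
  by rewrite eqz_nat => /eqP /val_inj.
rewrite [RHS](reindex_inj hinj) /=; apply: eq_bigr => u _.
by apply: fper; rewrite gez0_abs ?r0// /r modz_mod.
Qed.

End AdditiveCharacter.

(** * Dirichlet characters and their Gauss sums *)

Section GaussSums.
Variable R : realType.
Local Notation C := R[i].
Local Notation nm := (@Normc.normc R).
Variables (q : nat) (q_gt0 : (0 < q)%N).
Implicit Types (chi : int -> C).

Lemma coprimez_modl (a d : int) : coprimez (a %% d)%Z d = coprimez a d.
Proof. by rewrite /coprimez gcdz_modl. Qed.

Lemma dirichlet_character1 chi : dirichlet_character q chi -> chi 1 = 1.
Proof.
move=> [hM _ h0]; have := hM 1 1; rewrite mulr1 => h.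
have h1 : chi 1 != 0 by rewrite h0 /coprimez gcd1z.
by apply: (mulfI h1); rewrite -h mulr1.
Qed.

Lemma dirichlet_characterX chi (m : int) n : dirichlet_character q chi ->
  chi (m ^+ n) = chi m ^+ n.
Proof.
move=> hchi; have [hM _ _] := hchi; elim: n => [|n IH].
  by rewrite !expr0 dirichlet_character1.
by rewrite !exprS hM IH.
Qed.

Lemma dirichlet_character0 chi (m : int) : dirichlet_character q chi ->
  ~~ coprimez m q%:Z -> chi m = 0.
Proof. by move=> [_ _ h0]; rewrite -h0 negbK => /eqP. Qed.

(** By Euler's theorem the value at a unit is a root of unity. *)
Lemma nm_dirichlet_character chi (m : int) : dirichlet_character q chi ->
  coprimez m q%:Z -> nm (chi m) = 1.
Proof.
move=> hchi cop; have [hM hper _] := hchi.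
have q0 : q%:Z != 0 by rewrite eqz_nat -lt0n.
pose r := `|(m %% q%:Z)%Z|%N.
have rE : r%:Z = (m %% q%:Z)%Z by rewrite /r gez0_abs// modz_ge0.
have -> : chi m = chi r%:Z by apply: hper; rewrite rE modz_mod.
have copr : coprime r q.
  by move: cop; rewrite -coprimez_modl -rE /coprimez /gcdz /= eqz_nat.
have h : chi r%:Z ^+ totient q = 1.
  rewrite -dirichlet_characterX// -(dirichlet_character1 hchi); apply: hper.
  have -> : r%:Z ^+ totient q = (r ^ totient q)%N%:Z by rewrite -!natz natrX.
  by rewrite !modz_nat (cyclic.Euler_exp_totient copr).
have : nm (chi r%:Z) ^+ totient q = 1 by rewrite -nmX h nm1.
move/eqP; rewrite pexpr_eq1 ?nm_ge0 ?totient_gt0//; first by move/eqP.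
Qed.

Lemma conj_dirichlet_characterK chi (m : int) : dirichlet_character q chi ->
  coprimez m q%:Z -> chi m * (chi m)^* = 1.
Proof.
move=> hchi cop; have := sqr_normc (chi m).
by rewrite normcE (nm_dirichlet_character hchi cop) rmorph1 expr1n.
Qed.

Lemma nm_dirichlet_character_le1 chi (m : int) : dirichlet_character q chi -> nm (chi m) <= 1.
Proof.
move=> hchi; have [h|h] := boolP (coprimez m q%:Z).
  by rewrite (nm_dirichlet_character hchi h).
by rewrite (dirichlet_character0 hchi h) nm0.
Qed.

Lemma conj_dirichlet_character chi d : dirichlet_character d chi ->
  dirichlet_character d (conj_character chi).
Proof.
move=> [hM hper h0]; split => [m n|m n /hper|n]; rewrite /conj_character.
- by rewrite hM rmorphM.
- by move->.
- by rewrite conjc_eq0 h0.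
Qed.

Lemma conj_characterK chi : conj_character (conj_character chi) = chi.
Proof. by apply/funext => n; rewrite /conj_character conjCK. Qed.

Lemma conj_primitive_character chi : primitive_character q chi ->
  primitive_character q (conj_character chi).
Proof.
move=> [h1 h2]; split; first exact: conj_dirichlet_character.
move=> [d [psi [dq lt hpsi E]]]; apply: h2; exists d, (conj_character psi).
split => //; first exact: conj_dirichlet_character.
by move=> n cop; rewrite /conj_character -E// /conj_character conjCK.
Qed.

Lemma inv_modz (a : int) : coprimez a q%:Z -> exists b : int, (a * b = 1 %[mod q%:Z])%Z.
Proof.
move=> /coprimezP[[u v] /= h]; exists u; apply/eqP; rewrite eqz_mod_dvd.
apply/dvdzP; exists (- v); rewrite mulrC -h; ring.
Qed.

(** Take m = n0 + d t, where n0 = n mod d and t is the part of q built from the primes not dividing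
    n0. Each prime dividing q then divides exactly one of n0 and d t, hence not their sum. *)
Lemma coprime_lift (d : nat) (n : int) : (0 < d)%N -> (d %| q)%N -> coprimez n d%:Z ->
  exists m : int, coprimez m q%:Z /\ (m = n %[mod d%:Z])%Z.
Proof.
move=> d0 dq cop.
have dz : d%:Z != 0 by rewrite eqz_nat -lt0n.
(* Adding d makes n0 positive, as its set of primes must be the true one; the residue alone may be 0
   when d = 1. *)
pose n0 := (`|(n %% d%:Z)%Z| + d)%N.
have n00 : (0 < n0)%N by rewrite addn_gt0 d0 orbT.
have n0E : (n0%:Z = n %[mod d%:Z])%Z.
  by rewrite /n0 PoszD gez0_abs ?modz_ge0// modzDr modz_mod.
have copn0 : coprime n0 d.
  move: cop; rewrite -coprimez_modl -n0E coprimez_modl /coprimez /gcdz /=.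
  by rewrite eqz_nat.
pose t := (q`_(\pi(n0)^'))%N.
pose m := (n0 + d * t)%N.
exists m%:Z; split; last by rewrite /m PoszD PoszM addrC mulrC modzMDl n0E.
have m0 : (0 < m)%N by rewrite addn_gt0 n00.
rewrite /coprimez /gcdz /= eqz_nat -/(coprime m q) coprime_has_primes//.
apply/hasPn => p pq; apply/negP => /= pm.
move: pq pm; rewrite !mem_primes => /and3P[pp _ pq] /and3P[_ _ pm].
have [pn|pn] := boolP (p %| n0)%N.
  have : (p %| d * t)%N by rewrite -(dvdn_addr _ pn).
  rewrite Euclid_dvdM// => /orP[pd|pt].
    have : (p %| gcdn n0 d)%N by rewrite dvdn_gcd pn pd.
    by rewrite (eqP copn0) dvdn1 => /eqP h; move: pp; rewrite h.
  have : p \in primes t by rewrite mem_primes pp pt part_gt0.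
  rewrite primes_part mem_filter => /andP[]; rewrite /= inE /= => /negP h _.
  by apply: h; rewrite mem_primes pp n00 pn.
have : p \in primes t.
  rewrite primes_part mem_filter mem_primes pp q_gt0 pq andbT /=.
  by rewrite inE /= mem_primes pp n00 (negbTE pn).
rewrite mem_primes => /and3P[_ _ pt]; move/negP: pn; apply.
by rewrite -(dvdn_addl _ (dvdn_mull d pt)).
Qed.

(** If chi were 1 on all units congruent to 1 modulo d, its value at a unit would depend only on the
    class modulo d ([key]), and chi would be induced by a character psi modulo d, against
    primitivity. *)
Lemma primitive_character_witness chi (d : nat) : primitive_character q chi ->
  (d %| q)%N -> (d < q)%N -> exists m : int,
  [/\ coprimez m q%:Z, (m = 1 %[mod d%:Z])%Z & chi m != 1].
Proof.
move=> [hchi hprim] dq dlt; have [hM hper h0] := hchi.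
have d0 : (0 < d)%N by apply: dvdn_gt0 dq.
apply: contrapT => none.
have triv m : coprimez m q%:Z -> (m = 1 %[mod d%:Z])%Z -> chi m = 1.
  by move=> c e; apply: contrapT => /eqP ne; apply: none; exists m.
have key a b : coprimez a q%:Z -> coprimez b q%:Z -> (a = b %[mod d%:Z])%Z -> chi a = chi b.
  move=> ca cb ab; have [c hc] := inv_modz ca.
  have dz : (d%:Z %| q%:Z)%Z by rewrite /dvdz.
  have acd : (a * c = 1 %[mod d%:Z])%Z.
    apply/eqP; rewrite eqz_mod_dvd; apply: (dvdz_trans dz).
    by rewrite -eqz_mod_dvd; apply/eqP.
  have chiac : chi (a * c) = 1 by rewrite (hper _ _ hc) (dirichlet_character1 hchi).
  have cc : coprimez c q%:Z.
    rewrite -h0; apply/eqP => e; move: chiac; rewrite hM e mulr0 => /esym/eqP.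
    by rewrite oner_eq0.
  have bcd : (b * c = 1 %[mod d%:Z])%Z by rewrite -acd -[LHS]modzMml -ab modzMml.
  have chibc : chi (b * c) = 1 by apply: triv => //; rewrite coprimezMl cb.
  by rewrite -[LHS]mulr1 -chibc hM mulrCA -hM chiac mulr1.
(* psi(n) will be chi at a chosen lift of n to a unit modulo q; by [key] the choice does not affect
   the value. *)
have lift (n : int) : {m : int | coprimez n d%:Z -> coprimez m q%:Z /\ (m = n %[mod d%:Z])%Z}.
  apply: cid; have [c|c] := boolP (coprimez n d%:Z); last by exists 0.
  by have [m hm] := coprime_lift d0 dq c; exists m.
pose psi n := if coprimez n d%:Z then chi (sval (lift n)) else 0.
have cop_modd a b : (a = b %[mod d%:Z])%Z -> coprimez a d%:Z = coprimez b d%:Z.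
  by move=> e; rewrite -[LHS]coprimez_modl e coprimez_modl.
have copd n : coprimez n q%:Z -> coprimez n d%:Z.
  by apply: coprimez_dvdr.
have psiP n : coprimez n d%:Z ->
    exists x, [/\ psi n = chi x, coprimez x q%:Z & (x = n %[mod d%:Z])%Z].
  move=> cn; rewrite /psi; case: (lift n) => /= x /(_ cn) [x1 x2].
  by exists x; rewrite cn.
have psi0 n : ~~ coprimez n d%:Z -> psi n = 0 by rewrite /psi; case: ifP.
apply: hprim; exists d, psi; split => //.
- split.
  + move=> m n.
    have [cm|cm] := boolP (coprimez m d%:Z); last first.
      by rewrite (psi0 m)// mul0r psi0// coprimezMl negb_and cm.
    have [cn|cn] := boolP (coprimez n d%:Z); last first.
      by rewrite (psi0 n)// mulr0 psi0// coprimezMl negb_and cn orbT.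
    have [y [-> y1 y2]] := psiP m cm; have [z [-> z1 z2]] := psiP n cn.
    have [|x [-> x1 x2]] := psiP (m * n); first by rewrite coprimezMl cm.
    rewrite -hM; apply: key => //; first by rewrite coprimezMl y1.
    by rewrite x2 -[RHS]modzMml y2 modzMml -[RHS]modzMmr z2 modzMmr.
  + move=> m n e; have [cn|cn] := boolP (coprimez n d%:Z); last first.
      by rewrite !psi0// (cop_modd _ _ e).
    have [y [-> y1 y2]] := psiP m (etrans (cop_modd _ _ e) cn).
    have [z [-> z1 z2]] := psiP n cn.
    by apply: key => //; rewrite y2 e z2.
  + move=> n; have [cn|cn] := boolP (coprimez n d%:Z); last by rewrite psi0// eqxx.
    by have [z [-> z1 _]] := psiP n cn; rewrite h0.
- move=> n cn; have [z [-> z1 z2]] := psiP n (copd _ cn).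
  by apply: key.
Qed.

Definition gauss_sum chi : C := \sum_(u < q) chi u%:Z * eq_frac R q u%:Z.

(** For a unit n, u -> u n permutes the residues. Otherwise let g = gcd(n, q) > 1 and take a unit m
    = 1 mod q/g with chi(m) different from 1: the substitution u -> u m fixes e(u n / q) and
    multiplies the sum by chi(m), so the sum is 0. *)
Lemma gauss_sum_twist chi (n : int) : primitive_character q chi ->
  \sum_(u < q) chi u%:Z * eq_frac R q (u%:Z * n) = (chi n)^* * gauss_sum chi.
Proof.
move=> hp; have [hchi _] := hp; have [hM hper h0] := hchi.
have [cop|ncop] := boolP (coprimez n q%:Z).
  have cn := conj_dirichlet_characterK hchi cop.
  rewrite /gauss_sum -(@sum_mod_mul R q q_gt0 (fun u => chi u * eq_frac R q u) n)//; last first.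
    by move=> a b ab; rewrite (hper _ _ ab) (eq_frac_mod _ q_gt0 ab).
  rewrite mulr_sumr; apply: eq_bigr => u _.
  rewrite -[LHS]mul1r -cn hM; ring.
rewrite (dirichlet_character0 hchi ncop) rmorph0 mul0r.
pose g := gcdn `|n| q.
have g0 : (0 < g)%N by rewrite gcdn_gt0 q_gt0 orbT.
have g1 : (1 < g)%N.
  by move: ncop; rewrite /coprimez /gcdz /= eqz_nat -/g; case: g g0 => [|[|]].
have gq : (g %| q)%N by rewrite dvdn_gcdr.
have [m [cm m1 chim]] : exists m : int,
    [/\ coprimez m q%:Z, (m = 1 %[mod (q %/ g)%N%:Z])%Z & chi m != 1].
  apply: primitive_character_witness => //; first by rewrite dvdn_div.
  by rewrite ltn_Pdiv.
set S := \sum_(u < q) _.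
have : chi m * S = S.
  rewrite [in RHS]/S -(@sum_mod_mul R q q_gt0 (fun u => chi u * eq_frac R q (u * n)) m)//; last first.
    move=> a b ab; rewrite (hper _ _ ab); congr (_ * _); apply: eq_frac_mod => //.
    by rewrite -[LHS]modzMml ab modzMml.
  rewrite /S mulr_sumr; apply: eq_bigr => u _; rewrite hM mulrA [chi m * _]mulrC.
  congr (_ * _); apply: eq_frac_mod => //; apply/eqP; rewrite eqz_mod_dvd.
  have -> : u%:Z * n - u%:Z * m * n = u%:Z * (n * (1 - m)) by ring.
  apply: dvdz_mull.
  have -> : q%:Z = g%:Z * (q %/ g)%N%:Z by rewrite -PoszM mulnC divnK.
  apply: dvdz_mul; first by rewrite /dvdz /=; exact: dvdn_gcdl.
  by rewrite -eqz_mod_dvd; apply/eqP.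
move/eqP; rewrite -subr_eq0 -{2}[S]mul1r -mulrBl mulf_eq0 subr_eq0 (negbTE chim) /=.
by move/eqP.
Qed.

Lemma dirichlet_characterN1 chi : dirichlet_character q chi ->
  chi (-1) * chi (-1) = 1 /\ (chi (-1))^* = chi (-1).
Proof.
move=> hchi; have [hM _ _] := hchi.
have h : chi (-1) * chi (-1) = 1 by rewrite -hM mulrNN mulr1 dirichlet_character1.
split => //; move/eqP: h; rewrite -expr2 sqrf_eq1 => /orP[] /eqP ->.
  by rewrite conjC1.
by rewrite rmorphN rmorph1.
Qed.

(** Writing chi(u) g(conj chi) as a sum over v by [gauss_sum_twist], the sum over u becomes one of
    e(u (v+1) / q), which leaves only v = q - 1. Both the nonvanishing of Gauss sums and the value
    of the root number rest on this. *)
Lemma gauss_sum_mul_conj chi : primitive_character q chi ->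
  gauss_sum chi * gauss_sum (conj_character chi) = chi (-1) * q%:R.
Proof.
move=> hp; have [hchi _] := hp.
have hp' := conj_primitive_character hp; have [hchi' _] := hp'; have [hM' hper' h0'] := hchi'.
rewrite /gauss_sum mulr_suml.
transitivity (\sum_(u < q) \sum_(v < q) conj_character chi v%:Z * eq_frac R q (u%:Z * (v%:Z + 1))).
  apply: eq_bigr => u _; have := gauss_sum_twist u%:Z hp'.
  rewrite {2}/conj_character conjCK => e.
  rewrite -mulrA mulrCA -e mulr_sumr; apply: eq_bigr => v _.
  by rewrite mulrDr mulr1 eq_fracD [u%:Z * _]mulrC; ring.
rewrite exchange_big /=.
under eq_bigr do rewrite -mulr_sumr sum_eq_frac//.
have lq : (q.-1 < q)%N by rewrite prednK.
rewrite (bigD1 (Ordinal lq)) //= big1 => [|v vq].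
  rewrite addr0 ifT; last by rewrite -PoszD addn1 prednK// dvdzz.
  congr (_ * _); have [_ <-] := dirichlet_characterN1 hchi.
  rewrite -[RHS]/(conj_character chi (-1)); apply: hper'.
  apply/eqP; rewrite eqz_mod_dvd opprK -PoszD addn1 prednK//.
rewrite ifF ?mulr0//; apply/negP; rewrite -PoszD /dvdz /= addn1 => hdv.
have : (q <= v.+1)%N by apply: dvdn_leq hdv.
rewrite leq_eqVlt ltnNge ltn_ord orbF => /eqP e.
by move/negP: vq; apply; apply/eqP; apply: val_inj; rewrite /= [X in X.-1]e.
Qed.

Lemma gauss_sum_neq0 chi : primitive_character q chi -> gauss_sum chi != 0.
Proof.
move=> hp; have [hchi _] := hp; have [hN _] := dirichlet_characterN1 hchi.
apply/eqP => g0; have := gauss_sum_mul_conj hp; rewrite g0 mul0r => /esym/eqP.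
rewrite mulf_eq0 pnatr_eq0 -[(q == 0)%N]negbK -lt0n q_gt0 orbF => /eqP e.
by move: hN; rewrite e mul0r => /esym/eqP; rewrite oner_eq0.
Qed.

Lemma normalized_gauss_sumE chi :
  normalized_gauss_sum q chi = (Num.sqrt q%:R)%:C^-1 * gauss_sum chi.
Proof. by []. Qed.

End GaussSums.

(** * Coefficient bounds for cusp forms *)

Section ModularForms.
Variable R : realType.
Local Notation C := R[i].
Local Notation Re := (@complex.Re R).
Local Notation Im := (@complex.Im R).
Local Notation nm := (@Normc.normc R).
Implicit Types (f : C -> C) (c : nat -> C).

Lemma e2pi_i (y : R) : e2pi ('i%C * y%:C) = (expR (- (2 * pi * y)))%:C.
Proof.
have -> : e2pi ('i%C * y%:C) = cexp (- (2 * pi * y))%:C.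
  by rewrite /e2pi; congr cexp; apply/eqP; rewrite eq_complex /=; apply/andP; split; apply/eqP; ring.
by rewrite cexp_real.
Qed.

Lemma sum_geo_le (r : R) m n : 0 <= r -> r < 1 ->
  \sum_(m <= i < n) r ^+ i.+1 <= r ^+ m.+1 / (1 - r).
Proof.
move=> r0 r1; have h : 0 < 1 - r by rewrite subr_gt0.
rewrite ler_pdivlMr//.
have [mn|nm'] := leqP m n; last first.
  by rewrite big_geq ?mul0r ?exprn_ge0// ltnW.
have -> : (\sum_(m <= i < n) r ^+ i.+1) * (1 - r) = r ^+ m.+1 - r ^+ n.+1.
  rewrite mulr_suml.
  under eq_bigr do rewrite mulrBr mulr1 -exprSr.
  by rewrite -opprB -[in RHS](telescope_sumr (fun i => r ^+ i.+1) mn) -sumrN; apply: eq_bigr => i _; rewrite opprB.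
by rewrite gerBl exprn_ge0.
Qed.

(** Convergence at the single point i y suffices: late partial sums lie within 1 of the limit, so
    late terms are at most 2. This exponential bound is what the polynomial one is bootstrapped
    from. *)
Lemma fourier_term_le f c (y : R) : fourier_expansion f c -> 0 < y ->
  exists K : R, 0 <= K /\
  forall n, nm (c n.+1) <= K * expR (2 * pi * (n.+1%:R * y)).
Proof.
move=> hf y0.
have hz : upper_half_plane (0 +i* y) by [].
have := hf _ hz => /cvgCP /(_ 1 ltr01) [N hN].
pose t n := c n.+1 * e2pi (n.+1%:R * (0 +i* y)).
have nt n : nm (t n) = nm (c n.+1) * expR (- (2 * pi * (n.+1%:R * y))).
  by rewrite /t nmM nm_e2pi; congr (_ * expR (- (_ * _))); rewrite -(rmorph_nat (real_complex R)) ImZ.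
have htail n : (N <= n)%N -> nm (t n) <= 2.
  move=> Nn; have -> : t n = (series t n.+1 - f (0 +i* y)) - (series t n - f (0 +i* y)).
    by rewrite opprB addrA subrK /series /= big_nat_recr//= addrC addKr.
  apply: le_trans (nmB _ _) _; rewrite (_ : 2 = 1 + 1)//.
  by apply: lerD; apply: hN => //; apply: leqW.
exists (\sum_(i < N) nm (t i) + 2); split.
  by apply: addr_ge0 => //; apply: sumr_ge0 => i _; apply: nm_ge0.
move=> n; set E := expR (2 * pi * (n.+1%:R * y)).
have -> : nm (c n.+1) = nm (t n) * E.
  by rewrite nt expRN mulfVK// gt_eqF// expR_gt0.
apply: ler_wpM2r; first exact: expR_ge0.
have s0 : 0 <= \sum_(i < N) nm (t i) by apply: sumr_ge0 => i _; apply: nm_ge0.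
have [nN|Nn] := ltnP n N; last by apply: le_trans (htail n Nn) _; rewrite lerDr.
rewrite (bigD1 (Ordinal nN))//= -addrA lerDl; apply: addr_ge0 => //.
by apply: sumr_ge0 => i _; apply: nm_ge0.
Qed.

(** Bounding the coefficients at height y0 / 2 leaves, from height y0 upwards, a geometric series of
    ratio at most [r0]; its first term carries the decay. *)
Lemma fourier_bound f c (y0 : R) : fourier_expansion f c -> 0 < y0 ->
  exists M : R, 0 <= M /\
  forall z, y0 <= Im z -> nm (f z) <= M * expR (- (2 * pi * Im z)).
Proof.
move=> hf y0p; set y1 := y0 / 2; have y1p : 0 < y1 by rewrite divr_gt0.
have [K [K0 hK]] := fourier_term_le hf y1p.
have p0 := @pi_gt0 R.
set r0 := expR (- (2 * pi * y1)).
have r01 : r0 < 1 by rewrite /r0 expR_lt1 oppr_lt0 !mulr_gt0.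
exists (K * expR (2 * pi * y1) / (1 - r0)); split.
  by rewrite divr_ge0 ?mulr_ge0 ?expR_ge0// subr_ge0 ltW.
move=> z hz; have z0 : upper_half_plane z by rewrite /upper_half_plane /=; apply: lt_le_trans hz.
set r := expR (- (2 * pi * (Im z - y1))).
have yz : y1 <= Im z - y1 by rewrite lerBrDr /y1 -splitr.
have rr0 : r <= r0.
  by rewrite ler_expR lerN2 ler_pM2l// mulr_gt0.
have rp : 0 <= r by apply: expR_ge0.
have r1 : r < 1 by apply: le_lt_trans rr0 _.
have bnd N : nm (series (fun n => c n.+1 * e2pi (n.+1%:R * z)) N) <= K * r / (1 - r0).
  rewrite /series /=; apply: le_trans (_ : \sum_(0 <= i < N) K * r ^+ i.+1 <= _).
    rewrite !big_mkord; apply: le_trans (nm_sum _ _ _) _; apply: ler_sum => n _.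
    rewrite nmM nm_e2pi -(rmorph_nat (real_complex R)) ImZ.
    apply: le_trans (ler_wpM2r (expR_ge0 _) (hK n)) _.
    rewrite -[leLHS]mulrA; apply: ler_wpM2l => //; rewrite -expRD /r -expRM_natl ler_expR.
    rewrite le_eqVlt; apply/orP; left; apply/eqP; ring.
  rewrite -mulr_sumr -mulrA; apply: ler_wpM2l => //.
  apply: le_trans (sum_geo_le _ _ rp r1) _; rewrite expr1; apply: ler_wpM2l => //.
  rewrite lef_pV2 ?posrE ?subr_gt0//; exact: lerB.
have -> : K * expR (2 * pi * y1) / (1 - r0) * expR (- (2 * pi * Im z)) = K * r / (1 - r0).
  by rewrite /r (_ : - (2 * pi * (Im z - y1)) = 2 * pi * y1 + - (2 * pi * Im z)) ?expRD; ring.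
apply/ler_addgt0Pr => e e0; have /cvgCP /(_ e e0) [N hN] := hf z z0.
rewrite -[f z](subrK (series (fun n => c n.+1 * e2pi (n.+1%:R * z)) N)) addrC.
apply: le_trans (nmD _ _) _; apply: lerD; first exact: bnd.
by rewrite nm_distC; apply: hN.
Qed.

Lemma fourier_bound_pow f c (y0 : R) A : fourier_expansion f c -> 0 < y0 ->
  exists M : R, 0 <= M /\
  forall z, y0 <= Im z -> nm (f z) * Im z ^+ A <= M.
Proof.
move=> hf y0p; have [M [M0 hM]] := fourier_bound hf y0p.
exists (M * (A`!)%:R); split; first by rewrite mulr_ge0.
move=> z hz; have z0 : 0 <= Im z by apply: le_trans hz; apply: ltW.
apply: le_trans (ler_wpM2r (exprn_ge0 _ z0) (hM z hz)) _.
rewrite -[leLHS]mulrA; apply: ler_wpM2l => //.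
have pp : Im z <= 2 * pi * Im z.
  rewrite -[leLHS]mul1r; apply: ler_wpM2r => //; have := @pi_ge2 R; lra.
have pz : 0 <= 2 * pi * Im z by apply: le_trans pp.
rewrite expRN ler_pdivrMl ?expR_gt0// [leRHS]mulrC.
apply: le_trans (expR_le_expn A pz).
by apply: lerXn2r => //; rewrite nnegrE.
Qed.

(* Dirichlet's approximation theorem with denominator c, after division by gcd(c, d) *)
Lemma dirichlet_sl2 (x y : R) : 0 < y -> y <= 1 ->
  exists a b c d : int, a * d - b * c = 1 /\
   (c%:~R * x + d%:~R) ^+ 2 + (c%:~R * y) ^+ 2 <= 5 * y.
Proof.
move=> y0 y1; pose s := Num.sqrt y.
have s0 : 0 < s by rewrite sqrtr_gt0.
have s2 : s ^+ 2 = y by rewrite sqr_sqrtr// ltW.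
have s1 : s <= 1 by rewrite -(sqrtr1 R) ler_wsqrtr.
(* N is about y^(-1/2), with 1 <= N s <= 2. Then |c x + d| <= 1/N <= s contributes y, and c y <= N
   s^2 <= 2 s contributes 4 y: this is the 5. *)
pose N := (Num.truncn s^-1).+1.
have si0 : 0 <= s^-1 by rewrite invr_ge0 ltW.
have /andP[t1 t2] := truncn_itv si0.
have Ns : 1 <= N%:R * s by rewrite -ler_pdivrMr// mul1r ltW.
have Ns2 : N%:R * s <= 2.
  rewrite /N -addn1 natrD mulrDl mul1r (_ : 2 = 1 + 1)//; apply: lerD => //.
  by rewrite -ler_pdivlMr// mul1r.
have N0 : 0 < N%:R :> R by rewrite ltr0n.
pose fr (j : nat) : R := j%:R * x - (Num.floor (j%:R * x))%:~R.
have fr0 j : 0 <= fr j by rewrite subr_ge0 floor_le.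
have fr1 j : fr j < 1 by rewrite ltrBlDl -[X in _ + X]/(1%:~R) -intrD floorD1_gt.
have hb (j : 'I_N.+1) : (Num.truncn (N%:R * fr j) < N)%N.
  have h0 : 0 <= N%:R * fr j by rewrite mulr_ge0// ltW.
  have /andP[h1 _] := truncn_itv h0.
  rewrite -(ltr_nat R); apply: le_lt_trans h1 _.
  by rewrite -[ltRHS]mulr1 ltr_pM2l.
(* Pigeonhole: N + 1 fractional parts fall into N intervals of length 1/N, so two of them differ by
   at most 1/N. *)
pose g (j : 'I_N.+1) := Ordinal (hb j).
have [i [j [ij gij]]] : exists i j : 'I_N.+1, (i < j)%N /\ g i = g j.
  apply: contrapT => none.
  have gi : injective g.
    move=> i j e; apply: val_inj; apply/eqP; rewrite eqn_leq.
    apply/andP; split; rewrite leqNgt; apply/negP => l; apply: none; [exists j, i|exists i, j]; split => //.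
  by have := leq_card g gi; rewrite !card_ord ltnn.
have frij : `|fr j - fr i| <= s.
  have e : Num.truncn (N%:R * fr i) = Num.truncn (N%:R * fr j) by move/(congr1 val): gij.
  have hi : 0 <= N%:R * fr i by rewrite mulr_ge0// ltW.
  have hj : 0 <= N%:R * fr j by rewrite mulr_ge0// ltW.
  have /andP[i1 i2] := truncn_itv hi; have /andP[j1 j2] := truncn_itv hj.
  move: i1 i2 j1 j2; rewrite e -[X in _ < X]natr1 => i1 i2 j1; rewrite -[X in _ < X]natr1 => j2.
  have h : N%:R * `|fr j - fr i| <= N%:R * s.
    apply: le_trans Ns; rewrite -[X in X * _]gtr0_norm// -normrM mulrBr ler_norml; apply/andP; split; lra.
  by move: h; rewrite ler_pM2l.
pose c : int := (j - i)%N%:Z.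
pose d : int := Num.floor (i%:R * x) - Num.floor (j%:R * x).
have cR : c%:~R = j%:R - i%:R :> R by rewrite /c -pmulrn natrB// ltnW.
have cN : c%:~R <= N%:R :> R.
  by rewrite /c -pmulrn ler_nat; apply: leq_trans (leq_subr _ _) _; rewrite -ltnS ltn_ord.
have c0 : 0 <= c%:~R :> R by rewrite /c -pmulrn.
have cne : c != 0 by rewrite /c eqz_nat subn_eq0 -ltnNge.
have cd : c%:~R * x + d%:~R = fr j - fr i.
  by rewrite cR /fr /d intrB; ring.
have bnd : (c%:~R * x + d%:~R) ^+ 2 + (c%:~R * y) ^+ 2 <= 5 * y.
  rewrite (_ : 5 * y = y + 4 * y); last by ring.
  apply: lerD.
    by rewrite cd -real_normK ?num_real// -s2 ler_pXn2r// nnegrE// ltW.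
  rewrite (_ : 4 * y = (2 * s) ^+ 2); last by rewrite exprMn s2; ring.
  have cys : c%:~R * y <= 2 * s.
    rewrite -s2 expr2 mulrA; apply: ler_wpM2r; first exact: ltW.
    by apply: le_trans Ns2; apply: ler_wpM2r => //; apply: ltW.
  rewrite ler_pXn2r// nnegrE; first by rewrite mulr_ge0// ltW.
  by rewrite mulr_ge0// ltW.
have [u [v uv]] := Bezoutz c d.
set G := gcdz c d in uv.
have G0 : G != 0 by rewrite gcdz_eq0 negb_and cne.
have Gge : (1 <= G :> int).
  by rewrite -gtz0_ge1 lt0r G0 /G /gcdz.
have /dvdzP[c' hc] : (G %| c)%Z by apply: dvdz_gcdl.
have /dvdzP[d' hd] : (G %| d)%Z by apply: dvdz_gcdr.
(* The Bezout relation u c + v d = G becomes the determinant v d' + u c' = 1, and dividing c and d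
   by G >= 1 does not increase the quadratic form. *)
exists v, (- u), c', d'; split.
  apply: (mulIf G0); rewrite mul1r -[RHS]uv hc hd; ring.
apply: le_trans bnd; rewrite hc hd !intrM.
set GR : R := G%:~R.
have G1 : 1 <= GR ^+ 2 by rewrite exprn_ege1// /GR -[1]/(1%:~R) ler_int.
rewrite [leRHS](_ : _ = ((c'%:~R * x + d'%:~R) ^+ 2 + (c'%:~R * y) ^+ 2) * GR ^+ 2); last by ring.
by rewrite -[leLHS]mulr1; apply: ler_wpM2l => //; apply: addr_ge0; apply: sqr_ge0.
Qed.

Lemma Im_div (z w : C) : w != 0 -> Im (z / w) = (Im z * Re w - Re z * Im w) / (nm w ^+ 2).
Proof.
move=> w0; have -> : nm w ^+ 2 = Re w ^+ 2 + Im w ^+ 2.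
  by case: w {w0} => a b; rewrite /Normc.normc sqr_sqrtr// addr_ge0// sqr_ge0.
case: z => a b; case: w w0 => u v w0 /=; ring.
Qed.

(** |f(z)| (Im z)^A is invariant under SL_2(Z) in weight 2A, since Im z gets divided by |w|^2 and
    f(z) multiplied by w^(2A). Writing the weight as [A.*2] keeps the exponent k/2 a natural
    number. *)
Lemma modular_bound f c A : modular A.*2 f -> fourier_expansion f c ->
  exists B : R, 0 <= B /\
  forall z, 0 < Im z -> Im z <= 1 -> nm (f z) * Im z ^+ A <= B.
Proof.
move=> hm hf; have h5 : 0 < 5^-1 :> R by rewrite invr_gt0.
have [M [M0 hM]] := fourier_bound_pow A hf h5.
exists M; split => // z z0 z1.
have [a [b [u [v [det bnd]]]]] := dirichlet_sl2 (Re z) z0 z1.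
pose w : C := u%:~R * z + v%:~R.
have Rw : Re w = u%:~R * Re z + v%:~R.
  by rewrite /w ReD -!(rmorph_int (real_complex R)) ReZ.
have Iw : Im w = u%:~R * Im z.
  by rewrite /w ImD -!(rmorph_int (real_complex R)) ImZ /= addr0.
have nw2 : nm w ^+ 2 = Re w ^+ 2 + Im w ^+ 2.
  by case: (w) => s t; rewrite /Normc.normc sqr_sqrtr// addr_ge0// sqr_ge0.
have w0 : w != 0.
  apply/eqP => e.
  have u0 : u%:~R = 0 :> R.
    by move/eqP: Iw; rewrite e /= eq_sym mulf_eq0 (gt_eqF z0) orbF => /eqP.
  have v0 : v%:~R = 0 :> R by move: Rw; rewrite e u0 mul0r add0r.
  move/eqP: u0 v0; rewrite intr_eq0 => /eqP u0 /eqP; rewrite intr_eq0 => /eqP v0.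
  by move: det; rewrite u0 v0 !mulr0 subrr.
have nw0 : 0 < nm w by rewrite nm_gt0.
have Img : Im ((a%:~R * z + b%:~R) / w) = Im z / nm w ^+ 2.
  rewrite Im_div// Rw Iw ReD ImD -!(rmorph_int (real_complex R)) ReZ ImZ /=.
  congr (_ / _).
  transitivity ((a * v - b * u)%:~R * Im z); first by rewrite intrB !intrM; ring.
  by rewrite det mul1r.
have := hm a b u v z det z0; rewrite -/w => e.
have -> : nm (f z) * Im z ^+ A = nm (f ((a%:~R * z + b%:~R) / w)) * Im ((a%:~R * z + b%:~R) / w) ^+ A.
  rewrite e Img nmM nmX exprMn exprVn -exprM -mul2n; field.
  by rewrite expf_neq0// gt_eqF.
apply: hM; rewrite Img ler_pdivlMr ?exprn_gt0// mulrC ler_pdivrMr// mulrC.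
by rewrite nw2 Rw Iw.
Qed.

End ModularForms.

(** * From bounds on f to bounds on its Fourier coefficients *)

Section FourierCoefficients.
Variable R : realType.
Local Notation C := R[i].
Local Notation Re := (@complex.Re R).
Local Notation Im := (@complex.Im R).
Local Notation nm := (@Normc.normc R).
Implicit Types (f : C -> C) (c : nat -> C).

Lemma expr_lt_eps (r e : R) (n : nat) : 0 <= r -> r < 1 -> 0 < e ->
  exists N, (n < N)%N /\ r ^+ N.+1 <= e.
Proof.
move=> r0 r1 e0.
have : (fun n => r ^+ n) @ \oo --> (0 : R) by apply: cvg_expr; rewrite ger0_norm.
move/cvgrPdist_le => /(_ e e0) [N _ hN].
exists (maxn N n).+1; split; first by rewrite ltnS leq_maxr.
have := hN (maxn N n).+2; rewrite sub0r normrN ger0_norm ?exprn_ge0//; apply.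
exact: leq_trans (leq_maxl N n) (leqW (leqnSn _)).
Qed.

Lemma e2pi_shift_frac (N j m n : nat) (y : R) : (0 < N)%N ->
  e2pi (- (n%:R * (j%:R / N%:R))) * e2pi (m%:R * (j%:R / N%:R + 'i%C * y%:C)) =
  e2pi (m%:R * ('i%C * y%:C)) * eq_frac R N (j%:Z * (m%:Z - n%:Z)).
Proof.
move=> N0; rewrite -!e2piD; congr e2pi.
by rewrite /eq_frac rmorphM rmorphB /= -!pmulrn; ring.
Qed.

(* Averaging f(j/N + iy) e(-nj/N) over j mod N isolates the coefficients with
   index n mod N; as N grows, only the n-th one survives. *)
Lemma fourier_coef_le f c (y M : R) n : fourier_expansion f c -> 0 < y ->
  (forall x, nm (f (x%:C + 'i%C * y%:C)) <= M) ->
  nm (c n.+1) * expR (- (2 * pi * (n.+1%:R * y))) <= M.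
Proof.
move=> hf y0 hM; have p0 := @pi_gt0 R.
have y1p : 0 < y / 2 by rewrite divr_gt0.
have [K [K0 hK]] := fourier_term_le hf y1p.
pose tau m := c m.+1 * e2pi (m.+1%:R * ('i%C * y%:C)).
have ntau m : nm (tau m) = nm (c m.+1) * expR (- (2 * pi * (m.+1%:R * y))).
  rewrite /tau nmM nm_e2pi; congr (_ * expR (- (_ * _))).
  by rewrite -(rmorph_nat (real_complex R)) ImZ /=; ring.
rewrite -ntau.
set r := expR (- (2 * pi * (y / 2))).
have r0 : 0 <= r by apply: expR_ge0.
have r1 : r < 1 by rewrite /r expR_lt1 oppr_lt0 !mulr_gt0.
have taule m : nm (tau m) <= K * r ^+ m.+1.
  rewrite ntau; apply: le_trans (ler_wpM2r (expR_ge0 _) (hK m)) _.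
  rewrite -[leLHS]mulrA; apply: ler_wpM2l => //; rewrite -expRD /r -expRM_natl ler_expR.
  rewrite le_eqVlt; apply/orP; left; by apply/eqP; field.
apply/ler_addgt0Pr => e e0.
have e2 : 0 < e / 2 by rewrite divr_gt0.
(* Once r^(N+1) is below this, the geometric tail K r^(N+1) / (1 - r) is at most e / 2; the
   denominator is K + 1 because K may be 0. *)
have d0 : 0 < e / 2 * (1 - r) / (K + 1).
  by rewrite divr_gt0 ?mulr_gt0 ?subr_gt0// ltr_wpDl.
have [N [nN rN]] := expr_lt_eps n.+1 r0 r1 d0.
have N0 : (0 < N)%N by apply: leq_ltn_trans nN.
have NC : N%:R != 0 :> C by rewrite pnatr_eq0 -lt0n.
have NR : 0 < N%:R :> R by rewrite ltr0n.
pose z (j : nat) : C := j%:R / N%:R + 'i%C * y%:C.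
have zE j : z j = (j%:R / N%:R)%:C + 'i%C * y%:C.
  by rewrite /z rmorphM fmorphV !rmorph_nat.
have zH j : upper_half_plane (z j) by rewrite /upper_half_plane zE /=; lra.
pose P m (j : nat) := series (fun m => c m.+1 * e2pi (m.+1%:R * z j)) m.
(* Orthogonality of the additive characters modulo N, applied to partial sums. *)
have sumP m : \sum_(j < N) e2pi (- (n.+1%:R * (j%:R / N%:R))) * P m j =
    N%:R * \sum_(i < m | (N%:Z %| i.+1%:Z - n.+1%:Z)%Z) tau i.
  transitivity (\sum_(j < N) \sum_(i < m) tau i * eq_frac R N (j%:Z * (i.+1%:Z - n.+1%:Z))).
    apply: eq_bigr => j _; rewrite /P series_ord mulr_sumr; apply: eq_bigr => i _.
    by rewrite mulrCA e2pi_shift_frac// /tau -mulrA.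
  rewrite exchange_big /= mulr_sumr [RHS]big_mkcond /=; apply: eq_bigr => i _.
  by rewrite -mulr_sumr sum_eq_frac//; case: ifP => _; rewrite ?mulr0 1?mulrC.
(* One truncation m serves all N sample points, and it is long enough to contain the n-th term. *)
have [m [nm_ hm]] : exists m, (n < m)%N /\ forall j : 'I_N, nm (P m j - f (z j)) <= e / 2.
  have hc (j : 'I_N) : exists m0, forall m, (m0 <= m)%N -> nm (P m j - f (z j)) <= e / 2.
    by have /cvgCP /(_ _ e2) := hf _ (zH j).
  have [m0 hm0] := choice hc.
  exists (\max_(j < N) m0 j + n.+1)%N; split; first by rewrite addnS ltnS leq_addl.
  move=> j; apply: hm0; apply: leq_trans (leq_addr _ _).
  by apply: (@leq_bigmax _ m0 j).
have nS : nm (\sum_(i < m | (N%:Z %| i.+1%:Z - n.+1%:Z)%Z) tau i) <= M + e / 2.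
  have : N%:R * nm (\sum_(i < m | (N%:Z %| i.+1%:Z - n.+1%:Z)%Z) tau i) <= N%:R * (M + e / 2).
    rewrite -{1}(nm_nat R N) -nmM -sumP; apply: le_trans (nm_sum _ _ _) _.
    apply: le_trans (_ : \sum_(j < N) (M + e / 2) <= _).
      apply: ler_sum => j _; rewrite nmM nm_e2pi.
      have -> : Im (- (n.+1%:R * (j%:R / N%:R))) = 0 :> R.
        rewrite ImN (_ : _ * _ = (n.+1%:R * (j%:R / N%:R))%:C) ?oppr0//.
        by rewrite !rmorphM fmorphV !rmorph_nat.
      rewrite mulr0 oppr0 expR0 mul1r -[P m j](subrK (f (z j))) addrC.
      apply: le_trans (nmD _ _) _; apply: lerD => //; rewrite zE; exact: hM.
    by rewrite sumr_const card_ord mulr_natl.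
  by rewrite ler_pM2l.
(* As n < N, any other index congruent to n modulo N is at least N, and there the geometric majorant
   is small. *)
have tail : nm (\sum_(i < m | (N%:Z %| i.+1%:Z - n.+1%:Z)%Z && (i != Ordinal nm_)) tau i) <= e / 2.
  apply: le_trans (nm_sum _ _ _) _.
  apply: le_trans (_ : \sum_(i < m | (N <= i)%N) K * r ^+ i.+1 <= _).
    rewrite big_mkcond [leRHS]big_mkcond /=; apply: ler_sum => i _.
    case: ifP => [/andP[dv ne]|_]; last first.
      by case: ifP => // _; rewrite mulr_ge0// exprn_ge0.
    rewrite ifT//.
    move: dv; rewrite /dvdz /= => dv.
    have ne' : (i : nat) != n by apply: contraNneq ne => ii; apply/eqP/val_inj.
    have d1 : (N <= `|i.+1%:Z - n.+1%:Z|)%N.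
      by apply: dvdn_leq dv; rewrite absz_gt0 subr_eq0 eqz_nat eqSS.
    rewrite leqNgt; apply/negP => iN; move: d1; rewrite leqNgt => /negP; apply.
    have [l|l] := leqP n i.
      by rewrite distnEl ?ltnS// subSS; apply: leq_ltn_trans (leq_subr _ _) iN.
    rewrite distnEr; last exact: leqW.
    by rewrite subSS; apply: leq_ltn_trans (leq_subr _ _) (ltnW nN).
  have [Nm|mN] := leqP N m; last first.
    rewrite big1 ?ltW// => i Ni; have := leq_trans mN Ni.
    by rewrite ltnNge ltnW.
  rewrite -(big_mkord (fun i => (N <= i)%N) (fun i => K * r ^+ i.+1)).
  rewrite (@big_cat_nat _ _ _ N)//= big_nat_cond big1 ?add0r => [|i]; last first.
    by move=> /andP[/andP[_ iN] Ni]; move: iN; rewrite ltnNge Ni.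
  apply: le_trans (_ : \sum_(N <= i < m) K * r ^+ i.+1 <= _).
    rewrite big_mkcond /=; apply: ler_sum => i _; case: ifP => // _.
    by rewrite mulr_ge0// exprn_ge0.
  rewrite -mulr_sumr; apply: le_trans (ler_wpM2l K0 (sum_geo_le _ _ r0 r1)) _.
  apply: le_trans (_ : (K + 1) * (r ^+ N.+1 / (1 - r)) <= _).
    by apply: ler_wpM2r; [rewrite divr_ge0 ?exprn_ge0// subr_ge0 ltW|rewrite lerDl].
  rewrite mulrA ler_pdivrMr ?subr_gt0// mulrC.
  by rewrite -ler_pdivlMr// ltr_wpDl.
have -> : tau n = \sum_(i < m | (N%:Z %| i.+1%:Z - n.+1%:Z)%Z) tau i -
   \sum_(i < m | (N%:Z %| i.+1%:Z - n.+1%:Z)%Z && (i != Ordinal nm_)) tau i.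
  by rewrite (bigD1 (Ordinal nm_)) ?subrr ?dvdz0//= addrK.
apply: le_trans (nmB _ _) _; rewrite [e]splitr addrA; exact: lerD.
Qed.

Lemma modular_coef_bound f c A : modular A.*2 f -> fourier_expansion f c ->
  exists B : R, 0 <= B /\ forall n, nm (c n.+1) <= B * n.+1%:R ^+ A.
Proof.
move=> hm hf; have [B [B0 hB]] := modular_bound hm hf.
exists (B * expR (2 * pi)); split; first by rewrite mulr_ge0 ?expR_ge0.
move=> n; have n0 : 0 < n.+1%:R :> R by rewrite ltr0n.
have y0 : 0 < n.+1%:R^-1 :> R by rewrite invr_gt0.
have := @fourier_coef_le f c n.+1%:R^-1 (B * n.+1%:R ^+ A) n hf y0.
rewrite divff ?gt_eqF// mulr1 expRN => h.
rewrite mulrAC -ler_pdivrMr ?expR_gt0//; apply: h => x.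
rewrite -ler_pdivrMr ?exprn_gt0// -exprVn.
have := hB (x%:C + 'i%C * (n.+1%:R^-1)%:C).
rewrite (_ : Im _ = n.+1%:R^-1); last by rewrite /=; ring.
by apply; rewrite // invf_le1// ler1n.
Qed.

End FourierCoefficients.

(** * Twists by primitive characters *)

Section Twist.
Variable R : realType.
Local Notation C := R[i].
Local Notation Re := (@complex.Re R).
Local Notation Im := (@complex.Im R).
Local Notation nm := (@Normc.normc R).
Variables (q : nat) (q_gt0 : (0 < q)%N).
Implicit Types (f : C -> C) (c : nat -> C) (chi : int -> C).

Let qC : q%:R != 0 :> C. Proof. by rewrite pnatr_eq0 -lt0n. Qed.

(* By gauss_sum_twist this is \sum_n c(n) chi(n) e(n i y / q). *)
Definition twist f chi (y : R) : C :=
  (gauss_sum q (conj_character chi))^-1 *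
  \sum_(u < q) conj_character chi u%:Z * f ((u%:R + 'i%C * y%:C) / q%:R).

Lemma Im_twist_arg (u : nat) (y : R) : Im ((u%:R + 'i%C * y%:C) / q%:R) = y / q%:R.
Proof.
have -> : (u%:R + 'i%C * y%:C) / q%:R = (u%:R / q%:R)%:C + 'i%C * (y / q%:R)%:C :> C.
  by rewrite mulrDl -mulrA !rmorphM fmorphV !rmorph_nat.
by rewrite /=; ring.
Qed.

Lemma twist_expansion f c chi (y : R) : fourier_expansion f c ->
  primitive_character q chi -> 0 < y ->
  series (exp_term (2 * pi / q%:R) (fun n => c n.+1 * chi n.+1%:Z) y) @ \oo -->
  twist f chi y.
Proof.
move=> hf hp y0; have hp' := conj_primitive_character hp.
have g0 := gauss_sum_neq0 q_gt0 hp'.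
pose z (u : nat) : C := (u%:R + 'i%C * y%:C) / q%:R.
have zH u : upper_half_plane (z u).
  by rewrite /upper_half_plane /= Im_twist_arg divr_gt0// ltr0n.
have := cvgZC (a := (gauss_sum q (conj_character chi))^-1)
  (@cvg_sumC R q (fun u m => conj_character chi u%:Z * series (fun n => c n.+1 * e2pi (n.+1%:R * z u)) m) _
   (fun u => cvgZC (a := conj_character chi u%:Z) (hf _ (zH u)))).
rewrite -/(twist f chi y) => h.
rewrite (_ : series _ = (fun m => (gauss_sum q (conj_character chi))^-1 * \sum_(u < q)
  conj_character chi u%:Z * series (fun n => c n.+1 * e2pi (n.+1%:R * z u)) m)) {h}//.
apply/funext => m; apply/esym.
transitivity ((gauss_sum q (conj_character chi))^-1 * \sum_(i < m)
  \sum_(u < q) conj_character chi u%:Z * (c i.+1 * e2pi (i.+1%:R * z u))).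
  congr (_ * _); rewrite exchange_big /=; apply: eq_bigr => u _.
  by rewrite series_ord mulr_sumr.
rewrite series_ord mulr_sumr; apply: eq_bigr => i _.
have ez (u : nat) : e2pi (i.+1%:R * z u) =
    eq_frac R q (u%:Z * i.+1%:Z) * (expR (- (2 * pi / q%:R * i.+1%:R * y)))%:C.
  rewrite (_ : 2 * pi / q%:R * i.+1%:R * y = 2 * pi * (i.+1%:R * y / q%:R)); last by ring.
  rewrite -e2pi_i -e2piD; congr e2pi.
  by rewrite /z intrM -!pmulrn !rmorphM fmorphV !rmorph_nat; ring.
under eq_bigr do rewrite ez.
transitivity ((gauss_sum q (conj_character chi))^-1 * (c i.+1 *
   (expR (- (2 * pi / q%:R * i.+1%:R * y)))%:C *
   \sum_(u < q) conj_character chi u%:Z * eq_frac R q (u%:Z * i.+1%:Z))).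
  by congr (_ * _); rewrite mulr_sumr; apply: eq_bigr => u _; ring.
rewrite gauss_sum_twist// /exp_term {1}/conj_character conjCK.
by field.
Qed.

Lemma neg_inv_mod (u : 'I_q) : coprimez u%:Z q%:Z ->
  exists v : 'I_q, forall w : 'I_q, (q%:Z %| u%:Z * w%:Z + 1)%Z = (w == v).
Proof.
move=> cu; have [b hb] := inv_modz cu.
have q0 : q%:Z != 0 by rewrite eqz_nat -lt0n.
pose r := ((- b) %% q%:Z)%Z.
have r0 : (0 <= r) by rewrite modz_ge0.
have rq : (`|r| < q)%N by rewrite -ltz_nat gez0_abs// ltz_pmod// ltz_nat.
exists (Ordinal rq) => w.
have hv : (q%:Z %| u%:Z * r + 1)%Z.
  rewrite (_ : _ + 1 = u%:Z * (r - (- b)) - (u%:Z * b - 1)); last by ring.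
  apply: rpredB; last by rewrite -eqz_mod_dvd; apply/eqP.
  by rewrite dvdz_mull// -eqz_mod_dvd /r modz_mod.
apply/idP/eqP => [hw|->]; last by rewrite /= gez0_abs.
apply: val_inj => /=; apply/eqP; rewrite -eqz_nat gez0_abs//.
have : (q%:Z %| u%:Z * (w%:Z - r))%Z.
  rewrite (_ : _ * _ = (u%:Z * w%:Z + 1) - (u%:Z * r + 1)); last by ring.
  exact: rpredB.
rewrite Gauss_dvdzr 1?coprimez_sym// -eqz_mod_dvd.
by rewrite !modz_small ?r0 ?ltz_nat ?ltn_ord//= /r ltz_pmod ?ltz_nat.
Qed.

(* The matrix (a, b; q, -u) with a u + b q = -1 maps (u + i/y)/q to (a + iy)/q. *)
Lemma modular_inversion k f (u v : int) (y : R) : ~~ odd k -> modular k f -> 0 < y ->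
  (q%:Z %| u * v + 1)%Z ->
  f ((u%:~R + 'i%C * (y^-1)%:C) / q%:R) =
  'i%C ^+ k * (y ^+ k)%:C * f ((v%:~R + 'i%C * y%:C) / q%:R).
Proof.
move=> ek hm y0 /dvdzP[l hl].
have yC : y%:C != 0 :> C by rewrite -(rmorph0 (real_complex R)) (inj_eq (@complexI _)) gt_eqF.
have i2 : 'i%C * 'i%C = -1 :> C by rewrite -expr2 sqr_i.
have i0 : 'i%C != 0 :> C by apply/eqP => e; move/eqP: i2; rewrite e mul0r eq_sym oppr_eq0 oner_eq0.
set z : C := (u%:~R + 'i%C * (y^-1)%:C) / q%:R.
have zH : upper_half_plane z.
  rewrite /upper_half_plane /= (_ : z = (u%:~R / q%:R)%:C + 'i%C * (y^-1 / q%:R)%:C).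
    have : 0 < y^-1 / q%:R by rewrite divr_gt0 ?invr_gt0 ?ltr0n.
    by move=> /=; lra.
  by rewrite /z mulrDl -mulrA !rmorphM !fmorphV !rmorph_nat rmorph_int.
(* From u v + 1 = l q the determinant is 1; the automorphy factor is q z - u = i / y. *)
have := hm v (- l) q%:Z (- u) z.
have -> : v * - u - - l * q%:Z = 1 by rewrite mulNr opprK -hl; ring.
move=> /(_ erefl zH).
have -> : q%:Z%:~R * z + (- u)%:~R = 'i%C / y%:C :> C.
  by rewrite -pmulrn /z mulrC divfK// rmorphN /= fmorphV; ring.
have -> : (v%:~R * z + (- l)%:~R) / ('i%C / y%:C) = (v%:~R + 'i%C * y%:C) / q%:R.
  have lE : (- l)%:~R = - ((u%:~R * v%:~R + 1) / q%:R) :> C.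
    have : (u * v + 1)%:~R = (l * q%:Z)%:~R :> C by rewrite hl.
    rewrite rmorphD !rmorphM rmorph1 /= -(pmulrn 1 q) => ->.
    by rewrite mulfK// rmorphN.
  rewrite lE /z fmorphV /=.
  transitivity (('i%C * y%:C + v%:~R * - ('i%C * 'i%C)) / q%:R / (- ('i%C * 'i%C)) : C); last first.
    by rewrite i2 opprK divr1 mulr1 addrC.
  by field; rewrite i0 yC qC.
(* Modularity yields f((v + i y)/q) = (i/y)^k f(z); solving for f(z) uses i^k i^k = (-1)^k = 1, that
   is, k even. *)
move=> ->; rewrite expr_div_n mulrA -mulrA; set F := f z.
rewrite rmorphXn /= mulrA mulrACA -exprMn.
by rewrite i2 -signr_odd (negbTE ek) expr0 divff ?expf_neq0// !mul1r.
Qed.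

Definition root_number k chi : C := 'i%C ^+ k * normalized_gauss_sum q chi ^+ 2.

Lemma normalized_gauss_sum2 chi : normalized_gauss_sum q chi ^+ 2 = gauss_sum q chi ^+ 2 / q%:R.
Proof.
rewrite normalized_gauss_sumE exprMn exprVn -rmorphXn /= sqr_sqrtr ?ler0n// rmorph_nat.
by rewrite mulrC.
Qed.

(** [modular_inversion] pairs u with v when u v = -1 mod q, and then conj chi(u) = chi(-1) chi(v).
    The constant chi(-1) / g(conj chi) equals g(chi) / q; restoring the 1 / g(chi) that belongs to
    the twist by conj chi produces g(chi)^2 / q, the square of the normalized Gauss sum. *)
Lemma twist_inversion k f chi (y : R) : ~~ odd k -> modular k f ->
  primitive_character q chi -> 0 < y ->
  twist f chi y^-1 = root_number k chi * (y ^+ k)%:C * twist f (conj_character chi) y.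
Proof.
move=> ek hm hp y0; have [hchi _] := hp; have [hM hper h0] := hchi.
have hp' := conj_primitive_character hp.
have g0 := gauss_sum_neq0 q_gt0 hp; have g0' := gauss_sum_neq0 q_gt0 hp'.
have gg := gauss_sum_mul_conj q_gt0 hp.
have [N1 N1c] := dirichlet_characterN1 hchi.
pose h (v : nat) := f ((v%:R + 'i%C * y%:C) / q%:R).
pose D (u v : 'I_q) := (q%:Z %| u%:Z * v%:Z + 1)%Z.
have Dcop (u v : 'I_q) : D u v -> coprimez u%:Z q%:Z.
  move=> /dvdzP[l hl]; apply/coprimezP; exists (- v%:Z, l) => /=.
  by rewrite -hl; ring.
have DC (u v : 'I_q) : D u v = D v u by rewrite /D mulrC.
have hD (u v : 'I_q) : D u v ->
    conj_character chi u%:Z * f ((u%:R + 'i%C * (y^-1)%:C) / q%:R) =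
    'i%C ^+ k * (y ^+ k)%:C * chi (-1) * (chi v%:Z * h v).
  move=> duv; rewrite /h.
  have := modular_inversion ek hm y0 duv; rewrite -!pmulrn => ->.
  have cu := conj_dirichlet_characterK q_gt0 hchi (Dcop _ _ duv).
  have cuv : chi u%:Z * chi v%:Z = chi (-1).
    by rewrite -hM; apply: hper; apply/eqP; rewrite eqz_mod_dvd opprK.
  have -> : conj_character chi u%:Z = chi (-1) * chi v%:Z.
    rewrite /conj_character -[LHS]mul1r -N1 -{1}cuv.
    by rewrite -[RHS]mulr1 -cu; ring.
  by ring.
have H : \sum_(u < q) conj_character chi u%:Z * f ((u%:R + 'i%C * (y^-1)%:C) / q%:R) =
    'i%C ^+ k * (y ^+ k)%:C * chi (-1) * \sum_(v < q) chi v%:Z * h v.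
  (* A unit has exactly one partner under D and the terms of non-units are 0, so the inner sum
     changes nothing; after exchanging the sums it collapses in the same way over u. *)
  transitivity (\sum_(u < q) \sum_(v < q | D u v)
     conj_character chi u%:Z * f ((u%:R + 'i%C * (y^-1)%:C) / q%:R)).
    apply: eq_bigr => u _; have [cu|cu] := boolP (coprimez u%:Z q%:Z).
      have [v hv] := neg_inv_mod cu.
      by rewrite (eq_bigl (pred1 v)) ?big_pred1_eq.
    rewrite big1 => [|v /Dcop cu']; last by rewrite cu' in cu.
    by rewrite /conj_character (dirichlet_character0 hchi cu) rmorph0 mul0r.
  transitivity (\sum_(u < q) \sum_(v < q | D u v)
     'i%C ^+ k * (y ^+ k)%:C * chi (-1) * (chi v%:Z * h v)).
    by apply: eq_bigr => u _; apply: eq_bigr => v; apply: hD.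
  rewrite (exchange_big_dep predT)//= mulr_sumr; apply: eq_bigr => v _.
  have [cv|cv] := boolP (coprimez v%:Z q%:Z).
    have [u hu] := neg_inv_mod cv.
    by rewrite (eq_bigl (pred1 u)) ?big_pred1_eq// => w; rewrite /= DC; apply: hu.
  rewrite big1 => [|u]; last by rewrite DC => /Dcop cv'; rewrite cv' in cv.
  by rewrite (dirichlet_character0 hchi cv) mul0r mulr0.
rewrite {1}/twist H /twist conj_characterK /root_number normalized_gauss_sum2.
set S := \sum_(v < q) _.
clearbody S.
have qE : q%:R = chi (-1) * (gauss_sum q chi * gauss_sum q (conj_character chi)).
  by rewrite gg mulrA N1 mul1r.
have N10 : chi (-1) != 0 by apply/eqP => e; move/eqP: N1; rewrite e mul0r eq_sym oner_eq0.
rewrite qE.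
have eN : chi (-1) = (chi (-1))^-1 by apply: (mulfI N10); rewrite N1 divff.
rewrite [in LHS]eN.
by field; rewrite N10 g0 g0'.
Qed.

Lemma root_number_conj k chi : ~~ odd k -> primitive_character q chi ->
  root_number k chi * root_number k (conj_character chi) = 1.
Proof.
move=> ek hp; have [hchi _] := hp.
have gg := gauss_sum_mul_conj q_gt0 hp.
have [N1 _] := dirichlet_characterN1 hchi.
have i2 : 'i%C * 'i%C = -1 :> C by rewrite -expr2 sqr_i.
rewrite /root_number mulrACA -exprMn i2 -signr_odd (negbTE ek) expr0 mul1r.
rewrite !normalized_gauss_sum2 mulrACA -exprMn gg exprMn expr2 N1 mul1r.
by field.
Qed.

End Twist.

(** * The twisted L-function *)

Section TwistedL.
Variable R : realType.
Local Notation C := R[i].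
Local Notation Re := (@complex.Re R).
Local Notation Im := (@complex.Im R).
Local Notation nm := (@Normc.normc R).
Variables (q : nat) (q_gt0 : (0 < q)%N) (k : nat) (k_even : ~~ odd k).
Variables (f : C -> C) (lambda : nat -> C).
Hypothesis f_modular : modular k f.
Hypothesis f_fourier :
  fourier_expansion f (fun n => lambda n * cpow n%:R ((k%:R - 1) / 2)).
Implicit Types (chi : int -> C) (s : C).

Let kappa : C := (k%:R - 1) / 2.
Let c : R := 2 * pi / q%:R.

Let c_gt0 : 0 < c.
Proof. by rewrite divr_gt0 ?mulr_gt0 ?pi_gt0 ?ltr0n. Qed.

Definition completed_L chi s : C :=
  mellin_ge1 (twist q f chi) s +
  root_number q k chi * mellin_ge1 (twist q f (conj_character chi)) (k%:R - s).

(** Defined on all of C at once; a half-plane enters only in the comparison with the series. At s +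
    kappa = 0, -1, -2, ... the last factor is 0, which gives the trivial zeros. *)
Definition twisted_L chi s : C :=
  completed_L chi (s + kappa) * cpow c (s + kappa) * (cGamma (s + kappa))^-1.

(** One B for chi and its conjugate, because [mellin_dirichlet] takes the same constants for F and
    G. The exponent k/2 is that of [modular_coef_bound]. *)
Lemma twist_exp_expansion chi : primitive_character q chi -> exists B : R, 0 <= B /\
  forall chi', chi' = chi \/ chi' = conj_character chi ->
  exp_expansion c B k./2
    (fun n => lambda n.+1 * cpow n.+1%:R kappa * chi' n.+1%:Z) (twist q f chi').
Proof.
move=> hp; have hp' := conj_primitive_character hp.
have km : modular (k./2).*2 f by rewrite halfK (negbTE k_even) subn0.
have [B [B0 hB]] := modular_coef_bound km f_fourier.
exists B; split => // chi' hchi'.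
have hpc : primitive_character q chi' by case: hchi' => ->.
split => [n|y y0]; last exact: (twist_expansion q_gt0 f_fourier hpc y0).
rewrite nmM -[leRHS]mulr1; apply: ler_pM; [exact: nm_ge0|exact: nm_ge0|exact: hB|].
by have [h _] := hpc; apply: nm_dirichlet_character_le1 h.
Qed.

Lemma completed_L_FE chi s : primitive_character q chi ->
  completed_L chi s = root_number q k chi * completed_L (conj_character chi) (k%:R - s).
Proof.
move=> hp; rewrite /completed_L conj_characterK mulrDr mulrA root_number_conj// mul1r.
by rewrite opprB addrCA subrr addr0 addrC.
Qed.

Lemma qderivable_completed_L chi s : primitive_character q chi ->
  qderivable (completed_L chi) s.
Proof.
move=> hp; have [B [B0 hB]] := twist_exp_expansion hp.
have h1 := hB chi (or_introl erefl); have h2 := hB (conj_character chi) (or_intror erefl).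
apply: qderivableD; first by have [] := mellin_ge1_qderivable s c_gt0 B0 h1.
apply: qderivableM; first exact: qderivable_cst.
apply: (@qderivable_refl R (mellin_ge1 (twist q f (conj_character chi)))).
by have [] := mellin_ge1_qderivable (k%:R - s) c_gt0 B0 h2.
Qed.

Lemma twisted_L_holomorphic chi : primitive_character q chi ->
  holomorphic_on setT (twisted_L chi).
Proof.
move=> hp s _; apply: qderivable_derivable.
apply: (@qderivable_shift R (fun z => completed_L chi z * cpow c z * (cGamma z)^-1)).
apply: qderivableM; last exact: cGamma_inv_qderivable.
by apply: qderivableM; [exact: qderivable_completed_L|exact: qderivable_cpow].
Qed.

Lemma twisted_L_series chi s : primitive_character q chi ->
  (k./2).+2%:R < Re (s + kappa) ->
  twisted_dirichlet_series lambda chi s @ \oo --> twisted_L chi s.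
Proof.
move=> hp sA; have [B [B0 hB]] := twist_exp_expansion hp.
have h1 := hB chi (or_introl erefl); have h2 := hB (conj_character chi) (or_intror erefl).
have FG y : 1 <= y -> twist q f chi y^-1 =
    root_number q k chi * (y ^+ k)%:C * twist q f (conj_character chi) y.
  by move=> y1; apply: twist_inversion => //; apply: lt_le_trans y1.
have := mellin_dirichlet c_gt0 B0 h1 h2 FG sA.
have s0 : 0 < Re (s + kappa) by apply: le_lt_trans sA.
have GE : cGamma (s + kappa) = Gamma_integral (s + kappa).
  by have := @cGammaE R (s + kappa) 0; rewrite big_ord0 divr1 !addr0; apply.
have G0 : Gamma_integral (s + kappa) != 0 by rewrite Gamma_integral_neq0.
move/(cvgZC (a := cpow c (s + kappa) * (cGamma (s + kappa))^-1)).
rewrite -/(completed_L chi (s + kappa)) => h.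
have -> : twisted_L chi s =
    cpow c (s + kappa) * (cGamma (s + kappa))^-1 * completed_L chi (s + kappa).
  by rewrite /twisted_L -[LHS]mulrA; exact: mulrC.
rewrite (_ : twisted_dirichlet_series _ _ _ = (fun n => cpow c (s + kappa) * (cGamma (s + kappa))^-1 *
  series (fun n => lambda n.+1 * cpow n.+1%:R kappa * chi n.+1%:Z *
    cpow (c * n.+1%:R) (- (s + kappa)) * Gamma_integral (s + kappa)) n))//.
apply/funext => n; rewrite /twisted_dirichlet_series !series_ord mulr_sumr.
apply: eq_bigr => i _; rewrite cpowMl ?ltr0n// !cpowN !cpowDr GE.
have n1 := cpow_neq0 c s; have n2 := cpow_neq0 c kappa.
have n3 := cpow_neq0 (i.+1%:R : R) s; have n4 := cpow_neq0 (i.+1%:R : R) kappa.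
by field; rewrite ?n1 ?n2 ?n3 ?n4 ?G0.
Qed.

Lemma twisted_L_continuation chi : primitive_character q chi ->
  analytic_continuation_L lambda chi (twisted_L chi).
Proof.
move=> hp; split; first exact: twisted_L_holomorphic.
(* For even k this abscissa is k/2 + 2 - (k-1)/2 = 5/2. *)
exists ((k./2).+2%:R - Re kappa) => s sA; apply: twisted_L_series => //.
by rewrite ReD -ltrBlDr.
Qed.

Lemma gamma_factor_ratio s : gamma_factor k (1 - s) / gamma_factor k s =
  cpow (2 * pi) (2 * s - 1) * (cGamma (1 - s + kappa) * (cGamma (s + kappa))^-1).
Proof.
have sp : (Num.sqrt pi)%:C != 0 :> C.
  by rewrite -(rmorph0 (real_complex R)) (inj_eq (@complexI _)) gt_eqF// sqrtr_gt0 pi_gt0.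
have x0 := cpow_neq0 (2 : R) ((3 - k%:R) / 2).
rewrite /gamma_factor -/kappa.
have -> : cpow (2 * pi) (2 * s - 1) = cpow (2 * pi) (- (1 - s)) / cpow (2 * pi) (- s).
  by rewrite -cpowN -cpowDr; congr cpow; ring.
have p0 := cpow_neq0 (2 * pi : R) (- s).
(* [cGamma (s + kappa)] may be 0, so its inverse is split off and kept opaque; only nonzero factors
   are cancelled. *)
rewrite [(_ * cGamma (s + kappa))^-1]invfM; set g := (cGamma _)^-1.
by field; rewrite sp x0 p0.
Qed.

(** The excluded s are those with 1 - s + kappa = -n, where Gamma(1 - s + kappa) has a pole and
    cannot be cancelled against its inverse in [twisted_L] at 1 - s. At the poles of Gamma(s +
    kappa) the identity holds as 0 = 0, since both sides carry the factor
    [(cGamma (s + kappa))^-1]. *)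
Lemma twisted_L_FE chi s : primitive_character q chi ->
  (forall n : nat, s != (k%:R + 1) / 2 + n%:R) ->
  twisted_L chi s = 'i%C ^+ k * normalized_gauss_sum q chi ^+ 2
    * cpow (q%:R : R) (1 - 2 * s)
    * (gamma_factor k (1 - s) / gamma_factor k s)
    * twisted_L (conj_character chi) (1 - s).
Proof.
move=> hp sn; rewrite gamma_factor_ratio /twisted_L -/(root_number q k chi).
have E : 1 - s + kappa = k%:R - (s + kappa) by rewrite /kappa; field.
have G0 : cGamma (1 - s + kappa) != 0.
  apply: cGamma_neq0 => n; apply: contra (sn n) => /eqP e; apply/eqP.
  have -> : s = 1 + kappa - (1 - s + kappa) by ring.
  by rewrite e /kappa; field.
rewrite completed_L_FE// -E.
have -> : cpow c (s + kappa) =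
    cpow (q%:R : R) (1 - 2 * s) * cpow (2 * pi) (2 * s - 1) * cpow c (1 - s + kappa).
  have q0 : 0 < q%:R :> R by rewrite ltr0n.
  have p2 : 0 < 2 * pi :> R by rewrite mulr_gt0 ?pi_gt0.
  rewrite -[1 - 2 * s]opprB -cpowV// -cpowMl ?invr_gt0//.
  by rewrite [_^-1 * _]mulrC -/c -cpowDr; congr cpow; rewrite /kappa; ring.
set g := (cGamma (s + kappa))^-1.
by field.
Qed.

End TwistedL.

Theorem corollary1p3 (R : realType) (k : nat) (hk6 : (6 <= k)%N)
    (hk : ~~ odd k) (r : nat) (B : 'I_r -> R[i] -> R[i])
    (lambda : 'I_r -> nat -> R[i]) (hB : hecke_basis k B lambda) (j : 'I_r)
    (q : nat) (hq : (1 <= q)%N) (chi : int -> R[i])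
    (hchi : primitive_character q chi) :
  exists L Lbar : R[i] -> R[i],
    [/\ analytic_continuation_L (lambda j) chi L,
        analytic_continuation_L (lambda j) (conj_character chi) Lbar
      & (* the excluded points are the poles of gamma_factor k (1 - s) *)
        forall s : R[i], (forall n : nat, s != (k%:R + 1) / 2 + n%:R) ->
          L s = 'i%C ^+ k * normalized_gauss_sum q chi ^+ 2
                * cpow (q%:R : R) (1 - 2 * s)
                * (gamma_factor k (1 - s) / gamma_factor k s) * Lbar (1 - s)].
Proof.
have [[cusp _] _ _ four _] := hB; have [_ modB _] := cusp j.
exists (twisted_L q k (B j) chi), (twisted_L q k (B j) (conj_character chi)).
split; first exact: twisted_L_continuation.
  by apply: twisted_L_continuation => //; apply: conj_primitive_character.
by move=> s sn; apply: twisted_L_FE.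
Qed.
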